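(* Let $k$ be an algebraically closed field of characteristic $p>0$ and $A=k[x,y]/(x^p,y^p)$, the restricted enveloping algebra of the $2$-dimensional abelian Lie algebra $\langle x,y\rangle$ with trivial restriction. Consider the four Hopf algebra structures $\{\widetilde\Delta,\Delta_1,\Delta_2,\Delta_3\}$ on $A$ (a complete set of representatives of the cocommutative Hopf algebra structures on the augmented algebra $A$ up to augmented algebra automorphism), with corresponding finite group schemes $G_i$ and tensor products $\otimes_i$. Then for any $G_i$, and any ignoble point $\mathfrak p$ for $G_i$, there exist $V,W\in\mathcal C(\mathfrak p)$ such that $V\otimes_iW$ is not isomorphic to $V\widetilde\otimes W$.
   Context: **Hopf structures.** $A=k[x,y]/(x^p,y^p)$ with augmentation $x,y\mapsto0$. Put $\omega(x)=\frac{(x\otimes1+1\otimes x)^p-(x^p\otimes1+1\otimes x^p)}{p}$, a formal division of binomial coefficients by $p$. The structures are: - $\widetilde\Delta$: $x\mapsto x\otimes1+1\otimes x$, $y\mapsto y\otimes1+1\otimes y$ (group scheme $\mathbb G_{a(1)}^2$); - $\Delta_1$: $x\mapsto x\otimes1+1\otimes x$, $y\mapsto y\otimes1+1\otimes y+\omega(x)$ (group scheme $\mathbb G_{a(2)}$); - $\Delta_2$: $x\mapsto x\otimes1+1\otimes x$, $y\mapsto y\otimes1+1\otimes y+y\otimes y$ (group scheme $\mathbb G_{a(1)}\times\mathbb Z/p$); - $\Delta_3$: $x\mapsto x\otimes1+1\otimes x+x\otimes x$, $y\mapsto y\otimes1+1\otimes y+y\otimes y$ (group scheme $(\mathbb Z/p)^2$).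 Each makes $A$ the group algebra $kG=k[G]^*$ of the indicated finite group scheme; $\widetilde\otimes,\otimes_1,\otimes_2,\otimes_3$ are the corresponding tensor products of $A$-modules. **Points and support.** $\mathscr X(A)=\operatorname{Proj}H^*(A,k)$, where $H^*(A,k)=\operatorname{Ext}^*_A(k,k)$, is the space of homogeneous primes of the reduction of this graded-commutative ring; here it is $\mathbb P^1$. A $\pi$-point of $G$ over a field extension $K/k$ is a flat map of $K$-algebras $\alpha_K:K[t]/t^p\to KG_K$ factoring through the group algebra of a unipotent abelian subgroup scheme of $G_K$. $\mathfrak p(\alpha_K)\in\mathscr X(A)$ is the radical of the kernel of $H^*(A,k)\to H^*(A_K,K)\to H^*(K[t]/t^p,K)$; every point arises this way. The closed point $[a:b]\in\mathbb P^1$ corresponds to $t\mapsto ax+by$. For a finite-dimensional $A$-module $M$, $\mathscr X(A,M)$ is the closed set of those $\mathfrak p(\alpha_K)$ for which $\alpha_K^*(M_K)$ is not projective; it does not depend on the Hopf structure. For a closed point $\mathfrak p$, $\mathcal C(\mathfrak p)$ is the full subcategory of finite-dimensional $A$-modules $M$ with $\mathscr X(A,M)\subseteq\{\mathfrak p\}$. $\mathfrak p$ is noble for $G$ if $\mathfrak p=\mathfrak p(\alpha_K)$ for some $\pi$-point $\alpha_K$ of $G$ whose image is a Hopf subalgebra of $KG_K$, and ignoble otherwise. Points $\mathfrak p$ in the claim are closed. *)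

(* Defs.v *)
From mathcomp Require Import all_boot all_order all_algebra.
From mathcomp.real_closed Require Import mxtens.

Set Implicit Arguments.
Unset Strict Implicit.
Unset Printing Implicit Defensive.

Import GRing.Theory.
Local Open Scope ring_scope.

Definition trunc (p : nat) (R : comNzRingType) := {poly %/ ('X^p : {poly R})}.

(* trunc p R is R[t]/(t^p), with t = trT p R. *)
Definition trC p (R : comNzRingType) (c : R) : trunc p R := qpolyC 'X^p c.
Definition trT p (R : comNzRingType) : trunc p R := 'qX.
Definition trcoef p (R : comNzRingType) (a : trunc p R) (i : nat) : R :=
  (a : {poly R})`_i.

(* A_R = R[x,y]/(x^p, y^p), built as (R[x]/(x^p))[y]/(y^p).  It is a functor of
   the ground ring: A p K is the base change of A p k to an extension K. *)
Definition A (p : nat) (R : comNzRingType) := trunc p (trunc p R).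

Definition AC p (R : comNzRingType) (c : R) : A p R := trC p (trC p c).
Definition Ax p (R : comNzRingType) : A p R := trC p (trT p R).
Definition Ay p (R : comNzRingType) : A p R := trT p (trunc p R).
Definition Acoef p (R : comNzRingType) (a : A p R) (i j : nat) : R :=
  trcoef (trcoef a j) i.

Definition treps p (R : comNzRingType) (a : trunc p R) : R := trcoef a 0.
Definition Aeps p (R : comNzRingType) (a : A p R) : R := Acoef a 0 0.

(* The value at (x, y) = (X, Y) of a in A_R, its coefficients being sent to S
   by f. *)
Definition Aev p (R : comNzRingType) (S : pzRingType) (f : R -> S)
    (a : A p R) (X Y : S) : S :=
  \sum_(i < p) \sum_(j < p) f (Acoef a i j) * X ^+ i * Y ^+ j.

Inductive hopf :=
  | Ga1Ga1   (* \widetilde\Delta *)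
  | Ga2      (* \Delta_1 *)
  | Ga1Zp    (* \Delta_2 *)
  | ZpZp.    (* \Delta_3 *)

(* The integers 'C(p, i) %/ p are the formal quotients appearing in omega. *)
Definition omega p (S : pzRingType) (x1 x2 : S) : S :=
  \sum_(1 <= i < p) ('C(p, i) %/ p)%:R * x1 ^+ i * x2 ^+ (p - i).

(* Delta x and Delta y as expressions in x1 = x (x) 1, y1 = y (x) 1,
   x2 = 1 (x) x, y2 = 1 (x) y.  They are evaluated both in A (x) A and in
   End(V) (x) End(W). *)
Definition coprodx (i : hopf) (S : pzRingType) (x1 x2 : S) : S :=
  match i with
  | ZpZp => x1 + x2 + x1 * x2
  | _ => x1 + x2
  end.

Definition coprody p (i : hopf) (S : pzRingType) (x1 y1 x2 y2 : S) : S :=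
  match i with
  | Ga1Ga1 => y1 + y2
  | Ga2 => y1 + y2 + omega p x1 x2
  | Ga1Zp | ZpZp => y1 + y2 + y1 * y2
  end.

Section HopfStructure.
Variables (p : nat) (F : fieldType).

(* A_F (x)_F A_F is A over the ground ring A_F: the coefficients are the first
   tensor factor. *)
Definition AA := A p (A p F).

Definition inl_AA (a : A p F) : AA := AC p a.
Definition inr_AA (a : A p F) : AA :=
  Aev (fun c => inl_AA (AC p c)) a (Ax p (A p F)) (Ay p (A p F)).

Definition coprod (i : hopf) (a : A p F) : AA :=
  let x1 := inl_AA (Ax p F) in let y1 := inl_AA (Ay p F) in
  let x2 := inr_AA (Ax p F) in let y2 := inr_AA (Ay p F) in
  Aev (fun c => inl_AA (AC p c)) a (coprodx i x1 x2) (coprody p i x1 y1 x2 y2).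

(* A variable z with z |-> z(x)1 + 1(x)z + z(x)z has 1 + z group-like of order
   p, so that 1 + S(z) = (1 + z)^-1 = (1 + z)^(p-1).  For Ga2 one has
   S(y) = - y because omega(x, - x) is a multiple of x^p = 0. *)
Definition antip_mul (z : A p F) : A p F := (1 + z) ^+ p.-1 - 1.

Definition antipx (i : hopf) : A p F :=
  match i with ZpZp => antip_mul (Ax p F) | _ => - Ax p F end.

Definition antipy (i : hopf) : A p F :=
  match i with
  | Ga1Zp | ZpZp => antip_mul (Ay p F)
  | _ => - Ay p F
  end.

Definition antip (i : hopf) (a : A p F) : A p F :=
  Aev (@AC p F) a (antipx i) (antipy i).

Definition hopf_subalgebra (i : hopf) (H : A p F -> Prop) : Prop :=
  [/\ H 1,
      forall c a b, H a -> H b -> H (AC p c * a + b),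
      forall a b, H a -> H b -> H (a * b),
      forall a, H a -> exists2 s : seq (A p F * A p F),
        (forall u, u \in s -> H u.1 /\ H u.2) &
        coprod i a = \sum_(u <- s) inl_AA u.1 * inr_AA u.2
    & forall a, H a -> H (antip i a)].

(* Closed subgroup schemes of the group scheme with group algebra A_F
   correspond to Hopf subalgebras of A_F.  All of them are abelian, A_F being
   commutative; such a subgroup scheme is unipotent iff its group algebra is
   local, i.e. iff the augmentation ideal is nil. *)
Definition unipotent (H : A p F -> Prop) : Prop :=
  forall a, H a -> Aeps a = 0 -> exists N, a ^+ N = 0.

End HopfStructure.

(* [null_tensor phi M l]: the element \sum_((s, m) <- l) s (x) m of S (x)_R M
   is zero, i.e. every balanced biadditive map kills it. *)
Definition null_tensor (R S : comNzRingType) (phi : R -> S) (M : lmodType R)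
    (l : seq (S * M)) : Prop :=
  forall (Z : zmodType) (b : S -> M -> Z),
    (forall s1 s2 m, b (s1 + s2) m = b s1 m + b s2 m) ->
    (forall s m1 m2, b s (m1 + m2) = b s m1 + b s m2) ->
    (forall r s m, b (phi r * s) m = b s (r *: m)) ->
    \sum_(u <- l) b u.1 u.2 = 0.

(* S (x)_R - preserves injections. *)
Definition flat (R S : comNzRingType) (phi : R -> S) : Prop :=
  forall (M1 M2 : lmodType R) (f : {linear M1 -> M2}), injective f ->
  forall l : seq (S * M1),
    null_tensor phi [seq (u.1, f u.2) | u <- l] -> null_tensor phi l.

(* B is an algebra over F through sg, with augmentation ep.  H^*(B, F) =
   Ext^*_B(F, F) is computed by the bar resolution: an n-cochain is an
   F-multilinear map B^n -> F, represented by a function on sequences of which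
   only the values on sequences of size n matter. *)
Section Cohomology.
Variables (F : fieldType) (B : comNzRingType) (sg : F -> B) (ep : B -> F).
Implicit Types (f g : seq B -> F) (s : seq B).

Definition cochain n f : Prop :=
  forall s1 s2 c a b, (size s1 + size s2).+1 = n ->
    f (s1 ++ (sg c * a + b) :: s2) = c * f (s1 ++ a :: s2) + f (s1 ++ b :: s2).

Definition contract (i : nat) s : seq B :=
  take i s ++ (s`_i * s`_i.+1) :: drop i.+2 s.

(* On s = [:: b_0; ...; b_n]. *)
Definition bar_d n f s : F :=
  ep s`_0 * f (behead s)
  + \sum_(i < n) (-1) ^+ i.+1 * f (contract i s)
  + (-1) ^+ n.+1 * (f (take n s) * ep s`_n).

Definition cocycle n f : Prop :=
  cochain n f /\ forall s, size s = n.+1 -> bar_d n f s = 0.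

Definition coboundary n f : Prop :=
  match n with
  | 0 => f [::] = 0
  | m.+1 => exists2 g, cochain m g &
              forall s, size s = m.+1 -> f s = bar_d m g s
  end.

Definition cup n f g : seq B -> F := fun s => f (take n s) * g (drop n s).

(* The N-th power of an n-cochain, of degree N * n. *)
Fixpoint cup_pow n f (N : nat) : seq B -> F :=
  if N is N'.+1 then cup n f (cup_pow n f N') else fun=> 1.

End Cohomology.

Section Points.
Variables (p : nat) (k : fieldType).

Let Acochain := seq (A p k) -> k.
Let Acocycle := cocycle (@AC p k) (@Aeps p k).
Let Acoboundary := coboundary (@AC p k) (@Aeps p k).

(* A set of homogeneous elements of H^*(A, k), given by the cocycles
   representing them: [I n f] is meant for f a cocycle of degree n. *)
Definition hset := nat -> Acochain -> Prop.

Definition hsub (I J : hset) : Prop :=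
  forall n f, Acocycle n f -> I n f -> J n f.

Definition heq (I J : hset) : Prop := hsub I J /\ hsub J I.

(* A homogeneous prime of H^*(A, k), determined by its homogeneous elements.
   As it contains every homogeneous nilpotent, it is the same thing as a
   homogeneous prime of the reduction. *)
Record homog_prime (I : hset) : Prop := HomogPrime {
  hp_class : forall n f g, Acocycle n f -> Acocycle n g ->
    Acoboundary n (fun s => f s - g s) -> I n f -> I n g;
  hp_zero : forall n, I n (fun=> 0);
  hp_add : forall n f g, Acocycle n f -> Acocycle n g ->
    I n f -> I n g -> I n (fun s => f s + g s);
  hp_mull : forall m n f g, Acocycle m f -> Acocycle n g ->
    I n g -> I (m + n)%N (cup m f g);
  hp_mulr : forall m n f g, Acocycle m f -> Acocycle n g ->
    I m f -> I (m + n)%N (cup m f g);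
  hp_proper : ~ I 0%N (fun=> 1);
  hp_prime : forall m n f g, Acocycle m f -> Acocycle n g ->
    I (m + n)%N (cup m f g) -> I m f \/ I n g }.

Definition relevant (I : hset) : Prop :=
  exists n f, [/\ (0 < n)%N, Acocycle n f & ~ I n f].

(* The points of X(A) = Proj H^*(A, k). *)
Definition proj_point (P : hset) : Prop := homog_prime P /\ relevant P.

(* {P} is the closed set V(Z) for some set Z of homogeneous elements. *)
Definition closed_point (P : hset) : Prop :=
  proj_point P /\
  exists Z : hset, forall Q, proj_point Q -> (hsub Z Q <-> heq Q P).

Section Extension.
Variables (K : fieldType) (iota : k -> K).

(* The K-multilinear extension to A_K of a multilinear f on A_k. *)
Fixpoint scalar_ext (f : Acochain) (s : seq (A p K)) : K :=
  if s is a :: s' then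
    \sum_(i < p) \sum_(j < p) Acoef a i j *
      scalar_ext (fun r => f (Ax p k ^+ i * Ay p k ^+ j :: r)) s'
  else iota (f [::]).

Variable alpha : trunc p K -> A p K.

Definition pullback (f : Acochain) : seq (trunc p K) -> K :=
  fun s => scalar_ext f (map alpha s).

(* The radical of the kernel of H^*(A, k) -> H^*(K[t]/t^p, K). *)
Definition point_of : hset := fun n f =>
  exists N, coboundary (@trC p K) (@treps p K) (N * n)%N
              (pullback (cup_pow n f N)).

End Extension.

End Points.

Record pi_point p (i : hopf) (K : fieldType)
    (alpha : {rmorphism trunc p K -> A p K}) : Prop := PiPoint {
  pi_linear : forall c, alpha (trC p c) = AC p c;
  pi_flat : flat alpha;
  pi_subgroup : exists H : A p K -> Prop,
    [/\ hopf_subalgebra i H, unipotent H & forall u, H (alpha u)] }.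

Definition noble p (k : fieldType) (i : hopf) (P : hset p k) : Prop :=
  exists (K : fieldType) (iota : {rmorphism k -> K})
         (alpha : {rmorphism trunc p K -> A p K}),
    [/\ pi_point i alpha,
        hopf_subalgebra i (fun a => exists u, a = alpha u)
      & heq P (point_of iota alpha)].

Definition ignoble p (k : fieldType) (i : hopf) (P : hset p k) : Prop :=
  ~ noble i P.

(* A finite-dimensional A-module: F^n (column vectors) with commuting actions
   of x and y whose p-th powers vanish. *)
Record fdmod (p : nat) (F : fieldType) := FdMod {
  mdim : nat;
  modx : 'M[F]_mdim;
  mody : 'M[F]_mdim;
  modxyC : modx * mody = mody * modx;
  modxp : modx ^+ p = 0;
  modyp : mody ^+ p = 0 }.

Definition fdmod_iso p (F : fieldType) (V W : fdmod p F) : Prop :=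
  exists (f : 'M[F]_(mdim W, mdim V)) (g : 'M[F]_(mdim V, mdim W)),
    [/\ f *m g = 1%:M, g *m f = 1%:M,
        f *m modx V = modx W *m f & f *m mody V = mody W *m f].

(* The action of t on alpha_K^*(M_K). *)
Definition restr p (k K : fieldType) (iota : k -> K)
    (alpha : trunc p K -> A p K) (M : fdmod p k) : 'M[K]_(mdim M) :=
  Aev (fun c => c%:M) (alpha (trT p K))
    (map_mx iota (modx M)) (map_mx iota (mody M)).

(* N is the action of t on a finite-dimensional K[t]/t^p-module; projectivity
   is the lifting property along surjections of such modules. *)
Definition projective p (K : fieldType) n (N : 'M[K]_n) : Prop :=
  forall m1 m2 (N1 : 'M[K]_m1) (N2 : 'M[K]_m2)
         (g : 'M[K]_(m2, m1)) (h : 'M[K]_(m2, n)),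
    N1 ^+ p = 0 -> N2 ^+ p = 0 ->
    g *m N1 = N2 *m g -> \rank g = m2 -> h *m N = N2 *m h ->
    exists2 l : 'M[K]_(m1, n), l *m N = N1 *m l & g *m l = h.

(* P belongs to X(A, M); the pi-points used are those of the given structure. *)
Definition in_support p (k : fieldType) (i : hopf) (M : fdmod p k)
    (P : hset p k) : Prop :=
  exists (K : fieldType) (iota : {rmorphism k -> K})
         (alpha : {rmorphism trunc p K -> A p K}),
    [/\ pi_point i alpha, ~ projective p (restr iota alpha M)
      & heq P (point_of iota alpha)].

(* M lies in C(P). *)
Definition supported_at p (k : fieldType) (i : hopf) (P : hset p k)
    (M : fdmod p k) : Prop :=
  forall Q, in_support i M Q -> heq Q P.

Section TensorProduct.
Variables (p : nat) (F : fieldType) (charFp : p \in [pchar F]).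

Section Nilpotence.
Variable n : nat.
Implicit Types X Y Z : 'M[F]_n.

Lemma nil_add X Y : GRing.comm X Y -> X ^+ p = 0 -> Y ^+ p = 0 ->
  (X + Y) ^+ p = 0.
Proof.
case: n X Y => [|m] X Y cXY X0 Y0; first exact: flatmx0.
have charM : p \in [pchar 'M[F]_m.+1].
  rewrite inE (pcharf_prime charFp) /=.
  by rewrite -(rmorph_nat (@scalar_mx F m.+1)) (pcharf0 charFp) raddf0.
rewrite -(pFrobenius_autE charM) pFrobenius_autD_comm //.
by rewrite !pFrobenius_autE X0 Y0 addr0.
Qed.

Lemma nil_mul X Y : GRing.comm X Y -> X ^+ p = 0 -> (X * Y) ^+ p = 0.
Proof. by move=> cXY X0; rewrite exprMn_comm // X0 mul0r. Qed.

Lemma comm_omega X Y Z : GRing.comm Z X -> GRing.comm Z Y ->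
  GRing.comm Z (omega p X Y).
Proof.
move=> cX cY; apply: commr_sum => i _; apply: commrM; last exact: commrX.
by apply: commrM; [exact: commr_nat | exact: commrX].
Qed.

Lemma nil_omega X Y : GRing.comm X Y -> X ^+ p = 0 -> omega p X Y ^+ p = 0.
Proof.
move=> cXY X0; have p_gt0 := prime_gt0 (pcharf_prime charFp).
have cYX : GRing.comm Y X by exact: commr_sym.
rewrite /omega big_nat.
suff [] : [/\ (\sum_(1 <= i < p | (1 <= i < p)%N)
                ('C(p, i) %/ p)%:R * X ^+ i * Y ^+ (p - i)) ^+ p = 0,
   GRing.comm X (\sum_(1 <= i < p | (1 <= i < p)%N)
                ('C(p, i) %/ p)%:R * X ^+ i * Y ^+ (p - i))
 & GRing.comm Y (\sum_(1 <= i < p | (1 <= i < p)%N)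
                ('C(p, i) %/ p)%:R * X ^+ i * Y ^+ (p - i))] by [].
apply: (big_rec (fun Z => [/\ Z ^+ p = 0, GRing.comm X Z & GRing.comm Y Z])).
  by split; [rewrite expr0n gtn_eqF | exact: commr0 | exact: commr0].
move=> i Z /andP[i_gt0 _] [Z0 cXZ cYZ].
have cT W : GRing.comm W X -> GRing.comm W Y ->
    GRing.comm W (('C(p, i) %/ p)%:R * X ^+ i * Y ^+ (p - i)).
  move=> cWX cWY; apply: commrM; last exact: commrX.
  by apply: commrM; [exact: commr_nat | exact: commrX].
have cX := cT X (commr_refl X) cXY; have cY := cT Y cYX (commr_refl Y).
split; [apply: nil_add => // | exact: commrD | exact: commrD].
  by apply: commr_sym; apply: cT; exact: commr_sym.
have cn W : GRing.comm (('C(p, i) %/ p)%:R : 'M[F]_n) W.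
  by apply: commr_sym; exact: commr_nat.
rewrite -mulrA exprMn_comm //.
rewrite nil_mul ?mulr0 //.
  by apply: commrX; apply: commr_sym; exact: commrX.
by rewrite exprAC X0 expr0n gtn_eqF.
Qed.

End Nilpotence.

Section Modules.
Variables (i : hopf) (V W : fdmod p F).
Local Notation m := (mdim V).
Local Notation n := (mdim W).

Let x1 : 'M[F]_(m * n) := modx V *t 1%:M.
Let y1 : 'M[F]_(m * n) := mody V *t 1%:M.
Let x2 : 'M[F]_(m * n) := 1%:M *t modx W.
Let y2 : 'M[F]_(m * n) := 1%:M *t mody W.

Definition tensx : 'M[F]_(m * n) := coprodx i x1 x2.
Definition tensy : 'M[F]_(m * n) := coprody p i x1 y1 x2 y2.

Lemma comm_tens12 (X : 'M[F]_m) (Y : 'M[F]_n) :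
  GRing.comm (X *t (1%:M : 'M[F]_n)) ((1%:M : 'M[F]_m) *t Y).
Proof. by rewrite /GRing.comm -!mulmxE !tensmx_mul !mul1mx !mulmx1. Qed.

Lemma tens1_1 : (1%:M : 'M[F]_m) *t (1%:M : 'M[F]_n) = 1.
Proof.
apply/matrixP=> u v; case: (mxtens_indexP u) => u1 u2.
case: (mxtens_indexP v) => v1 v2; rewrite tensmxE !mxE -natrM mulnb.
by rewrite (can_eq (@mxtens_indexK _ _)) xpair_eqE.
Qed.

Lemma tens1_exp (X : 'M[F]_m) e :
  (X *t (1%:M : 'M[F]_n)) ^+ e = (X ^+ e) *t (1%:M : 'M[F]_n).
Proof.
elim: e => [|e IH]; first by rewrite !expr0 tens1_1.
by rewrite !exprS IH -!mulmxE tensmx_mul mul1mx.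
Qed.

Lemma tens2_exp (Y : 'M[F]_n) e :
  ((1%:M : 'M[F]_m) *t Y) ^+ e = (1%:M : 'M[F]_m) *t (Y ^+ e).
Proof.
elim: e => [|e IH]; first by rewrite !expr0 tens1_1.
by rewrite !exprS IH -!mulmxE tensmx_mul mul1mx.
Qed.

Let x1p : x1 ^+ p = 0. Proof. by rewrite tens1_exp modxp tens0mx. Qed.
Let y1p : y1 ^+ p = 0. Proof. by rewrite tens1_exp modyp tens0mx. Qed.
Let x2p : x2 ^+ p = 0. Proof. by rewrite tens2_exp modxp tensmx0. Qed.
Let y2p : y2 ^+ p = 0. Proof. by rewrite tens2_exp modyp tensmx0. Qed.
Let x1x2 : GRing.comm x1 x2. Proof. exact: comm_tens12. Qed.
Let x1y2 : GRing.comm x1 y2. Proof. exact: comm_tens12. Qed.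
Let y1x2 : GRing.comm y1 x2. Proof. exact: comm_tens12. Qed.
Let y1y2 : GRing.comm y1 y2. Proof. exact: comm_tens12. Qed.
Let x1y1 : GRing.comm x1 y1.
Proof. by rewrite /GRing.comm -!mulmxE !tensmx_mul !mulmxE modxyC. Qed.
Let x2y2 : GRing.comm x2 y2.
Proof. by rewrite /GRing.comm -!mulmxE !tensmx_mul !mulmxE modxyC. Qed.

Let nil_gl (d : nat) (X Y : 'M[F]_d) :
  GRing.comm X Y -> X ^+ p = 0 -> Y ^+ p = 0 -> (X + Y + X * Y) ^+ p = 0.
Proof.
move=> cXY X0 Y0; apply: nil_add; [|exact: nil_add|exact: nil_mul].
have cYX : GRing.comm Y X by exact: commr_sym.
apply: commr_sym; apply: commrD; apply: commr_sym; apply: commrM => //.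
Qed.

Lemma tensxp : tensx ^+ p = 0.
Proof. by rewrite /tensx /coprodx; case: i; (exact: nil_add || exact: nil_gl). Qed.

Let comm_coprody Z : GRing.comm Z x1 -> GRing.comm Z y1 -> GRing.comm Z x2 ->
  GRing.comm Z y2 -> GRing.comm Z tensy.
Proof.
move=> cx1 cy1 cx2 cy2; rewrite /tensy /coprody.
case: i; do ?[exact: commrD | apply: commrD; last by
  [exact: comm_omega | exact: commrM]].
Qed.

Lemma tensyp : tensy ^+ p = 0.
Proof.
rewrite /tensy /coprody; case: i;
  [exact: nil_add | | exact: nil_gl | exact: nil_gl].
apply: nil_add; [|exact: nil_add|exact: nil_omega].
have x2x1 : GRing.comm x2 x1 by exact: commr_sym.
apply: comm_omega; apply: commr_sym; apply: commrD => //; exact: commr_sym.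
Qed.

Lemma tensxyC : tensx * tensy = tensy * tensx.
Proof.
have c1 : GRing.comm x1 tensy by apply: comm_coprody => //.
have c2 : GRing.comm x2 tensy by apply: comm_coprody => //; exact: commr_sym.
suff: GRing.comm tensy tensx by move/commr_sym.
rewrite [tensx]/tensx /coprodx; have c1' := commr_sym c1; have c2' := commr_sym c2.
case: i; do ?[exact: commrD]; apply: commrD; by [exact: commrD | exact: commrM].
Qed.

Definition tens : fdmod p F := FdMod tensxyC tensxp tensyp.

End Modules.
End TensorProduct.

(* Main.v *)
Require Import Defs.
From HB Require Import structures.
From mathcomp Require Import all_boot all_order all_algebra.
From mathcomp Require Import ring zify.
From mathcomp.real_closed Require Import mxtens.
From Stdlib Require Import Classical.
Import Defs.

Set Implicit Arguments.
Unset Strict Implicit.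
Unset Printing Implicit Defensive.

Import GRing.Theory.
Local Open Scope ring_scope.

(** The bar complex of B = C[y]/y^p is compared, through an explicit homotopy,
    with the period-two resolution of C over B; applied twice this shows that
    every even cocycle of A is cohomologous to a polynomial in the Bockstein
    classes zeta_x, zeta_y plus multiples of lambda_x lambda_y.  Restricting to
    t |-> T in A_K and evaluating on [t^(p-1), t, t^(p-1), ...] kills
    coboundaries, is multiplicative, and gives on even classes a form of degree
    a multiple of p in the linear part (a, b) of T; a class whose form vanishes
    is nilpotent.  Factoring these forms over the algebraically closed field k,
    every point of Proj H^*(A, k) specialises to that of some t |-> a0 x + b0 y,
    so the closed points are of this kind, and the point of a pi-point depends
    only on its linear part, which is nonzero by flatness.

    Let V = W be k[t]/t^p with x = b0 t and y = - a0 t.  The restriction of V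
    along a pi-point is projective unless the linear part of the latter is
    proportional to (a0, b0), so V is supported at the point.  The element
    a0 x + b0 y acts as zero on the tensor product for the primitive
    coproducts, and on the other three as b0^(p+1) omega(t1, t2),
    a0^2 b0 t1 t2 and a0 b0 (a0 + b0) t1 t2 respectively.  These vanish only
    where the point is noble: at x for G_a(2), at x and y for G_a(1) x Z/p, and
    at x, y and (1+x)(1+y)^(p-1) - 1, of linear part x - y, for (Z/p)^2. *)

(** A homogeneous prime is only a set of cocycles here, so membership is decided through values. Odd
    degrees reduce to even ones: the square of a class is even, and a prime containing the square
    contains the class. The alternating sequence kills coboundaries because its entries have
    augmentation zero and neighbours multiply to zero. The product lambda_x lambda_y has a nonzero
    value only for p = 2, where the square of lambda is zeta; this is why p = 2 is separated so
    often. The class zeta_y - r^p zeta_x has value (b - r)^p at t |-> x + b y, so a form must be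
    raised to the power p before it can be compared with a product of such classes.

    V is chosen so that a0 x + b0 y annihilates it: this element is primitive for the standard
    coproduct, hence annihilates the standard tensor square of V, and annihilators are invariant
    under isomorphism. For (Z/p)^2 all the points rational over the prime field are noble, but the
    obstruction a0 b0 (a0 + b0) vanishes at only three of them, and only these three need a
    subgroup. *)

Fact trC_zmod_morphism p (R : comNzRingType) : zmod_morphism (@trC p R).
Proof. exact: rmorphB. Qed.
Fact trC_monoid_morphism p (R : comNzRingType) : monoid_morphism (@trC p R).
Proof. by split; [exact: rmorph1 | exact: rmorphM]. Qed.

HB.instance Definition _ (p : nat) (R : comNzRingType) :=
  GRing.isZmodMorphism.Build R (trunc p R) (@trC p R) (@trC_zmod_morphism p R).
HB.instance Definition _ (p : nat) (R : comNzRingType) :=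
  GRing.isMonoidMorphism.Build R (trunc p R) (@trC p R) (@trC_monoid_morphism p R).

Fact AC_zmod_morphism p (R : comNzRingType) : zmod_morphism (@AC p R).
Proof. by move=> a b; rewrite /AC !rmorphB. Qed.
Fact AC_monoid_morphism p (R : comNzRingType) : monoid_morphism (@AC p R).
Proof. by split=> [|a b]; rewrite /AC ?rmorph1 ?rmorphM. Qed.

HB.instance Definition _ (p : nat) (R : comNzRingType) :=
  GRing.isZmodMorphism.Build R (A p R) (@AC p R) (@AC_zmod_morphism p R).
HB.instance Definition _ (p : nat) (R : comNzRingType) :=
  GRing.isMonoidMorphism.Build R (A p R) (@AC p R) (@AC_monoid_morphism p R).

(** * Arithmetic in [R[t]/t^p] *)

Section Truncated.
Variables (p : nat) (p_gt1 : (1 < p)%N) (R : comNzRingType).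
Implicit Types a b : trunc p R.

Lemma size_mk_trunc : size (mk_monic ('X^p : {poly R})) = p.+1.
Proof. by rewrite /mk_monic size_polyXn ltnS (ltnW p_gt1) monicXn size_polyXn. Qed.

Lemma trcoef_ge a i : (p <= i)%N -> trcoef a i = 0.
Proof. by move=> pi; apply: big_coef_npoly; rewrite size_mk_trunc. Qed.

Lemma trP a b : (forall i, (i < p)%N -> trcoef a i = trcoef b i) -> a = b.
Proof.
move=> eq_ab; apply/npolyP => i; have [/eq_ab//|pi] := ltnP i p.
by rewrite !big_coef_npoly // size_mk_trunc.
Qed.

Lemma trcoef0 i : trcoef (0 : trunc p R) i = 0. Proof. by rewrite /trcoef coef0. Qed.
Lemma trcoefD a b i : trcoef (a + b) i = trcoef a i + trcoef b i.
Proof. by rewrite /trcoef coefD. Qed.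
Lemma trcoefN a i : trcoef (- a) i = - trcoef a i.
Proof. by rewrite /trcoef coefN. Qed.
Lemma trcoefB a b i : trcoef (a - b) i = trcoef a i - trcoef b i.
Proof. by rewrite trcoefD trcoefN. Qed.
Lemma trcoef_sum (I : Type) (r : seq I) (P : pred I) (f : I -> trunc p R) i :
  trcoef (\sum_(j <- r | P j) f j) i = \sum_(j <- r | P j) trcoef (f j) i.
Proof. by apply: (big_morph (fun a => trcoef a i)) => [a b|]; rewrite ?trcoefD ?trcoef0. Qed.

Lemma trcoef_in (q : {poly R}) i :
  trcoef (in_qpoly 'X^p q : trunc p R) i = if (i < p)%N then q`_i else 0.
Proof.
rewrite /trcoef /in_qpoly /= /mk_monic size_polyXn ltnS (ltnW p_gt1) monicXn /=.
have ->: Pdiv.CommonRing.rmodp q 'X^p = take_poly p q; last by rewrite coef_take_poly.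
rewrite -[in LHS](poly_take_drop p q) addrC Pdiv.RingMonic.rmodp_addl_mul_small ?monicXn //.
by rewrite size_polyXn ltnS size_take_poly.
Qed.

Lemma trcoefC (c : R) i : trcoef (trC p c) i = if i == 0%N then c else 0.
Proof. by rewrite /trcoef /trC qpolyCE coefC. Qed.

Lemma trcoef1 i : trcoef (1 : trunc p R) i = (i == 0%N)%:R.
Proof. by rewrite -(rmorph1 (@trC p R)) trcoefC; case: eqP. Qed.

Lemma trcoefM a b i : (i < p)%N ->
  trcoef (a * b) i = \sum_(j < i.+1) trcoef a j * trcoef b (i - j).
Proof.
move=> ip; rewrite -[LHS]/(trcoef (in_qpoly 'X^p ((a : {poly R}) * b)) i).
by rewrite trcoef_in ip coefM.
Qed.

Lemma trcoefCM c b i : trcoef (trC p c * b) i = c * trcoef b i.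
Proof.
have [ip|pi] := ltnP i p; last by rewrite !trcoef_ge // mulr0.
rewrite trcoefM // big_ord_recl trcoefC subn0 big1 ?addr0 // => j _.
by rewrite trcoefC mul0r.
Qed.

Lemma trT_exp i : trT p R ^+ i = in_qpoly 'X^p 'X^i.
Proof. by rewrite rmorphXn. Qed.

Lemma trcoefTn i j : trcoef (trT p R ^+ i) j = ((j < p)%N && (j == i))%:R.
Proof. by rewrite trT_exp trcoef_in coefXn; case: ltnP. Qed.

Lemma trTn_ge i : (p <= i)%N -> trT p R ^+ i = 0.
Proof.
move=> pi; apply: trP => j jp; rewrite trcoefTn trcoef0 jp /=.
by case: eqP => // eji; move: jp; rewrite eji ltnNge pi.
Qed.

Lemma trTp : trT p R ^+ p = 0. Proof. exact: trTn_ge. Qed.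

Lemma tr_sum a : a = \sum_(i < p) trC p (trcoef a i) * trT p R ^+ i.
Proof.
apply: trP => i ip; rewrite trcoef_sum (bigD1 (Ordinal ip)) //= trcoefCM trcoefTn.
rewrite ip eqxx mulr1 big1 ?addr0 // => j /negbTE nji.
by rewrite trcoefCM trcoefTn ip /= eq_sym (_ : (j == i :> nat) = false) ?mulr0 // -nji.
Qed.

Lemma trepsM a b : treps (a * b) = treps a * treps b :> R.
Proof. by rewrite [LHS]trcoefM ?(ltnW p_gt1) // big_ord1. Qed.
Lemma treps_T : treps (trT p R) = 0.
Proof. by rewrite /treps -[trT p R]expr1 trcoefTn andbF. Qed.
Lemma treps_C (c : R) : treps (trC p c) = c.
Proof. by rewrite [LHS]trcoefC. Qed.

Definition trmk (f : nat -> R) : trunc p R := in_qpoly 'X^p (\poly_(i < p) f i).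

Lemma trcoef_mk f i : trcoef (trmk f) i = if (i < p)%N then f i else 0.
Proof. by rewrite trcoef_in coef_poly; case: ltnP. Qed.

Lemma trcoefTM a i : trcoef (trT p R * a) i =
  if (0 < i < p)%N then trcoef a i.-1 else 0.
Proof.
case: (ltnP i p) => [ip|pi]; last by rewrite andbF trcoef_ge.
rewrite trcoefM // andbT; case: i ip => [|i] ip.
  by rewrite big_ord1 -[trT p R]expr1 trcoefTn andbF mul0r.
rewrite big_ord_recl big_ord_recl -[trT p R]expr1 !trcoefTn andbF mul0r add0r /=.
rewrite p_gt1 mul1r big1 ?addr0 ?subn1 // => j _.
by rewrite trcoefTn andbF mul0r.
Qed.

Definition trdiv a : trunc p R := trmk (fun i => trcoef a i.+1).

Lemma trcoef_div a i : trcoef (trdiv a) i = trcoef a i.+1.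
Proof. by rewrite trcoef_mk; case: ltnP => // pi; rewrite trcoef_ge // leqW. Qed.

Lemma trdivD a b : trdiv (a + b) = trdiv a + trdiv b.
Proof. by apply: trP => i ip; rewrite trcoefD !trcoef_div trcoefD. Qed.

Lemma trdivCM c a : trdiv (trC p c * a) = trC p c * trdiv a.
Proof. by apply: trP => i ip; rewrite trcoefCM !trcoef_div trcoefCM. Qed.

Lemma trdivK a : a = trC p (treps a) + trT p R * trdiv a.
Proof.
apply: trP => -[|i] ip; rewrite trcoefD trcoefC trcoefTM /= ?addr0 //.
by rewrite ip trcoef_div add0r.
Qed.

(* The coefficient in degree p of the product of the representatives. *)
Definition trovf a b : R := \sum_(1 <= i < p) trcoef a i * trcoef b (p - i).

(** Division by [t] is a derivation along the augmentation, except that the term of degree p of the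
    product is zero in the quotient while [trdiv a * b] still records it in degree [p.-1]. This
    defect is the origin of the Bockstein class. *)
Lemma trdivM a b : trdiv (a * b) =
  trC p (treps a) * trdiv b + trdiv a * b - trC p (trovf a b) * trT p R ^+ p.-1.
Proof.
apply: trP => i ip; rewrite trcoefB trcoefD !trcoefCM !trcoef_div trcoefTn ip /=.
rewrite (trcoefM (trdiv a)) //.
have -> : \sum_(j < i.+1) trcoef (trdiv a) j * trcoef b (i - j) =
          \sum_(j < i.+1) trcoef a j.+1 * trcoef b (i.+1 - j.+1).
  by apply: eq_bigr => j _; rewrite trcoef_div subSS.
have p_gt0 := ltnW p_gt1; case: eqP => [ei|/eqP ni].
  have pK : p.-1.+1 = p by rewrite prednK.
  rewrite ei pK !trcoef_ge // mulr0 add0r mulr1 /trovf big_add1.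
  rewrite -(big_mkord xpredT (fun j => trcoef a j.+1 * trcoef b (p - j.+1))).
  have -> : index_iota 0 p = index_iota 0 p.-1.+1 by rewrite pK.
  by rewrite big_nat_recr //= pK (trcoef_ge a) // mul0r addr0 subrr.
have ip1 : (i.+1 < p)%N by rewrite -ltn_predRL ltn_neqAle ni -ltnS prednK ?(ltnW p_gt1).
by rewrite mulr0 subr0 trcoefM // big_ord_recl subn0.
Qed.

Lemma trcoefTM1 a : trT p R ^+ p.-1 * a = trC p (treps a) * trT p R ^+ p.-1.
Proof.
rewrite {1}[a]trdivK mulrDr [_ * trC p _]mulrC mulrA -exprSr prednK ?(ltnW p_gt1) //.
by rewrite trTp mul0r addr0.
Qed.

End Truncated.

(** * The bar complex *)

(** The base is abstract because the one-variable step is used twice: over [F], and over [F[x]/x^p],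
    which yields [A]. *)
Record augmented (F : fieldType) (B : comNzRingType) (sg : F -> B) (ep : B -> F)
  : Prop := Augmented {
  augsB : zmod_morphism sg;
  augsM : monoid_morphism sg;
  augeB : zmod_morphism ep;
  augeM : monoid_morphism ep;
  augK : cancel sg ep }.

Section BarComplex.
Variables (F : fieldType) (B : comNzRingType) (sg : F -> B) (ep : B -> F).
Implicit Types (f g h : seq B -> F) (s r : seq B).
Local Notation cochain := (cochain sg).

Lemma cochain0 f : cochain 0 f. Proof. by []. Qed.

Lemma cochainS n f : cochain n.+1 f <->
  (forall s, size s = n -> forall c a b,
     f (sg c * a + b :: s) = c * f (a :: s) + f (b :: s)) /\
  (forall a, cochain n (fun s => f (a :: s))).
Proof.
split=> [Lf|[L1 L2] [|x s1] s2 c a b /= [es]].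
- split=> [s es c a b|x s1 s2 c a b es]; first by apply: (Lf [::]); rewrite es.
  by apply: (Lf (x :: s1)); rewrite /= addSn es.
- exact: L1.
- by apply: L2.
Qed.

Lemma cochain_ext n f g : (forall s, size s = n -> f s = g s) ->
  cochain n f -> cochain n g.
Proof.
by move=> efg Lf s1 s2 c a b es; rewrite -!efg ?Lf ?size_cat //= addnS.
Qed.

Lemma cochain_lin n e f g : cochain n f -> cochain n g ->
  cochain n (fun s => e * f s + g s).
Proof. by move=> Lf Lg s1 s2 c a b es; rewrite Lf // Lg //; ring. Qed.

Lemma cochainB n f g : cochain n f -> cochain n g -> cochain n (fun s => f s - g s).
Proof. by move=> Lf Lg s1 s2 c a b es; rewrite Lf // Lg //; ring. Qed.

Lemma cochainZ n e f : cochain n f -> cochain n (fun s => e * f s).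
Proof. by move=> Lf s1 s2 c a b es; rewrite Lf //; ring. Qed.

Lemma cochain_zero n : cochain n (fun=> 0).
Proof. by move=> *; rewrite mulr0 addr0. Qed.

Lemma cochain_sum n (I : Type) (r : seq I) (f : I -> seq B -> F) :
  (forall i, cochain n (f i)) -> cochain n (fun s => \sum_(i <- r) f i s).
Proof.
move=> Lf s1 s2 c a b es; rewrite mulr_sumr -big_split /=.
by apply: eq_bigr => i _; rewrite Lf.
Qed.

Lemma cochain_cup m n f g : cochain m f -> cochain n g ->
  cochain (m + n) (cup m f g).
Proof.
elim: m f => [|m IH] f; first by move=> _ Lg s1 s2 c a b es; rewrite /cup !take0 !drop0 Lg // mulrDr mulrCA.
move=> /cochainS[L1 L2] Lg; apply/cochainS; split=> [s es c a b|a]; last first.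
  by apply: (IH (fun s => f (a :: s))) => //; apply: L2.
rewrite /cup /= L1; first by rewrite mulrDl mulrA.
by rewrite size_takel // es leq_addr.
Qed.

(* The terms of [bar_d] that do not have the first entry of s as a factor. *)
Fixpoint bar_tail f s : F :=
  match s with
  | [::] => 0
  | b :: s' => if s' is c :: s'' then
        - f (b * c :: s'') - bar_tail (fun r => f (b :: r)) s'
      else - (ep b * f [::])
  end.

Arguments bar_tail : simpl never.

Lemma bar_tail0 f : bar_tail f [::] = 0. Proof. by []. Qed.
Lemma bar_tail1 f b : bar_tail f [:: b] = - (ep b * f [::]). Proof. by []. Qed.
Lemma bar_tailS f b c s : bar_tail f (b :: c :: s) =
  - f (b * c :: s) - bar_tail (fun r => f (b :: r)) (c :: s).
Proof. by []. Qed.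

(** The recursive form lets inductions peel off one entry at a time. Without the first term, the
    differential is that of the bar resolution, the head being a coefficient in [B]. *)
Lemma bar_dE n f b s : size s = n ->
  bar_d ep n f (b :: s) = ep b * f s + bar_tail f (b :: s).
Proof.
elim: n f b s => [|n IH] f b [|c s] //=.
  by move=> _; rewrite /bar_d big_ord0 /= addr0 bar_tail1 expr1 mulN1r mulrC.
case=> es; have {IH} := IH (fun r => f (b :: r)) c s es.
rewrite /bar_d /= => IH.
have tailE : bar_tail (fun r => f (b :: r)) (c :: s) =
  \sum_(i < n) (-1) ^+ i.+1 * f (b :: contract i (c :: s)) +
  (-1) ^+ n.+1 * (f (b :: take n (c :: s)) * ep (c :: s)`_n).
  by apply: (addrI (ep c * f (b :: s))); rewrite -IH addrA.
rewrite bar_tailS tailE big_ord_recl /= expr1 mulN1r /contract /= drop0.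
rewrite opprD -!addrA; congr (_ + (_ + _)); congr (_ + _).
  by rewrite -sumrN; apply: eq_bigr => i _; rewrite /= exprS mulN1r mulNr.
by rewrite [in LHS]exprS mulN1r mulNr.
Qed.

Lemma eq_bar_tail f g s :
  (forall r, (size r).+1 = size s -> f r = g r) -> bar_tail f s = bar_tail g s.
Proof.
elim: s f g => [|b [|c s] IH] f g efg //.
  by rewrite !bar_tail1 efg.
rewrite !bar_tailS efg // (IH _ (fun r => g (b :: r))) // => r er.
by apply: efg; rewrite /= er.
Qed.

Lemma bar_tail_lin e f g s :
  bar_tail (fun r => e * f r + g r) s = e * bar_tail f s + bar_tail g s.
Proof.
elim: s f g => [|b [|c s] IH] f g; rewrite ?bar_tail0 ?bar_tail1 ?bar_tailS ?IH; ring.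
Qed.

Lemma bar_tailZ e f s : bar_tail (fun r => e * f r) s = e * bar_tail f s.
Proof.
elim: s f => [|b [|c s] IH] f; rewrite ?bar_tail0 ?bar_tail1 ?bar_tailS ?IH; ring.
Qed.

Lemma bar_tailB f g s : bar_tail (fun r => f r - g r) s = bar_tail f s - bar_tail g s.
Proof.
elim: s f g => [|b [|c s] IH] f g; rewrite ?bar_tail0 ?bar_tail1 ?bar_tailS ?IH; ring.
Qed.

Lemma bar_tail_sum (I : Type) (l : seq I) (f : I -> seq B -> F) s :
  bar_tail (fun r => \sum_(i <- l) f i r) s = \sum_(i <- l) bar_tail (f i) s.
Proof.
elim: s f => [|b [|c s] IH] f.
- by rewrite big1.
- by rewrite bar_tail1 mulr_sumr -sumrN.
- by rewrite bar_tailS IH -!sumrN -big_split.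
Qed.

(** Multiplication of the head by [a] commutes with [bar_tail], as the differential of the bar
    resolution is [B]-linear. *)
Lemma bar_tail_head a f g b s : ep (a * b) = ep a * ep b ->
  (forall u r, (size r).+1 = size s -> g (u :: r) = f (a * u :: r)) ->
  (s = [::] -> g [::] = ep a * f [::]) ->
  bar_tail g (b :: s) = bar_tail f (a * b :: s).
Proof.
case: s => [|c s] epM eg g0; first by rewrite !bar_tail1 epM g0 //; ring.
rewrite !bar_tailS eg // mulrA; congr (_ - _).
by apply: eq_bar_tail => r er; apply: eg; rewrite -er.
Qed.

End BarComplex.

Arguments bar_tail : simpl never.

(** * A homotopy for truncated polynomial algebras *)

Section Truncation.
Variables (p : nat) (p_gt1 : (1 < p)%N) (F : fieldType) (C : comNzRingType).
Variables (sg : F -> C) (ep : C -> F) (aug : augmented sg ep).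

Definition tr_sg (c : F) : trunc p C := trC p (sg c).
Definition tr_ep (b : trunc p C) : F := ep (treps b).

Lemma tr_augmented : augmented tr_sg tr_ep.
Proof.
have [sB [s1 sM] eB [e1 eM] K] := aug.
split.
- by move=> a b; rewrite /tr_sg sB rmorphB.
- by split=> [|a b]; rewrite /tr_sg ?s1 ?sM ?rmorph1 ?rmorphM.
- by move=> a b; rewrite /tr_ep /treps trcoefB eB.
- by split=> [|a b]; rewrite /tr_ep ?trepsM ?eM // /treps trcoef1.
- by move=> c; rewrite /tr_ep /tr_sg treps_C K.
Qed.

Local Notation B := (trunc p C).
Local Notation t := (trT p C).
Local Notation cochain := (cochain tr_sg).
Local Notation bar_tail := (bar_tail tr_ep).
Implicit Types (f g h : seq B -> F) (s r : seq B).

Let eB : zmod_morphism ep. Proof. by case: aug. Qed.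
Let eM a b : ep (a * b) = ep a * ep b. Proof. by case: aug => _ _ _ [_ ->]. Qed.
Let e1 : ep 1 = 1. Proof. by case: aug => _ _ _ []. Qed.
Let e0 : ep 0 = 0. Proof. by rewrite -(subrr 0) eB subrr. Qed.
Let eD a b : ep (a + b) = ep a + ep b.
Proof. by rewrite -{1}[b]opprK -[- b]sub0r !eB e0 sub0r opprK. Qed.

Lemma tr_epM a b : tr_ep (a * b) = tr_ep a * tr_ep b.
Proof. by rewrite /tr_ep trepsM // eM. Qed.

Definition tr_proj (b : B) : B := trC p (treps b).

(** [B] is free over [C] on the powers of [t]. In each term of the expansion of [w], the power of
    [t] is split off as a new entry; then, with the opposite sign, it is pushed into the next entry,
    which is split in turn while the coefficient in [C] stays behind. *)
Fixpoint tr_htpy f (w : B) s : F :=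
  \sum_(j < p) (f (trC p (trcoef w j) :: t ^+ j :: s) -
    if s is b :: s' then
      tr_htpy (fun r => f (trC p (trcoef w j) :: r)) (t ^+ j * b) s'
    else 0).

Lemma tr_htpy_nil f w :
  tr_htpy f w [::] = \sum_(j < p) f [:: trC p (trcoef w j); t ^+ j].
Proof. by apply: eq_bigr => j _; rewrite subr0. Qed.

Lemma tr_htpy_cons f w b s : tr_htpy f w (b :: s) =
  \sum_(j < p) (f (trC p (trcoef w j) :: t ^+ j :: b :: s) -
      tr_htpy (fun r => f (trC p (trcoef w j) :: r)) (t ^+ j * b) s).
Proof. by []. Qed.

Arguments tr_htpy : simpl never.

Definition tr_Htpy f s : F := if s is w :: s' then tr_htpy f w s' else 0.

Lemma tr_htpy_linf e f g h w s :
  (forall c u r, size r = size s -> f (trC p c :: u :: r) =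
     e * g (trC p c :: u :: r) + h (trC p c :: u :: r)) ->
  tr_htpy f w s = e * tr_htpy g w s + tr_htpy h w s.
Proof.
elim: s f g h w => [|b s IH] f g h w efg.
  rewrite !tr_htpy_nil mulr_sumr -big_split.
  by apply: eq_bigr => j _; rewrite efg.
rewrite !tr_htpy_cons mulr_sumr -big_split; apply: eq_bigr => j _ /=.
rewrite (IH _ (fun r => g (trC p (trcoef w j) :: r))
            (fun r => h (trC p (trcoef w j) :: r))); last first.
  by move=> c u r er; apply: efg; rewrite /= er.
by rewrite efg //; ring.
Qed.

Lemma tr_htpyN f w s : tr_htpy (fun r => - f r) w s = - tr_htpy f w s.
Proof.
elim: s f w => [|b s IH] f w; first by rewrite !tr_htpy_nil sumrN.
by rewrite !tr_htpy_cons -sumrN; apply: eq_bigr => j _; rewrite IH; ring.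
Qed.

Lemma tr_htpyCM f c w s :
  tr_htpy f (trC p c * w) s =
  tr_htpy (fun r => if r is u :: r' then f (trC p c * u :: r') else 0) w s.
Proof.
have E j : trC p (trcoef (trC p c * w) j) = trC p c * trC p (trcoef w j).
  by rewrite trcoefCM // rmorphM.
case: s => [|b s]; first by rewrite !tr_htpy_nil; apply: eq_bigr => j _; rewrite E.
by rewrite !tr_htpy_cons; apply: eq_bigr => j _; rewrite E.
Qed.

Lemma tr_Htpy_cochain m f : cochain m.+2 f -> cochain m.+1 (tr_Htpy f).
Proof.
elim: m f => [|m IH] f Lf; have /cochainS[L1 L2] := Lf; apply/cochainS; split.
- move=> [] // _ c a b /=; rewrite !tr_htpy_nil mulr_sumr -big_split /=.
  by apply: eq_bigr => j _; rewrite trcoefD trcoefCM // rmorphD rmorphM L1.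
- by move=> a; exact: cochain0.
- move=> [|u s] //= [es] c a b; rewrite !tr_htpy_cons mulr_sumr -big_split /=.
  apply: eq_bigr => j _; rewrite trcoefD trcoefCM // rmorphD rmorphM.
  set f3 := fun r => f (_ :: r).
  rewrite (tr_htpy_linf (e := c) (g := fun r => f (trC p (trcoef a j) :: r))
            (h := fun r => f (trC p (trcoef b j) :: r))).
    by rewrite L1 /= ?es //; ring.
  by move=> c' u' r er; rewrite /f3 L1 //= er es.
- move=> w; rewrite /tr_Htpy.
  have Lj j := IH _ (L2 (trC p (trcoef w j))).
  have Nj j : cochain m.+1 (fun r => f (trC p (trcoef w j) :: t ^+ j :: r)).
    by have /cochainS[_ K2] := L2 (trC p (trcoef w j)); exact: K2.
  apply/cochainS; split=> [s es c a b|a].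
    rewrite !tr_htpy_cons mulr_sumr -big_split /=.
    apply: eq_bigr => j _; have /cochainS[M1 _] := Lj j.
    have /cochainS[N1 _] := Nj j; rewrite N1 // mulrDr mulrCA.
    by have := M1 s es c (t ^+ j * a) (t ^+ j * b) => /= ->; ring.
  apply: cochain_sum => j; apply: cochainB.
    by have /cochainS[_ N2] := Nj j; exact: N2.
  by have /cochainS[_ M2] := Lj j; exact: M2.
Qed.

Lemma tr_htpy0 f s : cochain (size s).+2 f -> tr_htpy f 0 s = 0.
Proof.
move=> /tr_Htpy_cochain/cochainS[L _]; have := L s erefl (-1) 0 0.
by rewrite mulr0 addr0 /= mulN1r addNr.
Qed.

Lemma tr_htpy_sum (I : Type) (l : seq I) (w : I -> B) f s :
  cochain (size s).+2 f ->
  tr_htpy f (\sum_(i <- l) w i) s = \sum_(i <- l) tr_htpy f (w i) s.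
Proof.
move=> Lf; have /cochainS[L _] := tr_Htpy_cochain Lf.
apply: (big_morph (fun w => tr_htpy f w s)) => [a b|]; last exact: tr_htpy0.
have := L s erefl 1 a b; have [_ [s1 _] _ _ _] := tr_augmented.
by rewrite s1 !mul1r.
Qed.

Lemma cochain_sum_head (I : Type) (l : seq I) (w : I -> B) f s :
  cochain (size s).+1 f -> f (\sum_(i <- l) w i :: s) = \sum_(i <- l) f (w i :: s).
Proof.
move=> /cochainS[L _]; have [_ [s1 _] _ _ _] := tr_augmented.
apply: (big_morph (fun w => f (w :: s))) => [a b|].
  by have := L s erefl 1 a b; rewrite s1 !mul1r.
by have := L s erefl (-1) 0 0; rewrite mulr0 addr0 mulN1r addNr.
Qed.

(* [tr_htpy] is a homotopy between the identity and the projection onto C of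
   the B-bar complex, head entries being the B-coefficients. *)
Lemma tr_htpyE f w s : cochain (size s).+1 f ->
  tr_htpy (bar_tail f) w s + bar_tail (tr_Htpy f) (w :: s) =
  - f (w :: s) + f (tr_proj w :: map tr_proj s).
Proof.
have p_gt0 := ltnW p_gt1.
have projt j : tr_proj (t ^+ j) = (j == 0%N)%:R.
  rewrite /tr_proj /treps trcoefTn // p_gt0 eq_sym.
  by case: eqP => _; rewrite ?rmorph1 ?rmorph0.
elim: s f w => [|b s IH] f w Lf.
  rewrite tr_htpy_nil bar_tail1 mulr0 subr0.
  have E (j : 'I_p) : bar_tail f [:: trC p (trcoef w j); t ^+ j] =
      - f [:: trC p (trcoef w j) * t ^+ j] +
      (if j == Ordinal p_gt0 then f [:: tr_proj w] else 0).
    rewrite bar_tailS bar_tail1 opprK /tr_ep /treps trcoefTn // p_gt0 /= eq_sym.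
    rewrite -val_eqE /=; case: eqP => [->|_]; last by rewrite e0 mul0r.
    by rewrite e1 mul1r.
  rewrite (eq_bigr _ (fun j _ => E j)) big_split sumrN /= -cochain_sum_head //.
  by rewrite -(tr_sum p_gt1) -big_mkcond big_pred1_eq.
have [L1 L2] := (cochainS _ _ _).1 Lf.
rewrite tr_htpy_cons bar_tailS.
pose c j := trC p (trcoef w j).
(* The induction hypothesis is used for [f (c j :: _)] at the head [t ^+ j * b]. Summed over j, the
   terms reassemble [w] in [F1] and [F2], and in [F4] the projection onto [C] leaves only j = 0. *)
have E (j : 'I_p) : bar_tail f [:: c j, t ^+ j, b & s] -
   tr_htpy (fun r => bar_tail f (c j :: r)) (t ^+ j * b) s =
   - f (c j * t ^+ j :: b :: s) + tr_htpy f (c j * (t ^+ j * b)) s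
   + (bar_tail (fun r => f (c j :: t ^+ j :: r)) (b :: s)
      - bar_tail (tr_Htpy (fun r => f (c j :: r))) (t ^+ j * b :: s))
   + f (c j :: tr_proj (t ^+ j * b) :: map tr_proj s).
  rewrite bar_tailS bar_tailS.
  rewrite (@tr_htpy_linf (-1) _
    (fun r => if r is u :: r' then f (c j * u :: r') else 0)
    (fun r => - bar_tail (fun r => f (c j :: r)) r)); last first.
    by move=> c' u r er; rewrite bar_tailS; ring.
  rewrite -tr_htpyCM tr_htpyN.
  have IHj : tr_htpy (bar_tail (fun r => f (c j :: r))) (t ^+ j * b) s =
    - bar_tail (tr_Htpy (fun r => f (c j :: r))) (t ^+ j * b :: s)
    - f (c j :: t ^+ j * b :: s) + f (c j :: tr_proj (t ^+ j * b) :: map tr_proj s).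
    apply: (addIr (bar_tail (tr_Htpy (fun r => f (c j :: r))) (t ^+ j * b :: s))).
    by rewrite IH //; ring.
  by rewrite IHj; ring.
have F1 : \sum_(j < p) - f (c j * t ^+ j :: b :: s) = - f (w :: b :: s).
  by rewrite sumrN -cochain_sum_head // -(tr_sum p_gt1).
have F2 : \sum_(j < p) tr_htpy f (c j * (t ^+ j * b)) s = tr_htpy f (w * b) s.
  rewrite -tr_htpy_sum // [in RHS](tr_sum p_gt1 w) mulr_suml; congr tr_htpy.
  by apply: eq_bigr => j _; rewrite mulrA.
have F3 : \sum_(j < p) (bar_tail (fun r => f (c j :: t ^+ j :: r)) (b :: s)
      - bar_tail (tr_Htpy (fun r => f (c j :: r))) (t ^+ j * b :: s)) =
   bar_tail (fun r => tr_htpy f w r) (b :: s).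
  rewrite (@eq_bar_tail _ _ _ _ (fun r => \sum_(j < p) (f (c j :: t ^+ j :: r) -
      (if r is u :: r' then tr_htpy (fun r => f (c j :: r)) (t ^+ j * u) r' else 0)))).
    rewrite bar_tail_sum; apply: eq_bigr => j _; rewrite bar_tailB; congr (_ - _).
    symmetry; apply: bar_tail_head => //; first exact: tr_epM.
    by rewrite /= mulr0.
  by move=> [|u r] _; rewrite ?tr_htpy_nil //; apply: eq_bigr => j _; rewrite subr0.
have F4 : \sum_(j < p) f (c j :: tr_proj (t ^+ j * b) :: map tr_proj s) =
   f (tr_proj w :: map tr_proj (b :: s)).
  rewrite (bigD1 (Ordinal p_gt0)) //= expr0 mul1r big1 ?addr0 // => j nj.
  have -> : tr_proj (t ^+ j * b) = 0.
    have /negbTE nj0 : j != 0%N :> nat by [].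
    by rewrite /tr_proj /treps trcoefM // big_ord1 trcoefTn // eq_sym nj0 andbF mul0r rmorph0.
  have /cochainS[K _] := L2 (c j).
  have := K (map tr_proj s) (size_map _ _) (-1) 0 0.
  by rewrite mulr0 addr0 mulN1r addNr.
rewrite (eq_bigr _ (fun j _ => E j)) big_split /= F4 big_split /= F3 big_split /= F1 F2.
ring.
Qed.

(* Such an f is a cocycle on the bar resolution of the trivial C-module,
   induced up to B. *)
Lemma bar_tail_htpy n f : cochain n.+1 f ->
  (forall s, size s = n.+2 -> bar_tail f s = 0) ->
  (forall c w s, size s = n -> f (trC p c * w :: s) = ep c * f (w :: s)) ->
  (forall s, size s = n -> f (1 :: map tr_proj s) = 0) ->
  forall s, size s = n.+1 -> bar_tail (tr_Htpy f) s = - f s.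
Proof.
move=> Lf Tf Cf f1 [|w s] //= [es].
have := @tr_htpyE f w s; rewrite es => /(_ Lf).
rewrite -[tr_proj w]mulr1 Cf ?size_map // f1 // mulr0 addr0 => <-.
rewrite -[LHS]add0r; congr (_ + _); symmetry.
have T0 c u r : size r = size s -> bar_tail f [:: trC p c, u & r] = 0.
  by move=> er; apply: Tf; rewrite /= er es.
have := @tr_htpy_linf (-1) (bar_tail f) (bar_tail f) (bar_tail f) w s.
by rewrite mulN1r addNr; apply=> c u r er; rewrite T0 //; ring.
Qed.

End Truncation.

Arguments tr_htpy : simpl never.

Lemma cocycleP (F : fieldType) (B : comNzRingType) (sg : F -> B) (ep : B -> F) n f :
  cocycle sg ep n f <-> cochain sg n f /\
  forall b s, size s = n -> ep b * f s + bar_tail ep f (b :: s) = 0.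
Proof.
split=> [] [Lf Zf]; split=> //.
  by move=> b s es; rewrite -(bar_dE _ f b es) Zf //= es.
by move=> [|b s] //= [es]; rewrite bar_dE // Zf.
Qed.

Lemma cocycleB (F : fieldType) (B : comNzRingType) (sg : F -> B) (ep : B -> F) n f g :
  cocycle sg ep n f -> cocycle sg ep n g -> cocycle sg ep n (fun s => f s - g s).
Proof.
move=> /cocycleP[Lf Zf] /cocycleP[Lg Zg]; apply/cocycleP; split; first exact: cochainB.
move=> b s es; rewrite bar_tailB -[RHS](subrr 0) -{1}(Zf b s es) -(Zg b s es).
by ring.
Qed.

(** * Functoriality of the bar complex *)

Section Pullback.
Variables (F : fieldType) (B B' : comNzRingType).
Variables (sg : F -> B) (ep : B -> F) (sg' : F -> B') (ep' : B' -> F).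
Variable phi : B -> B'.
Hypothesis phiL : forall c a b, phi (sg c * a + b) = sg' c * phi a + phi b.
Hypothesis phiM : forall a b, phi (a * b) = phi a * phi b.
Hypothesis phiE : forall a, ep' (phi a) = ep a.

Lemma pullback_cochain n f : cochain sg' n f -> cochain sg n (fun s => f (map phi s)).
Proof.
move=> Lf s1 s2 c a b es.
by rewrite !map_cat /= phiL Lf // !size_map.
Qed.

Lemma pullback_bar_tail f s :
  bar_tail ep (fun r => f (map phi r)) s = bar_tail ep' f (map phi s).
Proof.
elim: s f => [|b [|c s] IH] f //; first by rewrite !bar_tail1 phiE.
by rewrite /= !bar_tailS -phiM (IH (fun r => f (phi b :: r))).
Qed.

Lemma pullback_bar_d n f s : size s = n.+1 ->
  bar_d ep n (fun r => f (map phi r)) s = bar_d ep' n f (map phi s).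
Proof.
by case: s => [|b s] //= [es]; rewrite !bar_dE ?size_map // pullback_bar_tail phiE.
Qed.

Lemma pullback_cocycle n f : cocycle sg' ep' n f ->
  cocycle sg ep n (fun s => f (map phi s)).
Proof.
case=> Lf Zf; split=> [|s es]; first exact: pullback_cochain.
by rewrite pullback_bar_d // Zf // size_map.
Qed.

Lemma pullback_coboundary n f : coboundary sg' ep' n f ->
  coboundary sg ep n (fun s => f (map phi s)).
Proof.
case: n => [//|n] [g Lg fE]; exists (fun s => g (map phi s)).
  exact: pullback_cochain.
by move=> s es; rewrite pullback_bar_d // fE // size_map.
Qed.

End Pullback.

(** * Decomposing a cocycle of [C[t]/t^p] *)

Section Classes.
Variables (p : nat) (p_gt1 : (1 < p)%N) (F : fieldType) (C : comNzRingType).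
Variables (sg : F -> C) (ep : C -> F) (aug : augmented sg ep).
Local Notation B := (trunc p C).
Local Notation t := (trT p C).
Local Notation sgB := (@tr_sg p F C sg).
Local Notation epB := (@tr_ep p F C ep).
Implicit Types f g : seq B -> F.

Let p_gt0 : (0 < p)%N. Proof. exact: ltnW. Qed.
Let eB : zmod_morphism ep. Proof. by case: aug. Qed.
Let eM a b : ep (a * b) = ep a * ep b. Proof. by case: aug => _ _ _ [_ ->]. Qed.
Let e1 : ep 1 = 1. Proof. by case: aug => _ _ _ []. Qed.
Let e0 : ep 0 = 0. Proof. by rewrite -(subrr 0) eB subrr. Qed.
Let eD a b : ep (a + b) = ep a + ep b.
Proof. by rewrite -{1}[b]opprK -[- b]sub0r !eB e0 sub0r opprK. Qed.
Let epBC c : epB (trC p c) = ep c.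
Proof. by rewrite /tr_ep treps_C. Qed.
Let epBt : epB t = 0.
Proof. by rewrite /tr_ep treps_T. Qed.
Let epBM a b : epB (a * b) = epB a * epB b. Proof. exact: (tr_epM p_gt1 aug). Qed.

Definition tr_zeta (s : seq B) : F := ep (trovf s`_0 s`_1).
Definition tr_lambda (s : seq B) : F := ep (trcoef s`_0 1).
Definition tr_infl (h : seq C -> F) (s : seq B) : F := h (map (@treps p C) s).

Lemma tr_zeta_cochain : cochain sgB 2 tr_zeta.
Proof.
have epS (l : seq nat) (G : nat -> C) : ep (\sum_(i <- l) G i) = \sum_(i <- l) ep (G i).
  exact: (big_morph ep eD e0).
have [_ _ _ _ K] := aug.
case=> [|x [|y s1]] s2 c a b //= _; rewrite /tr_zeta /trovf /=.
- rewrite !epS mulr_sumr -big_split /=; apply: eq_bigr => i _.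
  by rewrite trcoefD trcoefCM // !eM eD eM K; ring.
- rewrite !epS mulr_sumr -big_split /=; apply: eq_bigr => i _.
  by rewrite trcoefD trcoefCM // !eM eD eM K; ring.
Qed.

Lemma tr_lambda_cochain : cochain sgB 1 tr_lambda.
Proof.
have [_ _ _ _ K] := aug.
case=> [|x s1] // s2 c a b _; rewrite /tr_lambda /=.
by rewrite trcoefD trcoefCM // eD eM K.
Qed.

Let treps_lin c (a b : B) : treps (sgB c * a + b) = sg c * treps a + treps b :> C.
Proof. by rewrite [LHS]trcoefD trcoefCM. Qed.
Let trC_lin c (a b : C) : trC p (sg c * a + b) = sgB c * trC p a + trC p b.
Proof. by rewrite rmorphD rmorphM. Qed.

Lemma tr_infl_cocycle n h : cocycle sg ep n h -> cocycle sgB epB n (tr_infl h).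
Proof. by apply: pullback_cocycle => // a b; rewrite trepsM. Qed.

Lemma tr_restr_cocycle n f : cocycle sgB epB n f ->
  cocycle sg ep n (fun s => f (map (trC p (R := C)) s)).
Proof. by apply: pullback_cocycle => // a b; rewrite rmorphM. Qed.

(* If [y b] is a C-multiple of [y], a class induced up from C can be slanted
   by y. *)
Lemma slant_cocycle n (G : seq B -> F) y b s :
  epB b * G (y :: s) = G (y * b :: s) ->
  size s = n -> bar_tail epB G (y :: b :: s) = 0 ->
  epB b * G (y :: s) + bar_tail epB (fun r => G (y :: r)) (b :: s) = 0.
Proof.
move=> Gb es; rewrite bar_tailS => /eqP; rewrite subr_eq0 => /eqP <-.
by rewrite Gb subrr.
Qed.

(** The homotopy leaves only elements of [C] at the head, so linearity over [C] in the head is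
    inherited. This is what allows slanting by [t] and by [t ^+ p.-1] afterwards. *)
Lemma tr_Htpy_CM f c w s :
  (forall c' w' s', f (trC p c' * w' :: s') = ep c' * f (w' :: s')) ->
  tr_Htpy f (trC p c * w :: s) = ep c * tr_Htpy f (w :: s).
Proof.
move=> Cf; have T0 : tr_htpy (fun=> 0 : F) w s = 0.
  have := @tr_htpy_linf p F C (-1) (fun=> 0) (fun=> 0) (fun=> 0) w s.
  by move=> -> *; rewrite ?mulN1r ?addNr //; ring.
rewrite /tr_Htpy tr_htpyCM // -[RHS]addr0 -T0; apply: tr_htpy_linf => c' u r _.
by rewrite Cf addr0.
Qed.

(** The three summands are the first steps of the resolution of [C] with maps [t] and [t ^+ p.-1]:
    restriction to [C] gives [h0], a primitive slanted by [t] gives [h1], and a second primitive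
    slanted by [t ^+ p.-1] gives [g'], two degrees lower. *)
Lemma cocycle_decomp n g0 : cocycle sgB epB n.+2 g0 ->
  exists g' h0 h1, [/\ cocycle sgB epB n g', cocycle sg ep n.+2 h0,
    cocycle sg ep n.+1 h1
  & coboundary sgB epB n.+2 (fun s => g0 s -
      (cup 2 tr_zeta g' s + tr_infl h0 s + cup 1 tr_lambda (tr_infl h1) s))].
Proof.
move=> zg0; pose h0 s := g0 (map (trC p (R := C)) s).
have zh0 : cocycle sg ep n.+2 h0 := tr_restr_cocycle zg0.
pose g s := g0 s - tr_infl h0 s.
have zg : cocycle sgB epB n.+2 g by apply: cocycleB => //; exact: tr_infl_cocycle.
have projE (s : seq B) : map (@tr_proj p C) s = map (trC p (R := C)) (map (@treps p C) s).
  by rewrite -map_comp.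
have trepsK (s : seq C) : map (@treps p C) (map (trC p (R := C)) s) = s.
  by rewrite -map_comp map_id_in // => x _; exact: treps_C.
have gproj s : g (map (@tr_proj p C) s) = 0.
  by rewrite /g /tr_infl /h0 !projE trepsK subrr.
have [Lg Zg] := (cocycleP _ _ _ _).1 zg.
(* [g] induced up to the bar resolution. It is closed, and trivial on entries from [C] since [h0]
   was subtracted, so the homotopy provides a primitive [G]. *)
pose f0 s := if s is w :: s' then epB w * g s' else 0.
have [saB [sa1 _] eaB [ea1 _] aK] := tr_augmented p_gt1 aug.
have eaD c a b : epB (sgB c * a + b) = c * epB a + epB b.
  by rewrite -{1}[b]opprK eaB -{1}[- b]sub0r eaB -{1}(subrr 0) eaB subrr epBM aK; ring.
have Lf0 : cochain sgB n.+3 f0.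
  apply/cochainS; split=> [s _ c a b|a]; first by rewrite /= eaD; ring.
  exact: cochainZ.
have Tf0 s : size s = n.+4 -> bar_tail epB f0 s = 0.
  case: s => [|w [|b s]] //= [es]; rewrite bar_tailS /= bar_tailZ epBM.
  by rewrite -mulrA -mulrN -mulrBr -opprD Zg ?oppr0 ?mulr0 //= es.
have Cf0 c w s : f0 (trC p c * w :: s) = ep c * f0 (w :: s).
  by rewrite /= epBM epBC mulrA.
pose G := tr_Htpy f0.
have TG s : size s = n.+3 -> bar_tail epB G s = - f0 s.
  move=> es; apply: (bar_tail_htpy p_gt1 aug Lf0 Tf0) => // s' _.
  by rewrite /= gproj mulr0.
have LG : cochain sgB n.+2 G := tr_Htpy_cochain p_gt1 Lf0.
have CG c w s : G (trC p c * w :: s) = ep c * G (w :: s) := tr_Htpy_CM _ _ _ Cf0.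
clearbody G; have [LG1 LG2] := (cochainS _ _ _).1 LG.
(* As [t] has augmentation zero, [f0] vanishes at the head [t], which makes this slant closed over
   [C]. *)
pose h1 s := G (t :: map (trC p (R := C)) s).
have zh1 : cocycle sg ep n.+1 h1.
  apply/cocycleP; split.
    exact: (pullback_cochain trC_lin (LG2 t)).
  move=> b s es; rewrite /h1.
  rewrite (@pullback_bar_tail F C B ep epB (trC p (R := C)) _ _
            (fun r => G (t :: r))) //; last by move=> *; rewrite rmorphM.
  rewrite /= -(epBC b); apply: (@slant_cocycle n.+1 G t (trC p b)); last 2 first.
  - by rewrite size_map.
  - by rewrite TG /= ?size_map ?es // epBt mul0r oppr0.
  by rewrite mulrC [in RHS]mulrC CG epBC mulrC.
have [_ Zh1] := (cocycleP _ _ _ _).1 (tr_infl_cocycle zh1).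
(* Subtracting the inflation of [h1] makes [f1] trivial on entries from [C], so the homotopy applies
   a second time. *)
pose f1 s := if s is w :: s' then G (t * w :: s') - epB w * tr_infl h1 s' else 0.
have Lf1 : cochain sgB n.+2 f1.
  apply/cochainS; split=> [s es c a b|a].
    have -> : f1 (sgB c * a + b :: s) = G (sgB c * (t * a) + t * b :: s) -
        epB (sgB c * a + b) * tr_infl h1 s by rewrite /= mulrDr mulrCA.
    by rewrite /= eaD LG1 //; ring.
  apply: cochainB; first exact: LG2.
  by apply: cochainZ; case: (tr_infl_cocycle zh1).
have Tf1 s : size s = n.+3 -> bar_tail epB f1 s = 0.
  case: s => [|w [|b s]] //= [es].
  have := TG [:: t * w, b & s]; rewrite /= es => /(_ erefl).
  rewrite epBM epBt !mul0r oppr0 !bar_tailS /= bar_tailB bar_tailZ epBM => TGs.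
  move/eqP: TGs; rewrite subr_eq0 => /eqP <-.
  by have /eqP := Zh1 b s es; rewrite addr_eq0 mulrA -[epB w * epB b * _]mulrA => /eqP ->; ring.
have Cf1 c w s : f1 (trC p c * w :: s) = ep c * f1 (w :: s).
  by rewrite /= mulrCA CG epBM epBC; ring.
pose G' := tr_Htpy f1.
have TG' s : size s = n.+2 -> bar_tail epB G' s = - f1 s.
  move=> es; apply: (bar_tail_htpy p_gt1 aug Lf1 Tf1) => // s' _.
  by rewrite /= ea1 mul1r mulr1 /tr_infl /h1 !projE trepsK subrr.
have LG' : cochain sgB n.+1 G' := tr_Htpy_cochain p_gt1 Lf1.
have CG' c w s : G' (trC p c * w :: s) = ep c * G' (w :: s) := tr_Htpy_CM _ _ _ Cf1.
clearbody G'; have [LG1' LG2'] := (cochainS _ _ _).1 LG'.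
(* Closed because [f1] at the head [t ^+ p.-1] involves only [t ^+ p = 0] and the augmentation of
   [t ^+ p.-1], which is zero. *)
pose g' s := G' (t ^+ p.-1 :: s).
have zg' : cocycle sgB epB n g'.
  apply/cocycleP; split=> [|b s es]; first exact: LG2'.
  apply: (@slant_cocycle n G' (t ^+ p.-1) b) => //.
    by rewrite trcoefTM1 // CG'.
  rewrite TG' /= ?es // -exprS prednK // trTp //.
  have -> : G (0 :: b :: s) = 0.
    by rewrite -[0](mul0r 0) -[X in X * _](rmorph0 (trC p (R := C))) CG e0 mul0r.
  rewrite /tr_ep /treps trcoefTn // p_gt0 /=.
  have -> : (0 == p.-1)%N = false by case: p p_gt1 => [|[]].
  by rewrite e0 mul0r subr0 oppr0.
exists g', h0, h1; split=> //.
(* The comparison map in degree one sends [b] to [trdiv b]. Its failure to be a derivation, given by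
   [trdivM], produces the cup product with [tr_zeta]. *)
exists (fun s => if s is b :: s' then G (1 :: s) - G' (trdiv b :: s') else 0).
  apply/cochainS; split=> [s es c a b|a].
    have [/(_ s es c a b) K _] := (cochainS _ _ _).1 (LG2 1).
    by rewrite K trdivD // trdivCM // LG1' //; ring.
  apply: cochainB; last exact: LG2'.
  by have /cochainS[_] := LG2 1; apply.
case=> [|b [|b' s]] //= [es]; rewrite bar_dE /= ?es // bar_tailS /= bar_tailB.
have A1 := TG [:: 1, b, b' & s]; rewrite /= es in A1; have {A1} := A1 erefl.
rewrite !bar_tailS ea1 !mul1r => A1.
have A2 r : size r = n.+1 -> G (b :: r) = epB b * G (1 :: r) + G (t * trdiv b :: r).
  move=> er; rewrite {1}(trdivK p_gt1 b) -[trC p (treps b)]mulr1.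
  have := LG1 r er 1 (trC p (treps b) * 1) (t * trdiv b).
  by rewrite sa1 !mul1r CG => ->.
have A4 := TG' [:: trdiv b, b' & s]; rewrite /= es in A4; have {A4} := A4 erefl.
rewrite bar_tailS => A4.
have A5 : G' (trdiv (b * b') :: s) = epB b * G' (trdiv b' :: s) +
    G' (trdiv b * b' :: s) - ep (trovf b b') * g' s.
  rewrite trdivM //.
  have K u v : G' (u + v :: s) = G' (u :: s) + G' (v :: s).
    by have := LG1' s es 1 u v; rewrite sa1 !mul1r.
  rewrite !K CG' -mulNr -rmorphN CG'; congr (_ + _).
  by rewrite -[- trovf b b']sub0r eB e0 sub0r mulNr.
rewrite /cup /= take0 drop0 /tr_zeta /tr_lambda /=.
have -> : ep (trcoef b 1) = epB (trdiv b) by rewrite /tr_ep /treps trcoef_div.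
have {A2} A2 := A2 (b' :: s); rewrite /= es in A2; have {A2} A2 := A2 erefl.
move: A1 A4; rewrite A2 A5 /g /= => A1 A4.
apply/eqP; rewrite -subr_eq0; apply/eqP.
move/eqP: A1; rewrite -subr_eq0 => /eqP A1.
move/eqP: A4; rewrite -subr_eq0 => /eqP A4.
by have := congr2 +%R A1 A4; rewrite addr0 => <-; ring.
Qed.

End Classes.

(** * Cup products *)

Section CupProducts.
Variables (F : fieldType) (B : comNzRingType) (sg : F -> B) (ep : B -> F).
Implicit Types (f g h : seq B -> F) (s : seq B).
Local Notation cochain := (cochain sg).
Local Notation bar_d := (bar_d ep).
Local Notation cocycle := (cocycle sg ep).
Local Notation coboundary := (coboundary sg ep).

Lemma bar_dS n f b c s : size s = n -> bar_d n.+1 f (b :: c :: s) =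
  ep b * f (c :: s) - f (b * c :: s)
  - (bar_d n (fun r => f (b :: r)) (c :: s) - ep c * f (b :: s)).
Proof. by move=> es; rewrite !bar_dE //= ?es // bar_tailS; ring. Qed.

Lemma bar_d_lin n e f g s : size s = n.+1 ->
  bar_d n (fun r => e * f r + g r) s = e * bar_d n f s + bar_d n g s.
Proof. by case: s => [|b s] //= [es]; rewrite !bar_dE // bar_tail_lin; ring. Qed.

Lemma bar_d0 n s : bar_d n (fun=> 0) s = 0.
Proof. by rewrite /bar_d big1 ?mul0r ?mulr0 ?addr0 // => i _; rewrite mulr0. Qed.

Lemma eq_bar_d n f g s : size s = n.+1 ->
  (forall r, size r = n -> f r = g r) -> bar_d n f s = bar_d n g s.
Proof.
case: s => [|b s] //= [es] efg; rewrite !bar_dE // efg //; congr (_ + _).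
by apply: eq_bar_tail => r [er]; apply: efg; rewrite er.
Qed.

Lemma bar_d_cup m n f g s : size s = (m + n).+1 ->
  bar_d (m + n) (cup m f g) s =
  cup m.+1 (bar_d m f) g s + (-1) ^+ m * cup m f (bar_d n g) s.
Proof.
elim: m f s => [|m IH] f [|b s] //= [es].
  rewrite bar_dE // /cup /= take0 drop0 mul1r !bar_dE // bar_tail1.
  rewrite (_ : bar_tail ep _ _ = f [::] * bar_tail ep g (b :: s)); last first.
    by rewrite -bar_tailZ; apply: eq_bar_tail => r _; rewrite take0 drop0.
  by ring.
case: s es => [|c s] //= [es]. rewrite addSn bar_dS //.
have -> : (fun r => cup m.+1 f g (b :: r)) = cup m (fun r => f (b :: r)) g by [].
rewrite IH; last by rewrite /= es.
rewrite /cup -[take m.+2 _]/(b :: c :: take m s) (@bar_dS m); last first.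
  by rewrite size_takel // es leq_addr.
rewrite /= -/take -/drop.
by rewrite exprS; ring.
Qed.

Lemma cocycle_cup m n f g : cocycle m f -> cocycle n g ->
  cocycle (m + n) (cup m f g).
Proof.
move=> [Lf Zf] [Lg Zg]; split=> [|s es]; first exact: cochain_cup.
rewrite bar_d_cup // /cup Zf ?Zg ?mul0r ?mulr0 ?addr0 //.
  by rewrite size_drop es -addnS addKn.
by rewrite size_takel // es ltnS leq_addr.
Qed.

Lemma coboundary_ext n f g : (forall s, size s = n -> f s = g s) ->
  coboundary n f -> coboundary n g.
Proof.
case: n => [|n] efg /=; first by rewrite efg.
by case=> h Lh fE; exists h => // s es; rewrite -efg // fE.
Qed.

Lemma coboundary_lin n e f g : coboundary n f -> coboundary n g ->
  coboundary n (fun s => e * f s + g s).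
Proof.
case: n => [|n] /=; first by move=> -> ->; ring.
move=> [f' Lf fE] [g' Lg gE]; exists (fun s => e * f' s + g' s).
  exact: cochain_lin.
by move=> s es; rewrite fE // gE // bar_d_lin.
Qed.

Lemma coboundary0 n : coboundary n (fun=> 0).
Proof.
case: n => [|n] //=; exists (fun=> 0); first exact: cochain_zero.
by move=> s es; rewrite bar_d0.
Qed.

Lemma cocycle_lin n e f g : cocycle n f -> cocycle n g ->
  cocycle n (fun s => e * f s + g s).
Proof.
move=> [Lf Zf] [Lg Zg]; split=> [|s es]; first exact: cochain_lin.
by rewrite bar_d_lin // Zf // Zg //; ring.
Qed.

Lemma cocycle_ext n f g : (forall s, size s = n -> f s = g s) ->
  cocycle n f -> cocycle n g.
Proof.
move=> efg [Lf Zf]; split=> [|s es]; first exact: cochain_ext Lf.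
by rewrite -(@eq_bar_d n f) ?Zf.
Qed.

Lemma cocycle_zero n : cocycle n (fun=> 0).
Proof.
split=> [|s es]; first exact: cochain_zero.
exact: bar_d0.
Qed.

Lemma cocycleZ n e f : cocycle n f -> cocycle n (fun s => e * f s).
Proof.
move=> Zf; apply: cocycle_ext (cocycle_lin e Zf (cocycle_zero n)) => s _.
by rewrite addr0.
Qed.

Lemma cocycleD n f g : cocycle n f -> cocycle n g -> cocycle n (fun s => f s + g s).
Proof.
move=> Zf Zg; apply: cocycle_ext (cocycle_lin 1 Zf Zg) => s _; by rewrite mul1r.
Qed.

Lemma cocycle_one : cocycle 0 (fun=> 1).
Proof.
by split=> // [] [|b []] // _; rewrite bar_dE // bar_tail1; ring.
Qed.

Lemma cup_pow_cocycle n f N : cocycle n f -> cocycle (N * n) (cup_pow n f N).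
Proof.
move=> Zf; elim: N => [|N IH] /=; first exact: cocycle_one.
by rewrite mulSn; apply: cocycle_cup.
Qed.

Lemma coboundary_cupr m n f g : cocycle m f -> coboundary n g ->
  coboundary (m + n) (cup m f g).
Proof.
case: n => [|n] /= [Lf Zf] Bg.
  apply: coboundary_ext (coboundary0 _) => s es.
  by rewrite /cup drop_oversize ?Bg ?mulr0 // es addn0.
case: Bg => h Lh gE; rewrite addnS; exists (fun s => (-1) ^+ m * cup m f h s).
  by apply: cochainZ; exact: cochain_cup.
move=> s es; have -> : bar_d (m + n) (fun s => (-1) ^+ m * cup m f h s) s =
    (-1) ^+ m * bar_d (m + n) (cup m f h) s.
  rewrite (@eq_bar_d _ _ (fun r => (-1) ^+ m * cup m f h r + (fun=> 0) r)) //.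
    by rewrite bar_d_lin // bar_d0 addr0.
  by move=> r _; rewrite addr0.
have ed : size (drop m s) = n.+1 by rewrite size_drop es -addnS addKn.
have et : size (take m.+1 s) = m.+1 by rewrite size_takel // es ltnS leq_addr.
rewrite bar_d_cup // /cup Zf // mul0r add0r gE // [RHS]mulrA -exprD addnn.
by rewrite -signr_odd odd_double mul1r.
Qed.

Definition cohom n f g : Prop := coboundary n (fun s => f s - g s).

Lemma cohom_ext n f g : (forall s, size s = n -> f s = g s) -> cohom n f g.
Proof. by move=> efg; apply: coboundary_ext (coboundary0 n) => s es; rewrite efg ?subrr. Qed.

Lemma cohom_sym n f g : cohom n f g -> cohom n g f.
Proof.
move=> H; apply: coboundary_ext (coboundary_lin (-1) H (coboundary0 n)) => s _.
by ring.
Qed.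

Lemma cohom_cupr m n f g g' : cocycle m f -> cohom n g g' ->
  cohom (m + n) (cup m f g) (cup m f g').
Proof.
move=> Zf H; apply: coboundary_ext (coboundary_cupr Zf H) => s _; rewrite /cup; ring.
Qed.

End CupProducts.

(** * Evaluation on alternating sequences *)

Section AlternatingSequence.
Variables (F : fieldType) (B : comNzRingType) (sg : F -> B) (ep : B -> F).

Fixpoint alt (u v : B) n : seq B := if n is n'.+1 then u :: alt v u n' else [::].

Lemma size_alt u v n : size (alt u v n) = n.
Proof. by elim: n u v => //= n IH u v; rewrite IH. Qed.

Lemma take_alt u v m n : take m (alt u v (m + n)) = alt u v m.
Proof. by elim: m u v => [|m IH] u v; rewrite ?take0 //= IH. Qed.

Lemma drop_alt u v m n : drop m (alt u v (m + n)) =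
  if odd m then alt v u n else alt u v n.
Proof. by elim: m u v => [|m IH] u v; rewrite ?drop0 //= IH if_neg. Qed.

Lemma cochain_head0 n f s : cochain sg n.+1 f -> size s = n -> f (0 :: s) = 0.
Proof.
move=> /cochainS[L _] es; have := L s es (-1) 0 0.
by rewrite mulr0 addr0 mulN1r addNr.
Qed.

(** Every inner term of the differential contains the product of two neighbours, which is 0, and
    both outer terms contain the augmentation of an entry. *)
Lemma coboundary_alt u v n f : ep u = 0 -> ep v = 0 -> u * v = 0 ->
  coboundary sg ep n f -> f (alt u v n) = 0.
Proof.
case: n => [//|n] eu ev uv [g Lg ->]; last exact: size_alt.
rewrite /= bar_dE ?size_alt // eu mul0r add0r.
elim: n u v eu ev uv g Lg => [|n IH] u v eu ev uv g Lg /=.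
  by rewrite bar_tail1 eu mul0r oppr0.
rewrite bar_tailS uv (cochain_head0 Lg) ?size_alt // oppr0 add0r.
rewrite (IH v u) ?oppr0 // 1?mulrC //.
by have /cochainS[_] := Lg; apply.
Qed.

End AlternatingSequence.

Section ClassCocycles.
Variables (p : nat) (p_gt1 : (1 < p)%N) (F : fieldType) (C : comNzRingType).
Variables (sg : F -> C) (ep : C -> F) (aug : augmented sg ep).
Local Notation B := (trunc p C).
Local Notation sgB := (@tr_sg p F C sg).
Local Notation epB := (@tr_ep p F C ep).

Let eM a b : ep (a * b) = ep a * ep b. Proof. by case: aug => _ _ _ [_ ->]. Qed.
Let eB : zmod_morphism ep. Proof. by case: aug. Qed.
Let e0 : ep 0 = 0. Proof. by rewrite -(subrr 0) eB subrr. Qed.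
Let eD a b : ep (a + b) = ep a + ep b.
Proof. by rewrite -{1}[b]opprK -[- b]sub0r !eB e0 sub0r opprK. Qed.

Lemma tr_lambda_cocycle : cocycle sgB epB 1 (@tr_lambda p F C ep).
Proof.
split=> [|[|a [|b []]] // _]; first exact: (tr_lambda_cochain p_gt1 aug).
rewrite bar_dE // bar_tailS bar_tail1 /tr_lambda /= trcoefM //.
by rewrite big_ord_recl big_ord1 /= subnn eD !eM /tr_ep /treps; ring.
Qed.

(* Compare the two expansions of [trdiv (a * b * c)]. *)
Lemma trovf_cocycle (a b c : B) :
  treps a * trovf b c + trovf a (b * c) = trovf a b * treps c + trovf (a * b) c.
Proof.
have := trdivM p_gt1 (a * b) c; rewrite -mulrA trdivM // [trdiv (b * c)]trdivM //.
rewrite [trdiv (a * b)]trdivM // trepsM // => E.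
have {E} E : trC p (treps a * trovf b c + trovf a (b * c)) * trT p C ^+ p.-1 =
             trC p (trovf a b * treps c + trovf (a * b) c) * trT p C ^+ p.-1.
  rewrite !rmorphD !rmorphM /= !mulrDl.
  have := trcoefTM1 p_gt1 c; move: (trT p C ^+ p.-1) E => y; rewrite rmorphM /= => E yc.
  apply/eqP; rewrite -subr_eq0; apply/eqP; move/eqP: E; rewrite -subr_eq0 => /eqP E.
  rewrite -[RHS]oppr0 -[in RHS]E.
  have -> : trC p (trovf a b) * trC p (treps c) * y = trC p (trovf a b) * (y * c).
    by rewrite yc; ring.
  by ring.
have /(congr1 (fun b => trcoef b p.-1)) := E.
by rewrite !trcoefCM // trcoefTn // eqxx prednK ?(ltnW p_gt1) // leqnn !mulr1.
Qed.

Lemma tr_zeta_cocycle : cocycle sgB epB 2 (@tr_zeta p F C ep).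
Proof.
split=> [|[|a [|b [|c []]]] // _]; first exact: (tr_zeta_cochain p_gt1 aug).
rewrite bar_dE // !bar_tailS bar_tail1 /tr_zeta /=.
have /(congr1 ep) := trovf_cocycle a b c; rewrite !eD !eM /tr_ep => E.
move/eqP: E; rewrite -subr_eq0 => /eqP E; rewrite -[RHS]E; ring.
Qed.

(** A 1-cocycle is a derivation into the trivial module, so it vanishes on multiples of [t ^+ 2]. *)
Lemma cocycle1_decomp f : cocycle sgB epB 1 f -> forall b,
  f [:: b] = f [:: trC p (treps b)] + ep (trcoef b 1) * f [:: trT p C].
Proof.
move=> [Lf Zf] b; have p_gt0 := ltnW p_gt1.
have D x y : f [:: x * y] = epB x * f [:: y] + f [:: x] * epB y.
  have := Zf [:: x; y] erefl; rewrite bar_dE // bar_tailS bar_tail1 /= => E.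
  move/eqP: E; rewrite -subr_eq0 subr0 => /eqP E; rewrite -[LHS]addr0 -[X in _ + X]E; ring.
have t0 : epB (trT p C) = 0 by rewrite /tr_ep treps_T.
have d0 (x : C) : f [:: trC p x * trT p C] = ep x * f [:: trT p C].
  by rewrite D t0 mulr0 addr0 /tr_ep treps_C.
have f0 (x : C) i : f [:: trC p x * trT p C ^+ i.+2] = 0.
  rewrite D exprS D t0 mul0r add0r.
  have -> : epB (trT p C ^+ i.+1) = 0 by rewrite /tr_ep /treps trcoefTn // andbF.
  have -> : epB (trT p C * trT p C ^+ i.+1) = 0.
    by rewrite -exprS /tr_ep /treps trcoefTn // andbF.
  by rewrite !mulr0 addr0.
rewrite {1}[b](tr_sum p_gt1) (cochain_sum_head p_gt1 aug) //.
rewrite (bigD1 (Ordinal p_gt0)) //= expr0 mulr1; congr (_ + _).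
rewrite (bigD1 (Ordinal p_gt1)) //= expr1 d0 big1 ?addr0 // => -[[|[|i]] ip] //= _.
Qed.

Lemma tr_infl_coboundary n h : coboundary sg ep n h ->
  coboundary sgB epB n (@tr_infl p F C h).
Proof.
apply: pullback_coboundary => // [c a b|a b]; last by rewrite trepsM.
by rewrite [LHS]trcoefD trcoefCM.
Qed.

End ClassCocycles.

(** * Cohomology in one variable *)

Section OneVariable.
Variables (p : nat) (p_gt1 : (1 < p)%N) (F : fieldType).
Local Notation B := (trunc p F).
Local Notation t := (trT p F).

Lemma id_augmented : augmented (fun c : F => c) (fun c : F => c).
Proof. by []. Qed.

(** Over the base field, inserting 1 in front is a contraction of the bar complex in positive
    degrees. *)
Lemma base_cocycle n h : cocycle (fun c : F => c) (fun c : F => c) n.+1 h ->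
  coboundary (fun c : F => c) (fun c : F => c) n.+1 h.
Proof.
move=> /cocycleP[Lh Zh]; have [L1 L2] := (cochainS _ _ _).1 Lh.
exists (fun s => h (1 :: s)); first exact: L2.
move=> [|b s] //= [es]; rewrite bar_dE //.
have := Zh 1 (b :: s) (congr1 S es); rewrite bar_tailS !mul1r addrA subrr sub0r.
move=> /eqP; rewrite oppr_eq0 => /eqP ->; rewrite addr0.
have := L1 s es b 1 0; rewrite mulr1 addr0 => ->.
by rewrite (cochain_head0 Lh) // addr0.
Qed.

Definition lam1 : seq B -> F := @tr_lambda p F F id.
Definition zeta1 : seq B -> F := @tr_zeta p F F id.

(** The generator of the one-dimensional space H^n of [F[t]/t^p]: a power of zeta, times lambda when
    n is odd. *)
Fixpoint tr_gen n : seq B -> F :=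
  match n with
  | 0 => fun=> 1
  | 1 => lam1
  | n'.+2 => cup 2 zeta1 (tr_gen n')
  end.

Lemma tr1_augmented : augmented (@trC p F) (@treps p F).
Proof. exact: (tr_augmented p_gt1 id_augmented). Qed.

Lemma zeta1_cocycle : cocycle (@trC p F) (@treps p F) 2 zeta1.
Proof. exact: (tr_zeta_cocycle p_gt1 id_augmented). Qed.

Lemma lam1_cocycle : cocycle (@trC p F) (@treps p F) 1 lam1.
Proof. exact: (tr_lambda_cocycle p_gt1 id_augmented). Qed.

Lemma tr_gen_cocycle n : cocycle (@trC p F) (@treps p F) n (tr_gen n).
Proof.
elim/ltn_ind: n => [[|[|n]]] IH; [|exact: lam1_cocycle|].
  exact: cocycle_one.
by apply: (@cocycle_cup F B _ _ 2 n); [exact: zeta1_cocycle | exact: IH].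
Qed.

Lemma tr_cohom1 n f : cocycle (@trC p F) (@treps p F) n f ->
  exists c, cohom (@trC p F) (@treps p F) n f (fun s => c * tr_gen n s).
Proof.
elim/ltn_ind: n f => [[|[|n]]] IH f Zf.
- by exists (f [::]); apply: cohom_ext => [] // [] //= _; rewrite mulr1.
- exists (f [:: t]); apply: cohom_ext => [] // [|b []] // _ /=.
  rewrite (cocycle1_decomp p_gt1 id_augmented Zf) /= /lam1 /tr_lambda /= mulrC.
  suff -> : f [:: trC p (treps b)] = 0 by rewrite add0r.
  have [g _ gE] := base_cocycle (@tr_restr_cocycle p F F id id 1 f Zf).
  have := gE [:: treps b] erefl => /= ->.
  by rewrite bar_dE // bar_tail1; ring.
have [g' [h0 [h1 [Zg' Zh0 Zh1 E]]]] := cocycle_decomp p_gt1 id_augmented Zf.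
have [c Ec] := IH _ (leqW (ltnSn n)) _ Zg'.
exists c.
have B0 := tr_infl_coboundary p_gt1 (base_cocycle Zh0).
have B1 := coboundary_cupr lam1_cocycle
  (tr_infl_coboundary p_gt1 (base_cocycle Zh1)).
have B2 := cohom_cupr zeta1_cocycle Ec.
have := coboundary_lin 1 E (coboundary_lin 1 B0 (coboundary_lin 1 B1 B2)).
apply: coboundary_ext => s _; rewrite -[tr_gen n.+2]/(cup 2 zeta1 (tr_gen n)).
by rewrite /cup /lam1 /zeta1; ring.
Qed.

Lemma tr_gen_alt n : tr_gen n (alt (t ^+ p.-1) t n) = (~~ odd n || (p == 2))%:R.
Proof.
have p_gt0 := ltnW p_gt1; have p1 : (p.-1 < p)%N by rewrite prednK.
elim/ltn_ind: n => [[|[|n]]] IH //.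
  rewrite /= /lam1 /tr_lambda /= trcoefTn // p_gt1 /=.
  by case: p p_gt1 => [|[|[|]]].
rewrite [LHS]/= /cup /= take0 drop0 (IH _ (leqW (ltnSn n))) ?negbK.
have -> : zeta1 [:: t ^+ p.-1; t] = 1; last by rewrite mul1r.
rewrite /zeta1 /tr_zeta /= /trovf.
rewrite (eq_big_nat _ _ (F2 := fun i => (i == p.-1)%:R)); last first.
  move=> i /andP[i1 ip]; rewrite trcoefTn // ip -[t in X in _ * X]expr1 trcoefTn //.
  rewrite ltn_subrL i1 p_gt0 /=; case: eqP => [->|_]; last by rewrite mul0r.
  by rewrite -subn1 subKn // eqxx mulr1.
under eq_bigr do rewrite mulrb.
rewrite -big_mkcond big_nat1_eq p1 andbT.
by case: p p_gt1 => [|[|p']].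
Qed.

(* Odd classes are nilpotent for odd p: starting the alternating sequence with
   t^(p-1) rather than t makes them evaluate to 0. *)
Lemma tr_alt_odd n f : cocycle (@trC p F) (@treps p F) n f ->
  odd n -> p != 2 -> f (alt (t ^+ p.-1) t n) = 0.
Proof.
move=> /tr_cohom1[c Ec] on p2.
have p0 := ltnW p_gt1; have := coboundary_alt _ _ _ Ec.
move=> /(_ (t ^+ p.-1) t); rewrite tr_gen_alt on (negbTE p2) mulr0 subr0; apply.
- by rewrite /treps trcoefTn // p0 /=; case: p p_gt1 => [|[]].
- by rewrite treps_T.
- by rewrite -exprSr prednK // trTp.
Qed.

(** After an odd number of entries the remaining sequence starts with [t] instead of [t ^+ p.-1].
    For p = 2 these coincide; for odd p the first factor is 0 anyway. *)
Lemma tr_alt_cup m n f g : cocycle (@trC p F) (@treps p F) m f ->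
  cup m f g (alt (t ^+ p.-1) t (m + n)) =
  f (alt (t ^+ p.-1) t m) * g (alt (t ^+ p.-1) t n).
Proof.
move=> Zf; rewrite /cup take_alt drop_alt; case: ifP => // om.
case: (eqVneq p 2) => [e2|p2]; first by rewrite (_ : p.-1 = 1%N) ?expr1 ?e2.
by rewrite (tr_alt_odd Zf om p2) !mul0r.
Qed.

(** The value is multiplicative and kills coboundaries, so a nilpotent class has value 0.
    Conversely, in even degree the generator has value 1, so a class of value 0 is a coboundary. *)
Lemma tr_nilpotentP n f : cocycle (@trC p F) (@treps p F) n f ->
  (exists N, coboundary (@trC p F) (@treps p F) (N * n) (cup_pow n f N)) <->
  f (alt (t ^+ p.-1) t n) = 0.
Proof.
move=> Zf; have p0 := ltnW p_gt1.
have Ealt m g : coboundary (@trC p F) (@treps p F) m g -> g (alt (t ^+ p.-1) t m) = 0.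
  apply: coboundary_alt.
  - by rewrite /treps trcoefTn // p0 /=; case: p p_gt1 => [|[]].
  - by rewrite treps_T.
  - by rewrite -exprSr prednK // trTp.
split=> [[N /Ealt]|f0].
  elim: N => [/eqP|N IH]; first by rewrite /= oner_eq0.
  rewrite /= mulSn tr_alt_cup // => /eqP; rewrite mulf_eq0 => /orP[/eqP//|/eqP].
  exact: IH.
have cob m g : cocycle (@trC p F) (@treps p F) m g -> g (alt (t ^+ p.-1) t m) = 0 ->
    ~~ odd m || (p == 2) -> coboundary (@trC p F) (@treps p F) m g.
  move=> /tr_cohom1[c Ec] g0 mp; have /Ealt := Ec.
  rewrite g0 tr_gen_alt mp mulr1 sub0r => /eqP; rewrite oppr_eq0 => /eqP c0.
  by apply: coboundary_ext Ec => s _; rewrite c0 mul0r subr0.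
(* Squaring moves any class to even degree, where the value determines it. *)
exists 2; apply: cob; first exact: cup_pow_cocycle.
  by rewrite /= mulSn tr_alt_cup // f0 mul0r.
by rewrite mul2n odd_double.
Qed.

End OneVariable.

Lemma cochain_head_mul (F : fieldType) (B : comNzRingType) (sg : F -> B) n f (a : B) :
  cochain sg n.+1 f ->
  cochain sg n.+1 (fun s => if s is b :: s' then f (a * b :: s') else 0).
Proof.
move=> /cochainS[L1 L2]; apply/cochainS; split=> [s es c x y|x]; last exact: L2.
by rewrite mulrDr mulrCA L1.
Qed.

(** Multilinearity of the differential allows identities involving [bar_d] to be tested on monomials
    by [eq_cochain_mon]. *)
Lemma bar_d_cochain (F : fieldType) (B : comNzRingType) (sg : F -> B) (ep : B -> F)
    n f : augmented sg ep -> cochain sg n f -> cochain sg n.+1 (bar_d ep n f).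
Proof.
move=> [sB [s1 sM] eB [e1 eM] K].
have e0 : ep 0 = 0 by rewrite -(subrr 0) eB subrr.
have eD c a b : ep (sg c * a + b) = c * ep a + ep b.
  by rewrite -{1}[b]opprK -[- b]sub0r !eB e0 sub0r opprK eM K.
elim: n f => [|n IH] f Lf.
  apply/cochainS; split=> // -[] // _ c a b.
  by rewrite !bar_dE // !bar_tail1 eD; ring.
have [L1 L2] := (cochainS _ _ _).1 Lf.
apply/cochainS; split=> [[|d s] // [es] c a b|a].
  have E : bar_d ep n (fun r => f (sg c * a + b :: r)) (d :: s) =
      c * bar_d ep n (fun r => f (a :: r)) (d :: s) + bar_d ep n (fun r => f (b :: r)) (d :: s).
    by rewrite -bar_d_lin /= ?es //; apply: eq_bar_d => [|r er]; rewrite /= ?es // L1.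
  have adE : (sg c * a + b) * d = sg c * (a * d) + b * d by rewrite mulrDl mulrA.
  by rewrite !bar_dS // E eD adE !L1 /= ?es //; ring.
apply: (@cochain_ext _ _ _ _ (fun s => ep a * f s -
   (if s is b :: s' then f (a * b :: s') else 0) -
   (bar_d ep n (fun r => f (a :: r)) s - cup 1 (fun s => ep s`_0) (fun r => f (a :: r)) s))).
  by move=> [|b s] // [es]; rewrite bar_dS // /cup /= ?take0 ?drop0.
apply: cochainB; first apply: cochainB; first exact: cochainZ.
  exact: cochain_head_mul.
apply: cochainB; first exact: IH.
apply: (@cochain_cup _ _ _ 1 n); last exact: L2.
by apply/cochainS; split=> [s es c x y|x] //=; rewrite eD.
Qed.

(** * Extension of scalars *)

Section Monomials.
Variables (p : nat) (p_gt1 : (1 < p)%N) (R : comNzRingType).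
Implicit Types a b : A p R.

(** Exponents are not bounded by p: a product of monomials, hence a contraction in the bar complex,
    is again of this form, possibly zero. *)
Definition mon (u : nat * nat) : A p R := Ax p R ^+ u.1 * Ay p R ^+ u.2.

Lemma AcoefD a b i j : Acoef (a + b) i j = Acoef a i j + Acoef b i j.
Proof. by rewrite /Acoef !trcoefD. Qed.
Lemma Acoef0 i j : Acoef (0 : A p R) i j = 0.
Proof. by rewrite /Acoef !trcoef0. Qed.
Lemma AcoefN a i j : Acoef (- a) i j = - Acoef a i j.
Proof. by rewrite /Acoef !trcoefN. Qed.
Lemma AcoefCM c a i j : Acoef (AC p c * a) i j = c * Acoef a i j.
Proof. by rewrite /Acoef /AC !trcoefCM. Qed.
Lemma AcoefC c i j : Acoef (AC p c : A p R) i j = if (i == 0%N) && (j == 0%N) then c else 0.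
Proof.
rewrite /Acoef /AC trcoefC andbC; case: eqP => _ /=; last exact: trcoef0.
by rewrite trcoefC.
Qed.

Lemma Acoef_mon u i j : Acoef (mon u) i j =
  [&& (i < p)%N, (j < p)%N, i == u.1 & j == u.2]%:R.
Proof.
rewrite /Acoef /mon /Ax /Ay -rmorphXn /= trcoefCM // trcoefTn //.
case: (j < p)%N => /=; last by rewrite mulr0 trcoef0 ?andbF.
case: (j == u.2) => /=; last by rewrite mulr0 trcoef0 !andbF.
by rewrite mulr1 trcoefTn // andbT.
Qed.

Lemma AP a b : (forall i j, (i < p)%N -> (j < p)%N -> Acoef a i j = Acoef b i j) -> a = b.
Proof. by move=> E; apply: trP => // j jp; apply: trP => // i ip; apply: E. Qed.

Lemma Acoef_ge a i j : (p <= i)%N || (p <= j)%N -> Acoef a i j = 0.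
Proof.
by rewrite /Acoef => /orP[pi|pj]; [rewrite trcoef_ge | rewrite (@trcoef_ge p p_gt1 _ a) ?trcoef0].
Qed.

Lemma mon_ge u : (p <= u.1)%N || (p <= u.2)%N -> mon u = 0.
Proof.
move=> pu; apply: AP => i j ip jp; rewrite Acoef_mon Acoef0 ip jp /=.
suff -> : (i == u.1) && (j == u.2) = false by [].
apply/negP => /andP[/eqP ei /eqP ej].
by move: pu; rewrite -ei -ej (leqNgt p i) (leqNgt p j) ip jp.
Qed.

Lemma mon_mul u v : mon u * mon v = mon (u.1 + v.1, u.2 + v.2)%N.
Proof. by rewrite /mon !exprD; ring. Qed.

Lemma A_sum a : a = \sum_(i < p) \sum_(j < p) AC p (Acoef a i j) * mon (i : nat, j : nat).
Proof.
rewrite [LHS](tr_sum p_gt1) exchange_big /=; apply: eq_bigr => j _.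
rewrite {1}(tr_sum p_gt1 (trcoef a j)) rmorph_sum mulr_suml; apply: eq_bigr => i _.
by rewrite /mon /AC /Ax /Ay rmorphM rmorphXn mulrA.
Qed.

Lemma AepsM a b : Aeps (a * b) = Aeps a * Aeps b.
Proof.
rewrite /Aeps /Acoef trcoefM ?(ltnW p_gt1) // big_ord1.
by rewrite trcoefM ?(ltnW p_gt1) // big_ord1.
Qed.

End Monomials.

Lemma A_augmented p (p_gt1 : (1 < p)%N) (F : fieldType) :
  augmented (@AC p F) (@Aeps p F).
Proof. exact: (tr_augmented p_gt1 (tr1_augmented p_gt1 F)). Qed.

Section ScalarExtension.
Variables (p : nat) (p_gt1 : (1 < p)%N) (k K : fieldType) (iota : {rmorphism k -> K}).
Implicit Types f g : seq (A p k) -> k.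
Local Notation se := (scalar_ext iota).
Local Notation mk := (map (@mon p k)).
Local Notation mK := (map (@mon p K)).

Lemma scalar_ext_cochain n f : cochain (@AC p K) n (se f).
Proof.
elim: n f => [|n IH] f //; apply/cochainS; split=> [s es c a b|a].
  rewrite /= mulr_sumr -big_split; apply: eq_bigr => i _.
  rewrite mulr_sumr -big_split; apply: eq_bigr => j _ /=.
  by rewrite AcoefD AcoefCM //; ring.
by apply: cochain_sum => i; apply: cochain_sum => j; apply: cochainZ; exact: IH.
Qed.

Lemma eq_scalar_ext f g s : (forall r, size r = size s -> f r = g r) -> se f s = se g s.
Proof.
elim: s f g => [|a s IH] f g efg; first by rewrite /= efg.
rewrite /=; apply: eq_bigr => i _; apply: eq_bigr => j _; congr (_ * _).
by apply: IH => r er; apply: efg; rewrite /= er.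
Qed.

Lemma scalar_ext_lin e f g s :
  se (fun r => e * f r + g r) s = iota e * se f s + se g s.
Proof.
elim: s f g => [|a s IH] f g; first by rewrite /= rmorphD rmorphM.
rewrite /= mulr_sumr -big_split; apply: eq_bigr => i _.
rewrite mulr_sumr -big_split; apply: eq_bigr => j _ /=.
by rewrite IH; ring.
Qed.

Lemma scalar_ext0 s : se (fun _ : seq (A p k) => 0) s = 0.
Proof.
elim: s => [|a s IH]; first exact: rmorph0.
by rewrite /= big1 // => i _; rewrite big1 // => j _; rewrite IH mulr0.
Qed.

Lemma scalar_ext_mon n f (l : seq (nat * nat)) : cochain (@AC p k) n f ->
  size l = n -> se f (mK l) = iota (f (mk l)).
Proof.
elim: l n f => [|u l IH] [|n] f Lf //= [es].
have [L1 L2] := (cochainS _ _ _).1 Lf.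
case: (boolP ((u.1 < p) && (u.2 < p))%N) => [/andP[u1 u2]|].
  rewrite (bigD1 (Ordinal u1)) //= (bigD1 (Ordinal u2)) //= Acoef_mon // u1 u2 !eqxx mul1r.
  rewrite [X in _ + X + _]big1 => [|j]; last first.
    by rewrite -val_eqE /= Acoef_mon // => /negbTE ->; rewrite !andbF mul0r.
  rewrite big1 => [|i]; last first.
    rewrite -val_eqE /= => /negbTE ni; rewrite big1 // => j _.
    by rewrite Acoef_mon // ni !andbF mul0r.
  by rewrite !addr0 -(IH n (fun r => f (mon p k u :: r))) //; case: (u).
rewrite negb_and -(leqNgt p u.1) -(leqNgt p u.2) => pu; rewrite [mon p k u]mon_ge //.
rewrite (cochain_head0 Lf) ?size_map // rmorph0 big1 // => i _; rewrite big1 // => j _.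
by rewrite mon_ge // Acoef0 mul0r.
Qed.

(** Compatibility of [scalar_ext] with cup products and differentials is reduced to monomials, where
    by [scalar_ext_mon] the extension of a cochain is just its value in [k]. *)
Lemma eq_cochain_mon n (f1 f2 : seq (A p K) -> K) :
  cochain (@AC p K) n f1 -> cochain (@AC p K) n f2 ->
  (forall l, size l = n -> f1 (mK l) = f2 (mK l)) ->
  forall s, size s = n -> f1 s = f2 s.
Proof.
move=> L1 L2 E [|a s] es; first by apply: (E [::]).
elim: n f1 f2 L1 L2 E a s es => [|n IH] f1 f2 L1 L2 E a s //= [es].
have aug := tr1_augmented p_gt1 K.
rewrite [a]A_sum // !(cochain_sum_head p_gt1 aug) ?es //; apply: eq_bigr => i _.
rewrite !(cochain_sum_head p_gt1 aug) ?es //; apply: eq_bigr => j _.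
have [M1 N1] := (cochainS _ _ _).1 L1; have [M2 N2] := (cochainS _ _ _).1 L2.
rewrite -[_ * _]addr0 M1 // M2 // (cochain_head0 L1) // (cochain_head0 L2) //.
congr (_ * _ + _); move: (N1 (mon p K (i : nat, j : nat))) (N2 (mon p K (i : nat, j : nat))).
move=> {}N1 {}N2.
have {}E l : size l = n -> f1 (mon p K (i : nat, j : nat) :: mK l) =
    f2 (mon p K (i : nat, j : nat) :: mK l).
  by move=> el; apply: (E ((i : nat, j : nat) :: l)); rewrite /= el.
case: s es => [|b s] es; first by apply: (E [::]).
by case: n IH es L1 L2 M1 M2 N1 N2 E => // n IH es L1 L2 M1 M2 N1 N2 E; apply: (IH _ _ N1 N2 E).
Qed.

Lemma scalar_ext_cup m n f g : cochain (@AC p k) m f -> cochain (@AC p k) n g ->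
  forall s, size s = (m + n)%N -> se (cup m f g) s = cup m (se f) (se g) s.
Proof.
move=> Lf Lg; apply: eq_cochain_mon; first exact: scalar_ext_cochain.
  by apply: cochain_cup; exact: scalar_ext_cochain.
move=> l el; rewrite (scalar_ext_mon (cochain_cup Lf Lg)) //.
rewrite /cup -!map_take -!map_drop (scalar_ext_mon Lf) ?(scalar_ext_mon Lg) ?rmorphM //.
  by rewrite size_drop el addKn.
by rewrite size_takel // el leq_addr.
Qed.

Lemma scalar_ext_bar_d n f : cochain (@AC p k) n f ->
  forall s, size s = n.+1 ->
  se (bar_d (@Aeps p k) n f) s = bar_d (@Aeps p K) n (se f) s.
Proof.
move=> Lf; apply: eq_cochain_mon; first exact: scalar_ext_cochain.
  by apply: (bar_d_cochain (A_augmented p_gt1 K)); exact: scalar_ext_cochain.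
move=> l el; rewrite (scalar_ext_mon (bar_d_cochain (A_augmented p_gt1 k) Lf)) //.
have ep u : iota (Aeps (mon p k u)) = Aeps (mon p K u).
  by rewrite /Aeps !Acoef_mon // rmorph_nat.
rewrite /bar_d !rmorphD rmorph_sum.
case: l el => [//|u l] [el]; have l0 : (0 < size (u :: l))%N by [].
congr (_ + _ + _).
- by rewrite rmorphM /= ep (scalar_ext_mon Lf).
- apply: eq_bigr => i _; rewrite rmorphM rmorphXn rmorphN1; congr (_ * _).
  have E (F : fieldType) : contract i (map (@mon p F) (u :: l)) =
      map (@mon p F) (take i (u :: l) ++ (let v := nth (0, 0)%N (u :: l) i in
        let w := nth (0, 0)%N (u :: l) i.+1 in (v.1 + w.1, v.2 + w.2)%N) ::
        drop i.+2 (u :: l)).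
    have i2 : (i.+1 < size (u :: l))%N by rewrite /= ltnS el.
    move: (u :: l) i2 => v i2; rewrite map_cat map_take [map _ (_ :: _)]/= map_drop.
    by rewrite /contract (nth_map (0, 0)%N) ?(ltnW i2) // (nth_map (0, 0)%N) // mon_mul.
  rewrite !E (scalar_ext_mon Lf) // size_cat /= size_takel ?size_drop /= ?el; last first.
    by rewrite ltnW // ltnS ltnW.
  by rewrite ?subSS addnS -addSn subnKC.
- have EP (F : fieldType) : (map (@mon p F) (u :: l))`_n = mon p F (nth (0, 0)%N (u :: l) n).
    by rewrite (nth_map (0, 0)%N) //= el.
  rewrite !EP rmorphM rmorphXn rmorphN1 rmorphM ep -!map_take (scalar_ext_mon Lf) //.
  by rewrite size_takel //= el.
Qed.

Lemma scalar_ext_cocycle n f : cocycle (@AC p k) (@Aeps p k) n f ->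
  cocycle (@AC p K) (@Aeps p K) n (se f).
Proof.
case=> Lf Zf; split=> [|s es]; first exact: scalar_ext_cochain.
rewrite -scalar_ext_bar_d // (@eq_scalar_ext _ (fun=> 0)) ?scalar_ext0 //.
by move=> r er; rewrite Zf ?er.
Qed.

Lemma scalar_ext_coboundary n f : coboundary (@AC p k) (@Aeps p k) n f ->
  coboundary (@AC p K) (@Aeps p K) n (se f).
Proof.
case: n => [/= ->|n [g Lg fE]]; first exact: rmorph0.
exists (se g); first exact: scalar_ext_cochain.
by move=> s es; rewrite -scalar_ext_bar_d //; apply: eq_scalar_ext => r er; rewrite fE ?er.
Qed.

End ScalarExtension.

(** * Even classes of A *)

Section ClassesOfA.
Variables (p : nat) (p_gt1 : (1 < p)%N) (F : fieldType).
Local Notation A := (A p F).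
Local Notation cocycleA := (cocycle (@AC p F) (@Aeps p F)).
Local Notation cohomA := (cohom (@AC p F) (@Aeps p F)).
Implicit Types s : seq A.

Let aug1 := tr1_augmented p_gt1 F.

Definition zetay : seq A -> F := @tr_zeta p F (trunc p F) (@treps p F).
Definition lamy : seq A -> F := @tr_lambda p F (trunc p F) (@treps p F).
Definition genx n : seq A -> F := @tr_infl p F (trunc p F) (@tr_gen p F n).
Definition zetax : seq A -> F := @tr_infl p F (trunc p F) (@zeta1 p F).
Definition lamx : seq A -> F := @tr_infl p F (trunc p F) (@lam1 p F).

Lemma zetay_cocycle : cocycleA 2 zetay.
Proof. exact: (tr_zeta_cocycle p_gt1 aug1). Qed.
Lemma lamy_cocycle : cocycleA 1 lamy.
Proof. exact: (tr_lambda_cocycle p_gt1 aug1). Qed.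
Lemma genx_cocycle n : cocycleA n (genx n).
Proof. exact: (tr_infl_cocycle p_gt1 (tr_gen_cocycle p_gt1 F n)). Qed.
Lemma zetax_cocycle : cocycleA 2 zetax.
Proof. exact: (tr_infl_cocycle p_gt1 (zeta1_cocycle p_gt1 F)). Qed.
Lemma lamx_cocycle : cocycleA 1 lamx.
Proof. exact: (tr_infl_cocycle p_gt1 (lam1_cocycle p_gt1 F)). Qed.

Lemma genxSS n s : genx n.+2 s = cup 2 zetax (genx n) s.
Proof.
rewrite /genx /zetax /tr_infl -[tr_gen n.+2]/(cup 2 (@zeta1 p F) (tr_gen n)) /cup.
by rewrite map_take map_drop.
Qed.

(* The normal form of an even class: powers of [zetay] times classes in x,
   with an odd contribution [lamy * genx _] at each step. *)
Fixpoint even_class (c : F) (L : seq (F * F)) : seq A -> F :=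
  if L is e :: L' then fun s =>
    cup 2 zetay (even_class c L') s + e.1 * genx (size L).*2 s
    + e.2 * cup 1 lamy (genx (size L').*2.+1) s
  else fun=> c.

Lemma even_class_cocycle c L : cocycleA (size L).*2 (even_class c L).
Proof.
elim: L => [|e L IH] /=.
  by apply: cocycle_ext (cocycleZ c (@cocycle_one _ _ _ _)) => s _; rewrite mulr1.
apply: cocycleD; first apply: cocycleD.
- exact: (cocycle_cup zetay_cocycle IH).
- by apply: cocycleZ; exact: (genx_cocycle (size L).*2.+2).
- by apply: cocycleZ; exact: (cocycle_cup lamy_cocycle (genx_cocycle (size L).*2.+1)).
Qed.

(** Each application of [cocycle_decomp] over [F[x]/x^p] splits off one factor [zetay]; the two
    classes in x that it leaves are multiples of generators by [tr_cohom1]. *)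
Lemma even_form m g : cocycleA m.*2 g ->
  exists c L, size L = m /\ cohomA m.*2 g (even_class c L).
Proof.
elim: m g => [|m IH] g Zg.
  by exists (g [::]), [::]; split=> //; apply: cohom_ext => -[].
have [g' [h0 [h1 [Zg' Zh0 Zh1 E]]]] := cocycle_decomp p_gt1 aug1 Zg.
have [c [L [sL Eg']]] := IH _ Zg'.
have [c0 E0] := tr_cohom1 p_gt1 Zh0; have [c1 E1] := tr_cohom1 p_gt1 Zh1.
exists c, ((c0, c1) :: L); split; first by rewrite /= sL.
have B0 := tr_infl_coboundary p_gt1 E0.
have B1 := coboundary_cupr lamy_cocycle (tr_infl_coboundary p_gt1 E1).
have B2 := cohom_cupr zetay_cocycle Eg'.
have := coboundary_lin 1 E (coboundary_lin 1 B0 (coboundary_lin 1 B1 B2)).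
apply: coboundary_ext => s _; rewrite [even_class _ _ s]/= sL.
by rewrite /cup /lamy /zetay /genx /tr_infl; ring.
Qed.

Lemma zetayE a b : zetay [:: a; b] = \sum_(1 <= i < p) Acoef a 0 i * Acoef b 0 (p - i).
Proof.
rewrite /zetay /tr_zeta /= /trovf.
rewrite (big_morph (@treps p F) (fun x y => trcoefD x y 0) (trcoef0 p F 0)).
by apply: eq_bigr => i _; rewrite trepsM.
Qed.
Lemma zetaxE a b : zetax [:: a; b] = \sum_(1 <= i < p) Acoef a i 0 * Acoef b (p - i) 0.
Proof. by []. Qed.
Lemma lamyE a : lamy [:: a] = Acoef a 0 1. Proof. by []. Qed.
Lemma lamxE a : lamx [:: a] = Acoef a 1 0. Proof. by []. Qed.

End ClassesOfA.

Section ScalarExtensionOfClasses.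
Variables (p : nat) (p_gt1 : (1 < p)%N) (k K : fieldType) (iota : {rmorphism k -> K}).
Local Notation se := (scalar_ext iota).

Lemma scalar_ext_zetay a b : se (@zetay p k) [:: a; b] = zetay [:: a; b] :> K.
Proof.
apply: (eq_cochain_mon p_gt1 (n := 2)) => //; first exact: scalar_ext_cochain.
  by case: (zetay_cocycle p_gt1 K).
move=> [|u [|v []]] // _; have [L _] := zetay_cocycle p_gt1 k.
rewrite (scalar_ext_mon p_gt1 _ L) //= !zetayE // rmorph_sum; apply: eq_bigr => i _.
by rewrite !Acoef_mon // rmorphM !rmorph_nat.
Qed.

Lemma scalar_ext_zetax a b : se (@zetax p k) [:: a; b] = zetax [:: a; b] :> K.
Proof.
apply: (eq_cochain_mon p_gt1 (n := 2)) => //; first exact: scalar_ext_cochain.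
  by case: (zetax_cocycle p_gt1 K).
move=> [|u [|v []]] // _; have [L _] := zetax_cocycle p_gt1 k.
rewrite (scalar_ext_mon p_gt1 _ L) //= !zetaxE // rmorph_sum; apply: eq_bigr => i _.
by rewrite !Acoef_mon // rmorphM !rmorph_nat.
Qed.

Lemma scalar_ext_lamy a : se (@lamy p k) [:: a] = Acoef a 0 1.
Proof.
rewrite -lamyE; apply: (eq_cochain_mon p_gt1 (n := 1)) => //; first exact: scalar_ext_cochain.
  by case: (lamy_cocycle p_gt1 K).
move=> [|u []] // _; have [L _] := lamy_cocycle p_gt1 k.
by rewrite (scalar_ext_mon p_gt1 _ L) //= !lamyE !Acoef_mon // rmorph_nat.
Qed.

Lemma scalar_ext_lamx a : se (@lamx p k) [:: a] = Acoef a 1 0.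
Proof.
rewrite -lamxE; apply: (eq_cochain_mon p_gt1 (n := 1)) => //; first exact: scalar_ext_cochain.
  by case: (lamx_cocycle p_gt1 K).
move=> [|u []] // _; have [L _] := lamx_cocycle p_gt1 k.
by rewrite (scalar_ext_mon p_gt1 _ L) //= !lamxE !Acoef_mon // rmorph_nat.
Qed.

Lemma trcoef_exp (u : trunc p K) m i : treps u = 0 -> (i <= m)%N -> (m < p)%N ->
  trcoef (u ^+ m) i = (i == m)%:R * trcoef u 1 ^+ m.
Proof.
move=> u0; elim: m i => [|m IH] i im mp.
  by rewrite expr0 trcoef1 // mulr1; case: i im.
rewrite exprS trcoefM //; last exact: leq_ltn_trans im mp.
rewrite big_ord_recl -[trcoef u 0]/(treps u) u0 mul0r add0r.
case: i im => [|i] im; first by rewrite big_ord0 mul0r.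
rewrite big_ord_recl /= subSS subn0 IH ?(ltnW mp) // eqSS big1 ?addr0 => [|j _].
  by rewrite exprS; ring.
rewrite IH ?(ltnW mp) //; last by rewrite /bump /=; lia.
rewrite (_ : (_ == m) = false) ?mul0r ?mulr0 //.
by apply/negbTE; have := ltn_ord j; rewrite /bump /=; lia.
Qed.

(** [u ^+ p.-1] starts in degree [p.-1], so only the index [p.-1] contributes. Thus zeta sees the
    p-th power of the linear coefficient. *)
Lemma trcoef_alt (u : trunc p K) : treps u = 0 ->
  \sum_(1 <= i < p) trcoef (u ^+ p.-1) i * trcoef u (p - i) = trcoef u 1 ^+ p.
Proof.
move=> u0; have p_gt0 := ltnW p_gt1; have p1 : (p.-1 < p)%N by rewrite prednK.
rewrite (eq_big_nat _ _ (F2 := fun i => if i == p.-1 then trcoef u 1 ^+ p else 0)).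
  rewrite -big_mkcond big_nat1_eq p1 andbT.
  by have -> : (1 <= p.-1)%N by lia.
move=> i /andP[i1 ip]; rewrite trcoef_exp //; last by rewrite -ltnS prednK.
case: eqP => [->|_]; last by rewrite !mul0r.
have -> : (p - p.-1 = 1)%N by lia.
by rewrite mul1r -exprSr prednK.
Qed.

(* Setting x = 0. *)
Definition projy (a : A p K) : trunc p K := trmk p (fun j => Acoef a 0 j).

Lemma projy_exp a m : projy (a ^+ m) = projy a ^+ m.
Proof.
elim: m => [|m IH].
  rewrite !expr0; apply: trP => // i ip; rewrite trcoef_mk // ip.
  have := Acoef_mon p_gt1 K (0, 0)%N 0 i.
  by rewrite /mon !expr0 mulr1 trcoef1 // ip (ltnW p_gt1).
rewrite !exprS -IH; apply: trP => // i ip; rewrite trcoef_mk // ip.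
rewrite /Acoef trcoefM // -[trcoef _ 0]/(treps _).
rewrite (big_morph (@treps p K) (fun x y => trcoefD x y 0) (trcoef0 p K 0)).
rewrite trcoefM //; apply: eq_bigr => j _; rewrite trepsM // !trcoef_mk //.
by rewrite (leq_ltn_trans _ ip) ?leq_ord // (leq_ltn_trans (leq_subr _ _) ip).
Qed.

Variable T : A p K.
Hypothesis T0 : Aeps T = 0.

Let treps_exp m : treps (T ^+ m) = treps T ^+ m :> trunc p K.
Proof.
elim: m => [|m IH]; first by rewrite !expr0 /treps trcoef1.
by rewrite !exprS trepsM // IH.
Qed.

Let projy_coef a i : (i < p)%N -> trcoef (projy a) i = Acoef a 0 i.
Proof. by move=> ip; rewrite trcoef_mk // ip. Qed.

Lemma zetax_alt : zetax [:: T ^+ p.-1; T] = Acoef T 1 0 ^+ p.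
Proof.
rewrite zetaxE -[RHS]/(trcoef (treps T) 1 ^+ p) -trcoef_alt //.
by apply: eq_bigr => i _; rewrite -[Acoef _ _ _]/(trcoef (treps _) i) treps_exp.
Qed.

Lemma zetay_alt : zetay [:: T ^+ p.-1; T] = Acoef T 0 1 ^+ p.
Proof.
have p_gt0 := ltnW p_gt1.
rewrite zetayE // -(projy_coef T p_gt1) -trcoef_alt; last first.
  by rewrite /treps projy_coef.
apply: eq_big_nat => i /andP[i1 ip]; rewrite -projy_exp !projy_coef //.
by rewrite ltn_subrL i1.
Qed.

(** [T ^+ p.-1] has order at least [p.-1], so it has a linear part only when p = 2, where it is [T]
    itself. *)
Lemma lamx_alt : lamx [:: T ^+ p.-1] = (p == 2)%:R * Acoef T 1 0.
Proof.
have p_gt0 := ltnW p_gt1; have p1 : (p.-1 < p)%N by rewrite prednK.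
rewrite lamxE -[LHS]/(trcoef (treps (T ^+ p.-1)) 1) treps_exp trcoef_exp //; last by lia.
rewrite -[Acoef _ _ _]/(trcoef (treps T) 1).
have [e2|n2] := eqVneq p 2; last first.
  have -> : (1 == p.-1)%N = false by lia.
  by rewrite !mul0r.
by have -> : p.-1 = 1%N by lia.
Qed.

Lemma lamy_alt : lamy [:: T ^+ p.-1] = (p == 2)%:R * Acoef T 0 1.
Proof.
have p_gt0 := ltnW p_gt1; have p1 : (p.-1 < p)%N by rewrite prednK.
rewrite lamyE -!(projy_coef _ p_gt1) projy_exp trcoef_exp //; last 2 first.
- by rewrite /treps projy_coef.
- by lia.
have [e2|n2] := eqVneq p 2; last first.
  have -> : (1 == p.-1)%N = false by lia.
  by rewrite !mul0r.
by have -> : p.-1 = 1%N by lia.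
Qed.

End ScalarExtensionOfClasses.

Section LambdaSquare.
Variables (p : nat) (F : fieldType) (C : comNzRingType).
Variables (sg : F -> C) (ep : C -> F) (aug : augmented sg ep).

(** For p > 2 the coefficient of [t ^+ 2] exists in the quotient; in a product its mixed term is the
    product of the linear coefficients, so up to sign it is a primitive. *)
Lemma tr_lambda_sq : (2 < p)%N ->
  coboundary (@tr_sg p F C sg) (@tr_ep p F C ep) 2
    (cup 1 (@tr_lambda p F C ep) (@tr_lambda p F C ep)).
Proof.
move=> p_gt2; have p_gt1 := ltnW p_gt2.
have [sB [s1 sM] eB [e1 eM] K] := aug.
have e0 : ep 0 = 0 by rewrite -(subrr 0) eB subrr.
have eD a b : ep (a + b) = ep a + ep b.
  by rewrite -{1}[b]opprK -[- b]sub0r !eB e0 sub0r opprK.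
exists (fun s => - ep (trcoef s`_0 2)).
  apply/cochainS; split=> [s _ c a b|a] //=.
  by rewrite trcoefD trcoefCM // eD eM K; ring.
move=> [|a [|b []]] // _; rewrite bar_dE // bar_tailS bar_tail1 /cup /= trcoefM //.
rewrite !big_ord_recl big_ord0 /= !eD !eM /tr_ep /treps /tr_lambda /= e0; ring.
Qed.

End LambdaSquare.

(** * Values of classes at an element of [A] *)

Section Evaluation.
Variables (p : nat) (p_gt1 : (1 < p)%N) (k K : fieldType) (iota : {rmorphism k -> K}).
Local Notation se := (scalar_ext iota).
Local Notation cocycleA := (cocycle (@AC p k) (@Aeps p k)).
Local Notation coboundaryA := (coboundary (@AC p k) (@Aeps p k)).
Local Notation cohomA := (cohom (@AC p k) (@Aeps p k)).

(* The class of degree n of A evaluated on the cyclic subgroup t |-> T, up to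
   a nonzero scalar and nilpotents. *)
Definition ev (T : A p K) n f : K := se f (alt (T ^+ p.-1) T n).

Section Fixed.
Variable T : A p K.
Hypotheses (T0 : Aeps T = 0) (Tp : T ^+ p = 0).

Lemma ev_coboundary n f : coboundaryA n f -> ev T n f = 0.
Proof.
move=> /(scalar_ext_coboundary p_gt1 iota); apply: coboundary_alt => //.
  have -> : p.-1 = p.-2.+1 by lia.
  by rewrite exprS AepsM // T0 mul0r.
by rewrite -exprSr prednK // ltnW.
Qed.

Lemma ev_lin n e f g : ev T n (fun s => e * f s + g s) = iota e * ev T n f + ev T n g.
Proof. exact: scalar_ext_lin. Qed.

Lemma ev_cohom n f g : cohomA n f g -> ev T n f = ev T n g.
Proof.
move=> /ev_coboundary; have -> : ev T n (fun s => f s - g s) = ev T n (fun s => (-1) * g s + f s).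
  by apply: eq_scalar_ext => r _; ring.
by rewrite ev_lin rmorphN1 mulN1r addrC => /eqP; rewrite subr_eq0 => /eqP.
Qed.

Lemma ev_cup_even m n f g : cochain (@AC p k) m.*2 f -> cochain (@AC p k) n g ->
  ev T (m.*2 + n) (cup m.*2 f g) = ev T m.*2 f * ev T n g.
Proof.
move=> Lf Lg; rewrite /ev (scalar_ext_cup p_gt1 _ Lf Lg) ?size_alt //.
by rewrite /cup take_alt drop_alt odd_double.
Qed.

Let a := Acoef T 1 0.
Let b := Acoef T 0 1.

Lemma ev_genx_even n : ev T n.*2 (@genx p k n.*2) = (a ^+ p) ^+ n.
Proof.
elim: n => [|n IH]; first exact: rmorph1.
rewrite exprS -IH /a -zetax_alt // -(scalar_ext_zetax p_gt1 iota).
have [Lz _] := zetax_cocycle p_gt1 k; have [Lg _] := genx_cocycle p_gt1 k n.*2.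
rewrite -[_.+1.*2]/(1.*2 + n.*2)%N -(ev_cup_even (m := 1) Lz Lg).
by apply: eq_scalar_ext => r _; exact: genxSS.
Qed.

Lemma ev_genx_odd n : ev T n.*2.+1 (@genx p k n.*2.+1) = (a ^+ p) ^+ n * ((p == 2)%:R * a).
Proof.
elim: n => [|n IH].
  by rewrite expr0 mul1r /a -lamx_alt // lamxE -(scalar_ext_lamx p_gt1 iota).
rewrite exprS -mulrA -IH /a -zetax_alt // -(scalar_ext_zetax p_gt1 iota).
have [Lz _] := zetax_cocycle p_gt1 k; have [Lg _] := genx_cocycle p_gt1 k n.*2.+1.
rewrite -[_.+1.*2.+1]/(1.*2 + n.*2.+1)%N -(ev_cup_even (m := 1) Lz Lg).
by apply: eq_scalar_ext => r _; exact: genxSS.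
Qed.

End Fixed.

(** The value of [even_class c L] at an element of linear part [(a, b)]: a form of degree
    [p * size L] with coefficients in [k]. *)
Fixpoint even_value (a b : K) (c : k) (L : seq (k * k)) : K :=
  if L is e :: L' then
    b ^+ p * even_value a b c L' + iota e.1 * (a ^+ p) ^+ (size L').+1
    + iota e.2 * ((p == 2)%:R * b * ((a ^+ p) ^+ size L' * a))
  else iota c.

Lemma ev_even_class T c L : Aeps T = 0 -> T ^+ p = 0 ->
  ev T (size L).*2 (@even_class p k c L) = even_value (Acoef T 1 0) (Acoef T 0 1) c L.
Proof.
move=> T0 Tp; elim: L => [|e L IH] //=.
have [Ly _] := zetay_cocycle p_gt1 k; have [Ll _] := lamy_cocycle p_gt1 k.
have [Le _] := even_class_cocycle p_gt1 c L.
have [Lg _] := genx_cocycle p_gt1 k (size L).*2.+1.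
have -> : ev T (size L).*2.+2 (fun s => cup 2 (@zetay p k) (@even_class p k c L) s +
     e.1 * genx (size L).+1.*2 s + e.2 * cup 1 (@lamy p k) (genx (size L).*2.+1) s) =
   ev T (size L).*2.+2 (fun s => e.2 * cup 1 (@lamy p k) (genx (size L).*2.+1) s +
     (e.1 * genx (size L).+1.*2 s + cup 2 (@zetay p k) (@even_class p k c L) s)).
  by apply: eq_scalar_ext => r _; ring.
rewrite !ev_lin // [RHS]addrC; congr (_ * _ + _).
  have -> : ev T (size L).*2.+2 (cup 1 (@lamy p k) (genx (size L).*2.+1)) =
      Acoef (T ^+ p.-1) 0 1 * se (genx (size L).*2.+1) (alt T (T ^+ p.-1) (size L).*2.+1).
    rewrite -(scalar_ext_lamy p_gt1 iota).
    by rewrite /ev (scalar_ext_cup p_gt1 _ Ll Lg) //= ?size_alt // /cup /= drop0.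
  rewrite -lamyE lamy_alt //.
  case: (eqVneq p 2) => [e2|n2]; last by rewrite !mul0r.
  have p1e : p.-1 = 1%N by lia.
  have := ev_genx_odd T0 (size L).
  by rewrite /ev p1e (introT eqP e2) expr1 !mul1r => ->.
rewrite addrC; congr (_ + _).
  rewrite -IH // -zetay_alt // -(scalar_ext_zetay p_gt1 iota).
  exact: (ev_cup_even (m := 1) T Ly Le).
by rewrite -ev_genx_even.
Qed.

Lemma even_value_scale l a b c L :
  even_value (l * a) (l * b) c L = l ^+ (p * size L) * even_value a b c L.
Proof.
elim: L => [|e L IH] /=; first by rewrite muln0 mul1r.
rewrite IH mulnS exprD; set x := even_value _ _ _ _.
rewrite exprM; have [e2|_] := eqVneq p 2; last first.
  by rewrite !(mul0r, mulr0, addr0) !exprMn !exprS; ring.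
have e2l : l ^+ p = l * l by rewrite e2 expr2.
by rewrite !exprMn !exprS e2l exprMn; ring.
Qed.

End Evaluation.

Lemma even_value_ext p (k K : fieldType) (iota : {rmorphism k -> K}) a b c L :
  even_value p iota (iota a) (iota b) c L = iota (even_value p idfun a b c L).
Proof.
elim: L => [|e L IH] //=.
by rewrite IH !(rmorphD, rmorphM, rmorphXn, rmorph_nat).
Qed.

(** * Points defined by maps out of [K[t]/t^p] *)

Section Pi.
Variables (p : nat) (p_gt1 : (1 < p)%N) (k K : fieldType) (iota : {rmorphism k -> K}).
Variable alpha : {rmorphism trunc p K -> A p K}.
Hypothesis alphaC : forall c, alpha (trC p c) = AC p c.
Local Notation T := (alpha (trT p K)).
Local Notation cocycleA := (cocycle (@AC p k) (@Aeps p k)).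

Lemma pi_nil : T ^+ p = 0.
Proof. by rewrite -rmorphXn trTp // rmorph0. Qed.

Lemma pi_eps : Aeps T = 0.
Proof.
have E m : Aeps (T ^+ m) = Aeps T ^+ m.
  elim: m => [|m IH]; last by rewrite !exprS AepsM // IH.
  by rewrite !expr0 -[X in Aeps X](rmorph1 (@AC p K)) /Aeps AcoefC.
have /eqP := E p; rewrite pi_nil /Aeps Acoef0 eq_sym expf_eq0 => /andP[_ /eqP]; exact.
Qed.

Lemma pi_augment u : Aeps (alpha u) = treps u.
Proof.
rewrite {1}(trdivK p_gt1 u) rmorphD rmorphM alphaC.
rewrite /Aeps AcoefD AcoefC -[X in _ + X]/(Aeps _) AepsM //.
by rewrite pi_eps mul0r addr0.
Qed.

Lemma pullback_pi_cocycle n f : cocycleA n f ->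
  cocycle (@trC p K) (@treps p K) n (pullback iota alpha f).
Proof.
move=> /(scalar_ext_cocycle p_gt1 iota); apply: pullback_cocycle.
- by move=> c a b; rewrite rmorphD rmorphM alphaC.
- exact: rmorphM.
- exact: pi_augment.
Qed.

Lemma map_pi_alt n : map alpha (alt (trT p K ^+ p.-1) (trT p K) n) = alt (T ^+ p.-1) T n.
Proof.
rewrite -rmorphXn; move: (trT p K) (trT p K ^+ _) => v u.
by elim: n u v => //= n IH u v; rewrite IH.
Qed.

Lemma evE n f : ev iota T n f = pullback iota alpha f (alt (trT p K ^+ p.-1) (trT p K) n).
Proof. by rewrite /pullback map_pi_alt. Qed.

Lemma pullback_cup m n f g s : cochain (@AC p k) m f -> cochain (@AC p k) n g ->
  size s = (m + n)%N ->
  pullback iota alpha (cup m f g) s = cup m (pullback iota alpha f) (pullback iota alpha g) s.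
Proof.
move=> Lf Lg es; rewrite /pullback (scalar_ext_cup p_gt1 _ Lf Lg) ?size_map //.
by rewrite /cup map_take map_drop.
Qed.

(** Odd degrees are included: after pullback to [K[t]/t^p] the parity problem is settled by
    [tr_alt_cup]. *)
Lemma ev_cup m n f g : cocycleA m f -> cocycleA n g ->
  ev iota T (m + n) (cup m f g) = ev iota T m f * ev iota T n g.
Proof.
move=> Zf Zg; have [Lf _] := Zf; have [Lg _] := Zg.
rewrite !evE (pullback_cup Lf Lg) ?size_alt // tr_alt_cup //.
exact: pullback_pi_cocycle.
Qed.

Lemma point_ofP n f : cocycleA n f -> point_of iota alpha n f <-> ev iota T n f = 0.
Proof.
move=> Zf; rewrite evE -(tr_nilpotentP p_gt1 (pullback_pi_cocycle Zf)).
have E N s : size s = (N * n)%N ->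
    pullback iota alpha (cup_pow n f N) s = cup_pow n (pullback iota alpha f) N s.
  elim: N s => [|N IH] s; first by rewrite /pullback; case: s => //= _; exact: rmorph1.
  have [Lf _] := Zf.
  have L : cochain (@AC p k) (N * n) (cup_pow n f N).
    by elim: N {IH} => //= N IHN; rewrite mulSn; exact: cochain_cup.
  rewrite mulSn => es; rewrite /= (pullback_cup Lf L) // /cup IH //.
  by rewrite size_drop es addKn.
by split=> -[N BN]; exists N; apply: coboundary_ext BN => s es; rewrite E.
Qed.

End Pi.

(** * Universal property of the truncated algebras *)

Section Lift.
Variables (p : nat) (p_gt1 : (1 < p)%N) (R S : comNzRingType).
Variables (f : {rmorphism R -> S}) (T : S).
Hypothesis Tp : T ^+ p = 0.

Let lift (u : trunc p R) : S := (map_poly f (u : {poly R})).[T].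

Let lift_zmod_morphism : zmod_morphism lift.
Proof. by move=> u v; rewrite /lift /= !rmorphB hornerD hornerN. Qed.

Let lift_take (q : {poly R}) : (map_poly f (take_poly p q)).[T] = (map_poly f q).[T].
Proof.
rewrite -[q in RHS](poly_take_drop p) rmorphD rmorphM /= map_polyXn !hornerE.
by rewrite ?hornerXn Tp mulr0 addr0.
Qed.

Let lift_monoid_morphism : monoid_morphism lift.
Proof.
split=> [|u v]; first by rewrite -[1 in LHS](rmorph1 (@trC p R)) /lift /trC qpolyCE map_polyC hornerC; exact: rmorph1.
have -> : lift (u * v) = (map_poly f (take_poly p ((u : {poly R}) * v))).[T].
  rewrite /lift; congr (map_poly f _).[T]; apply/polyP => i; rewrite coef_take_poly.
  by rewrite -(trcoef_in p_gt1).
by rewrite lift_take rmorphM hornerM.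
Qed.

HB.instance Definition _ :=
  GRing.isZmodMorphism.Build (trunc p R) S lift lift_zmod_morphism.
HB.instance Definition _ :=
  GRing.isMonoidMorphism.Build (trunc p R) S lift lift_monoid_morphism.

Lemma tr_lift : exists phi : {rmorphism trunc p R -> S},
  (forall c, phi (trC p c) = f c) /\ phi (trT p R) = T.
Proof.
exists lift; split=> [c|] /=; first by rewrite /lift /trC qpolyCE map_polyC hornerC.
rewrite /lift; have -> : (trT p R : {poly R}) = 'X.
  apply/polyP => i; rewrite -[LHS]/(trcoef (trT p R) i) -[trT p R]expr1 trcoefTn // coefX.
  by case: eqP => [->|]; rewrite ?p_gt1 ?andbF.
by rewrite map_polyX hornerX.
Qed.

End Lift.

Lemma tr_rmorph_eq p (p_gt1 : (1 < p)%N) (R : comNzRingType) (S : pzRingType)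
    (f g : {rmorphism trunc p R -> S}) :
  (forall c, f (trC p c) = g (trC p c)) -> f (trT p R) = g (trT p R) -> f =1 g.
Proof.
move=> fgC fgT u; rewrite (tr_sum p_gt1 u) !rmorph_sum; apply: eq_bigr => i _.
by rewrite !rmorphM !rmorphXn /= fgC fgT.
Qed.

Section Characteristic.
Variables (p : nat) (F : fieldType) (charFp : p \in [pchar F]).
Let p_gt1 : (1 < p)%N. Proof. exact: prime_gt1 (pcharf_prime charFp). Qed.

Lemma A_lift (S : comNzRingType) (f : {rmorphism F -> S}) (X Y : S) :
  X ^+ p = 0 -> Y ^+ p = 0 ->
  exists phi : {rmorphism A p F -> S},
    [/\ forall c, phi (AC p c) = f c, phi (Ax p F) = X & phi (Ay p F) = Y].
Proof.
move=> Xp Yp; have [g [gC gT]] := tr_lift p_gt1 f Xp.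
have [h [hC hT]] := tr_lift p_gt1 g Yp.
by exists h; split=> [c||] //; rewrite /AC /Ax hC ?gC ?gT.
Qed.

Lemma A_rmorph_eq (S : pzRingType) (f g : {rmorphism A p F -> S}) :
  (forall c, f (AC p c) = g (AC p c)) -> f (Ax p F) = g (Ax p F) ->
  f (Ay p F) = g (Ay p F) -> f =1 g.
Proof.
move=> fgC fgx fgy u; rewrite (A_sum p_gt1 u) !rmorph_sum; apply: eq_bigr => i _.
rewrite !rmorph_sum; apply: eq_bigr => j _.
by rewrite /mon !rmorphM !rmorphXn /= fgC fgx fgy.
Qed.

Lemma pchar_A (R : comNzRingType) : p \in [pchar R] -> p \in [pchar (A p R)].
Proof.
move=> cp; rewrite inE (pcharf_prime charFp) /=.
by rewrite -(rmorph_nat (@AC p R)) (pcharf0 cp) rmorph0.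
Qed.

(** Frobenius is additive and kills every nonconstant monomial. Hence each element of the
    augmentation ideal is the image of [t] under some map. *)
Lemma A_nil (T : A p F) : Aeps T = 0 -> T ^+ p = 0.
Proof.
move=> T0; have cA := pchar_A charFp.
rewrite -(pFrobenius_autE cA) (A_sum p_gt1 T) rmorph_sum big1 // => i _.
rewrite rmorph_sum big1 // => j _; rewrite rmorphM /= [X in _ * X]pFrobenius_autE.
have [/andP[/eqP -> /eqP ->]|nij] := boolP ((i == 0%N :> nat) && (j == 0%N :> nat)).
  by rewrite -[Acoef T 0 0]/(Aeps T) T0 !rmorph0 mul0r.
rewrite exprMn -!exprM -[X in _ * X]/(mon p F (i * p, j * p)%N) mon_ge ?mulr0 //=.
by move: nij; rewrite negb_and; case: (nat_of_ord i) (nat_of_ord j) => [|a] [|b] //= _; lia.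
Qed.

End Characteristic.

(** * Points of Proj *)

Section LinearPoints.
Variables (p : nat) (F : fieldType) (charFp : p \in [pchar F]).
Let p_gt1 : (1 < p)%N. Proof. exact: prime_gt1 (pcharf_prime charFp). Qed.

Definition linpt (a b : F) : A p F := AC p a * Ax p F + AC p b * Ay p F.

Lemma AxE : Ax p F = mon p F (1, 0)%N. Proof. by rewrite /mon expr1 expr0 mulr1. Qed.
Lemma AyE : Ay p F = mon p F (0, 1)%N. Proof. by rewrite /mon expr1 expr0 mul1r. Qed.

Lemma linptx a b : Acoef (linpt a b) 1 0 = a.
Proof.
rewrite AcoefD !AcoefCM // AxE AyE !Acoef_mon // p_gt1 (ltnW p_gt1) /=.
by rewrite mulr1 mulr0 addr0.
Qed.

Lemma linpty a b : Acoef (linpt a b) 0 1 = b.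
Proof.
rewrite AcoefD !AcoefCM // AxE AyE !Acoef_mon // p_gt1 (ltnW p_gt1) /=.
by rewrite mulr1 mulr0 add0r.
Qed.

Lemma linpt_eps a b : Aeps (linpt a b) = 0.
Proof.
rewrite /Aeps AcoefD !AcoefCM // AxE AyE !Acoef_mon // (ltnW p_gt1) /=.
by rewrite !mulr0 addr0.
Qed.

Lemma A_eps_lift (T : A p F) : Aeps T = 0 ->
  exists alpha : {rmorphism trunc p F -> A p F},
    (forall c, alpha (trC p c) = AC p c) /\ alpha (trT p F) = T.
Proof. by move=> T0; exact: (@tr_lift p p_gt1 F (A p F) (@AC p F) T (A_nil charFp T0)). Qed.

End LinearPoints.

Section PointOf.
Variables (p : nat) (k : fieldType) (charkp : p \in [pchar k]).
Local Notation cocycleA := (cocycle (@AC p k) (@Aeps p k)).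
Local Notation coboundaryA := (coboundary (@AC p k) (@Aeps p k)).
Let p_gt1 : (1 < p)%N. Proof. exact: prime_gt1 (pcharf_prime charkp). Qed.

Lemma point_of_proj (K : fieldType) (iota : {rmorphism k -> K})
    (alpha : {rmorphism trunc p K -> A p K}) :
  (forall c, alpha (trC p c) = AC p c) ->
  Acoef (alpha (trT p K)) 1 0 != 0 \/ Acoef (alpha (trT p K)) 0 1 != 0 ->
  proj_point (point_of iota alpha : hset p k).
Proof.
move=> alC nz; have P := point_ofP p_gt1 iota alC.
have T0 := pi_eps p_gt1 alpha; have Tp := pi_nil p_gt1 alpha.
split; first split.
- move=> n f g Zf Zg B /(P _ _ Zf) Ef; apply/(P _ _ Zg).
  by rewrite -(ev_cohom p_gt1 iota T0 Tp B).
- by move=> n; apply/(P _ _ (@cocycle_zero _ _ _ _ _)); exact: scalar_ext0.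
- move=> n f g Zf Zg /(P _ _ Zf) Ef /(P _ _ Zg) Eg.
  apply/(P _ _ (cocycleD Zf Zg)).
  have -> : ev iota (alpha (trT p K)) n (fun s => f s + g s) =
            ev iota (alpha (trT p K)) n (fun s => 1 * f s + g s).
    by apply: eq_scalar_ext => r _; rewrite mul1r.
  by rewrite ev_lin Ef Eg mulr0 addr0.
- move=> m n f g Zf Zg /(P _ _ Zg) Eg; apply/(P _ _ (cocycle_cup Zf Zg)).
  by rewrite ev_cup // Eg mulr0.
- move=> m n f g Zf Zg /(P _ _ Zf) Ef; apply/(P _ _ (cocycle_cup Zf Zg)).
  by rewrite ev_cup // Ef mul0r.
- move=> /(P _ _ (@cocycle_one _ _ _ _)); rewrite /ev /= rmorph1 => /eqP.
  by rewrite oner_eq0.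
- move=> m n f g Zf Zg /(P _ _ (cocycle_cup Zf Zg)); rewrite ev_cup // => /eqP.
  by rewrite mulf_eq0 => /orP[] /eqP E; [left; apply/(P _ _ Zf) | right; apply/(P _ _ Zg)].
case: nz => nz.
- exists 2, (@zetax p k); split=> //; first exact: zetax_cocycle.
  move=> /(P _ _ (zetax_cocycle p_gt1 k)); rewrite /ev /= -[LHS]/(scalar_ext _ _ [:: _; _]).
  rewrite (scalar_ext_zetax p_gt1) zetax_alt // => /eqP.
  by rewrite expf_eq0 (negbTE nz) andbF.
- exists 2, (@zetay p k); split=> //; first exact: zetay_cocycle.
  move=> /(P _ _ (zetay_cocycle p_gt1 k)); rewrite /ev /= -[LHS]/(scalar_ext _ _ [:: _; _]).
  rewrite (scalar_ext_zetay p_gt1) zetay_alt // => /eqP.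
  by rewrite expf_eq0 (negbTE nz) andbF.
Qed.

Lemma even_square n (f : seq (A p k) -> k) : cocycleA n f ->
  exists c L, size L = n /\
    cohom (@AC p k) (@Aeps p k) n.*2 (cup n f f) (@even_class p k c L).
Proof.
by move=> Zf; apply: (even_form p_gt1); rewrite -addnn; exact: cocycle_cup.
Qed.

Lemma ev_square (K : fieldType) (iota : {rmorphism k -> K}) (T : A p K) n f c L :
  p \in [pchar K] -> Aeps T = 0 -> cocycleA n f -> size L = n ->
  cohom (@AC p k) (@Aeps p k) n.*2 (cup n f f) (@even_class p k c L) ->
  ev iota T n f ^+ 2 = even_value p iota (Acoef T 1 0) (Acoef T 0 1) c L.
Proof.
move=> cK T0 Zf sL E; have [alpha [alC alT]] := A_eps_lift cK T0.
have Tp := A_nil cK T0.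
rewrite -(ev_even_class p_gt1) // sL -(ev_cohom p_gt1 iota T0 Tp E) -addnn -alT.
by rewrite ev_cup.
Qed.

(** The square of the value is a form in the linear part with coefficients in [k]. It depends on
    nothing else of [T], commutes with [iota], and scales by a power of [l]. *)
Lemma ev_proportional (K : fieldType) (iota : {rmorphism k -> K}) (T : A p K)
    (a b : k) (l : K) n f :
  Aeps T = 0 -> l != 0 -> Acoef T 1 0 = l * iota a -> Acoef T 0 1 = l * iota b ->
  cocycleA n f ->
  ev iota T n f = 0 <-> ev idfun (linpt p a b) n f = 0.
Proof.
move=> T0 l0 Ta Tb Zf; have [c [L [sL E]]] := even_square Zf.
have cK : p \in [pchar K] by rewrite (rmorph_pchar iota).
have E1 := ev_square iota cK T0 Zf sL E.
have E2 := ev_square idfun charkp (linpt_eps charkp a b) Zf sL E.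
rewrite linptx // linpty // in E2.
rewrite Ta Tb even_value_scale // even_value_ext -E2 in E1.
have Z (R : fieldType) (x : R) : x = 0 <-> x ^+ 2 = 0.
  by split=> [->|/eqP]; [rewrite expr0n | rewrite expf_eq0 => /andP[_ /eqP]].
rewrite Z E1; rewrite (Z _ (ev idfun _ _ _)); split=> [/eqP|->]; last first.
  by rewrite rmorph0 mulr0.
by rewrite mulf_eq0 expf_eq0 (negbTE l0) andbF /= fmorph_eq0 => /eqP.
Qed.

End PointOf.

(** * Homogeneous primes *)

Section HomogeneousPrimes.
Variables (p : nat) (k : closedFieldType) (charkp : p \in [pchar k]).
Local Notation cocycleA := (cocycle (@AC p k) (@Aeps p k)).
Local Notation coboundaryA := (coboundary (@AC p k) (@Aeps p k)).
Local Notation cohomA := (cohom (@AC p k) (@Aeps p k)).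
Local Notation ev1 b := (ev idfun (linpt p 1 b)).
Let p_gt1 : (1 < p)%N. Proof. exact: prime_gt1 (pcharf_prime charkp). Qed.

(** The form [even_value] on the chart a = 1, as a polynomial in b. *)
Fixpoint even_poly_value (c : k) (L : seq (k * k)) : {poly k} :=
  if L is e :: L' then
    'X^p * even_poly_value c L' + e.1%:P + (e.2 * (p == 2)%:R)%:P * 'X
  else c%:P.

Lemma horner_even_poly_value c L b :
  (even_poly_value c L).[b] = even_value p idfun 1 b c L.
Proof.
elim: L => [|e L IH] /=; first exact: hornerC.
by rewrite !hornerE ?hornerXn IH !expr1n /=; ring.
Qed.

Lemma size_even_poly_value c L : (size (even_poly_value c L) <= (p * size L).+1)%N.
Proof.
elim: L => [|e L IH] /=; first by rewrite muln0 size_polyC leq_b1.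
rewrite mulnS; apply: (leq_trans (size_polyD _ _)); rewrite geq_max; apply/andP; split.
  apply: (leq_trans (size_polyD _ _)); rewrite geq_max size_polyC.
  rewrite (leq_trans (leq_b1 _)) // andbT (leq_trans (size_polyMleq _ _)) //.
  by rewrite size_polyXn addSn /= -addnS leq_add2l.
apply: (leq_trans (size_polyMleq _ _)); rewrite size_polyX addn2 /= size_polyC.
by case: eqP => _ /=; lia.
Qed.

(** The last two terms have degree below p and cannot cancel against a multiple of ['X^p]. *)
Lemma even_poly_value0 e c L : even_poly_value c (e :: L) = 0 ->
  [/\ even_poly_value c L = 0, e.1 = 0 & p = 2 -> e.2 = 0].
Proof.
move=> /= E; have C i : (i < p)%N ->
    (e.1%:P + (e.2 * (p == 2)%:R)%:P * 'X : {poly k})`_i = 0.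
  move=> ip; have := congr1 (fun q : {poly k} => q`_i) E.
  by rewrite /= -addrA coefD coefXnM ip add0r coef0.
have e1 : e.1 = 0.
  by have := C 0%N (ltnW p_gt1); rewrite coefD coefC coefMX /= addr0.
have e2 : e.2 * (p == 2)%:R = 0.
  by have := C 1%N p_gt1; rewrite coefD coefC coefMX coefC /= add0r.
split=> //; last by move=> p2; move: e2; rewrite p2 eqxx mulr1.
move: E; rewrite e1 e2 !polyC0 mul0r !addr0 => /eqP.
by rewrite mulf_eq0 expf_eq0 polyX_eq0 andbF => /eqP.
Qed.

(** A root of [q - 1] would be a point where q has value 1, so over a closed field [q - 1] is a
    nonzero constant, and the value of q at 0 decides. *)
Lemma poly_values0 (q : {poly k}) : (forall b, q.[b] = 0) -> q = 0.
Proof.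
move=> q0; have [/eqP/size_poly1P[c c0 E]|/closed_rootP[r]] := eqVneq (size (q - 1)) 1%N.
  have := q0 0; rewrite -[q](subrK 1) E !hornerE => cE; apply/eqP.
  by rewrite -polyC1 -polyCD cE polyC0.
by rewrite rootE !hornerE q0 sub0r oppr_eq0 oner_eq0.
Qed.

Variable P : hset p k.
Hypothesis hp : homog_prime P.

Lemma hp_ext n f g : cocycleA n f -> (forall s, size s = n -> f s = g s) ->
  P n f -> P n g.
Proof.
move=> Zf fg Pf; apply: (hp_class hp Zf (cocycle_ext fg Zf) _ Pf).
by apply: coboundary_ext (coboundary0 _ _ n) => s es; rewrite fg ?subrr.
Qed.

Lemma hp_cohom n f g : cocycleA n f -> cocycleA n g -> cohomA n f g ->
  P n f <-> P n g.
Proof.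
move=> Zf Zg E; split; apply: (hp_class hp) => //; exact: cohom_sym.
Qed.

Lemma hp_scale n e f : cocycleA n f -> P n f -> P n (fun s => e * f s).
Proof.
move=> Zf Pf; have Ze : cocycleA 0 (fun=> e).
  by apply: cocycle_ext (cocycleZ e (@cocycle_one _ _ _ _)) => s _; rewrite mulr1.
have := hp_mull hp Ze Zf Pf; apply: hp_ext; first exact: (cocycle_cup Ze Zf).
by move=> s _; rewrite /cup drop0.
Qed.

Lemma hp_lin n e f g : cocycleA n f -> cocycleA n g -> P n f -> P n g ->
  P n (fun s => e * f s + g s).
Proof.
by move=> Zf Zg Pf Pg; apply: (hp_add hp) => //; [exact: cocycleZ | exact: hp_scale].
Qed.

Lemma hp_coboundary n f : cocycleA n f -> coboundaryA n f -> P n f.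
Proof.
move=> Zf B; apply/(hp_cohom Zf (@cocycle_zero _ _ _ _ n)); last exact: (hp_zero hp).
by apply: coboundary_ext B => s _; rewrite subr0.
Qed.

Lemma hp_square n f : cocycleA n f -> P (n + n)%N (cup n f f) -> P n f.
Proof. by move=> Zf /(hp_prime hp Zf Zf)[]. Qed.

Lemma hp_lamy : p != 2 -> P 1 (@lamy p k).
Proof.
move=> p2; have Zl := lamy_cocycle p_gt1 k; apply: (hp_square Zl).
apply: hp_coboundary; first exact: (cocycle_cup Zl Zl).
by apply: (tr_lambda_sq (tr1_augmented p_gt1 k)); lia.
Qed.

(** The square of [lamx] is [zetax] for p = 2 and a coboundary for odd p. *)
Lemma hp_lamx : P 2 (@zetax p k) -> P 1 (@lamx p k).
Proof.
move=> Pz; have Zl := lamx_cocycle p_gt1 k; apply: (hp_square Zl).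
have [p2|p2] := eqVneq p 2.
  apply: hp_ext Pz; first exact: zetax_cocycle.
  move=> [|a [|b []]] // _; rewrite /cup /= !lamxE zetaxE.
  have -> : index_iota 1 p = [:: 1%N] by rewrite p2.
  by rewrite big_seq1 (_ : p - 1 = 1)%N // p2.
apply: hp_coboundary; first exact: (cocycle_cup Zl Zl).
have p_gt2 : (2 < p)%N by lia.
have B := tr_infl_coboundary p_gt1 (tr_lambda_sq (id_augmented k) p_gt2).
by apply: coboundary_ext B => s _; rewrite /lamx /tr_infl /cup map_take map_drop.
Qed.

Lemma hp_lamy' : P 2 (@zetay p k) -> P 1 (@lamy p k).
Proof.
have [p2 Pz|p2 _] := eqVneq p 2; last exact: hp_lamy.
have Zl := lamy_cocycle p_gt1 k; apply: (hp_square Zl).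
apply: hp_ext Pz; first exact: zetay_cocycle.
move=> [|a [|b []]] // _; rewrite /cup /= !lamyE zetayE //.
have -> : index_iota 1 p = [:: 1%N] by rewrite p2.
by rewrite big_seq1 (_ : p - 1 = 1)%N // p2.
Qed.

(** The vanishing form kills [c] and every coefficient except, for odd p, those of the terms in
    [lamy], and [lamy] is then nilpotent. *)
Lemma hp_even_class c L : even_poly_value c L = 0 ->
  P (size L).*2 (@even_class p k c L).
Proof.
elim: L => [/= /eqP|e L IH].
  rewrite polyC_eq0 => /eqP ->; exact: (hp_zero hp).
move=> /even_poly_value0[/IH PL e1 e2] /=.
have ZL := even_class_cocycle p_gt1 c L; have Zz := zetay_cocycle p_gt1 k.
have Zg := genx_cocycle p_gt1 k (size L).*2.+1; have Zl := lamy_cocycle p_gt1 k.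
have Zzl := cocycle_cup Zl Zg; have Zze := cocycle_cup Zz ZL.
have Pz := hp_mull hp Zz ZL PL.
have Pl : P (1 + (size L).*2.+1)%N (fun s => e.2 * cup 1 (@lamy p k) (genx (size L).*2.+1) s).
  have [p2|p2] := eqVneq p 2; last first.
    by apply: hp_scale => //; apply: (hp_mulr hp) => //; exact: hp_lamy.
  apply: hp_ext (@cocycle_zero _ _ _ _ _) _ (hp_zero hp _) => s _.
  by rewrite e2 // mul0r.
apply: hp_ext (hp_add hp Zze (cocycleZ e.2 Zzl) Pz Pl).
  exact: (cocycleD Zze (cocycleZ e.2 Zzl)).
by move=> s _; rewrite e1; ring.
Qed.

Lemma hp_ev_zero m h : cocycleA m.*2 h -> (forall b, ev1 b m.*2 h = 0) -> P m.*2 h.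
Proof.
move=> Zh h0; have [c [L [sL E]]] := even_form p_gt1 Zh.
have ZL := even_class_cocycle p_gt1 c L; rewrite sL in ZL.
apply/(hp_cohom Zh ZL E); rewrite -sL; apply: hp_even_class; apply: poly_values0 => b.
have T0 := linpt_eps charkp 1 b; have Tp := A_nil charkp T0.
have := ev_even_class p_gt1 idfun c L T0 Tp; rewrite linptx // linpty // sL.
by rewrite -(ev_cohom p_gt1 idfun T0 Tp E) h0 horner_even_poly_value => <-.
Qed.

(** In positive degree, every summand of the normal form of a square has a factor [zetax], [zetay]
    or [lamy], and the square of [lamy] is 0 or [zetay]. *)
Lemma hp_irrelevant : relevant P -> P 2 (@zetax p k) -> P 2 (@zetay p k) -> False.
Proof.
move=> [n [f [n0 Zf nP]]] Px Py; apply: nP; apply: (hp_square Zf).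
have [c [L [sL E]]] := even_square charkp Zf.
have ZL := even_class_cocycle p_gt1 c L.
rewrite addnn; apply/(hp_cohom _ _ E); [|by rewrite -sL|].
  by rewrite -addnn; exact: cocycle_cup.
rewrite -sL in n0 *; case: L n0 {E sL} ZL => // e L _ _.
have ZL := even_class_cocycle p_gt1 c L; have Zz := zetay_cocycle p_gt1 k.
have Zx := zetax_cocycle p_gt1 k; have Zl := lamy_cocycle p_gt1 k.
have Zg0 := genx_cocycle p_gt1 k (size L).*2.
have Zg := genx_cocycle p_gt1 k (size L).*2.+1.
have P1 := hp_mulr hp Zz ZL Py; have P2 := hp_mulr hp Zl Zg (hp_lamy' Py).
have P3 := hp_mulr hp Zx Zg0 Px.
have Z1 := cocycle_cup Zz ZL; have Z2 := cocycle_cup Zl Zg; have Z3 := cocycle_cup Zx Zg0.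
apply: hp_ext (hp_lin e.2 Z2 (cocycle_lin e.1 Z3 Z1) P2 (hp_lin e.1 Z3 Z1 P3 P1)).
  exact: (cocycle_lin e.2 Z2 (cocycle_lin e.1 Z3 Z1)).
by move=> s _ /=; rewrite genxSS; ring.
Qed.

(* The class that vanishes to order p at the point t |-> x + r y. *)
Definition zeta_at (r : k) (s : seq (A p k)) : k := - r ^+ p * zetax s + zetay s.

Lemma zeta_at_cocycle r : cocycleA 2 (zeta_at r).
Proof. by apply: cocycle_lin; [exact: zetax_cocycle | exact: zetay_cocycle]. Qed.

(** The power of [zetax], whose value on the chart a = 1 is 1, adjusts the degree without changing
    the form. *)
Fixpoint zeta_prod (rs : seq k) e : seq (A p k) -> k :=
  if rs is r :: rs' then cup 2 (zeta_at r) (zeta_prod rs' e)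
  else cup_pow 2 (@zetax p k) e.

Lemma zeta_prod_cocycle rs e : cocycleA (size rs + e).*2 (zeta_prod rs e).
Proof.
elim: rs => [|r rs IH] /=; last exact: (cocycle_cup (zeta_at_cocycle r) IH).
by rewrite -muln2; apply: cup_pow_cocycle; exact: zetax_cocycle.
Qed.

Lemma ev_zetax b : ev1 b 2 (@zetax p k) = 1.
Proof.
rewrite /ev -[alt _ _ _]/[:: _; _] (scalar_ext_zetax p_gt1) zetax_alt ?linpt_eps //.
by rewrite linptx // expr1n.
Qed.

Lemma ev_zeta_at r b : ev1 b 2 (zeta_at r) = (b - r) ^+ p.
Proof.
rewrite ev_lin ev_zetax mulr1 /ev -[alt _ _ _]/[:: _; _] (scalar_ext_zetay p_gt1).
rewrite zetay_alt ?linpt_eps // linpty // addrC -!(pFrobenius_autE charkp) /=.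
by rewrite -rmorphB.
Qed.

Lemma ev_zeta_prod rs e b :
  ev1 b (size rs + e).*2 (zeta_prod rs e) = (\prod_(r <- rs) (b - r)) ^+ p.
Proof.
have [Lx _] := zetax_cocycle p_gt1 k.
elim: rs => [|r rs IH] /=.
  rewrite big_nil expr1n add0n; elim: e => [|e IH]; first exact: rmorph1.
  have [Le _] := cup_pow_cocycle e (zetax_cocycle p_gt1 k); rewrite muln2 in Le.
  rewrite /= -[e.+1.*2]/(1.*2 + e.*2)%N (ev_cup_even p_gt1 idfun _ (m := 1) Lx Le).
  by rewrite ev_zetax mul1r.
rewrite big_cons exprMn -IH -ev_zeta_at; have [Lr _] := zeta_at_cocycle r.
have [Lp _] := zeta_prod_cocycle rs e.
exact: (ev_cup_even p_gt1 idfun _ (m := 1) Lr Lp).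
Qed.

Lemma hp_zeta_prod rs e r : r \in rs -> P 2 (zeta_at r) ->
  P (size rs + e).*2 (zeta_prod rs e).
Proof.
move=> rrs Pr; elim: rs rrs => //= r' rs IH; rewrite inE => /orP[/eqP <-|/IH Prs].
  exact: (hp_mulr hp (zeta_at_cocycle r) (zeta_prod_cocycle rs e) Pr).
exact: (hp_mull hp (zeta_at_cocycle r') (zeta_prod_cocycle rs e) Prs).
Qed.

Lemma hp_cup_pow n f N : cocycleA n f -> P (N * n)%N (cup_pow n f N) -> P n f.
Proof.
move=> Zf; elim: N => [|N IH] /=; first by move/(hp_proper hp).
rewrite mulSn => /(hp_prime hp Zf (cup_pow_cocycle N Zf))[//|]; exact: IH.
Qed.

Lemma hp_zeta_prod_inv rs e : P (size rs + e).*2 (zeta_prod rs e) ->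
  P 2 (@zetax p k) \/ exists r, P 2 (zeta_at r).
Proof.
elim: rs => [|r rs IH] /=.
  by rewrite add0n -muln2 => /(hp_cup_pow (zetax_cocycle p_gt1 k)); left.
move=> /(hp_prime hp (zeta_at_cocycle r) (zeta_prod_cocycle rs e))[Pr|/IH//].
by right; exists r.
Qed.

(** Over the closed field, q splits, so [h] and a scalar multiple of a product of classes
    [zeta_at r] have the same values at all b. *)
Lemma hp_roots M (h : seq (A p k) -> k) (q : {poly k}) : q != 0 ->
  (size q <= M.+1)%N -> cocycleA M.*2 h -> (forall b, ev1 b M.*2 h = q.[b] ^+ p) ->
  exists rs e, [/\ (size rs + e = M)%N, forall r, root q r -> r \in rs &
    P M.*2 h <-> P M.*2 (zeta_prod rs e)].
Proof.
move=> q0 sq Zh hq; have [rs qE] := closed_field_poly_normal q.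
have lq : lead_coef q != 0 by rewrite lead_coef_eq0.
have srs : (size rs <= M)%N.
  by rewrite -ltnS (leq_trans _ sq) // qE size_scale // size_prod_XsubC.
exists rs, (M - size rs)%N; rewrite subnKC //.
have Zp := zeta_prod_cocycle rs (M - size rs); rewrite subnKC // in Zp.
have evp b : ev1 b M.*2 (zeta_prod rs (M - size rs)) = (\prod_(r <- rs) (b - r)) ^+ p.
  by have := ev_zeta_prod rs (M - size rs) b; rewrite subnKC.
have qb b : q.[b] = lead_coef q * \prod_(r <- rs) (b - r).
  rewrite {1}qE hornerZ horner_prod; congr (_ * _); apply: eq_bigr => r _.
  by rewrite !hornerE.
(* The difference has value 0 everywhere on the chart and so lies in every homogeneous prime. *)
have Pd : P M.*2 (fun s => - lead_coef q ^+ p * zeta_prod rs (M - size rs) s + h s).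
  apply: hp_ev_zero; first exact: cocycle_lin.
  by move=> b; rewrite ev_lin evp hq qb exprMn mulNr addNr.
have Zd := cocycle_lin (- lead_coef q ^+ p) Zp Zh.
split=> // [r|].
  by rewrite qE rootZ // root_prod_XsubC.
split=> [Ph|Pp].
  have Q := hp_lin (-1) Zd Zh Pd Ph.
  have ZQ := cocycle_lin (-1) Zd Zh.
  have := hp_scale (lead_coef q ^+ p)^-1 ZQ Q; apply: hp_ext; first exact: cocycleZ.
  move=> s _; rewrite mulN1r opprD mulNr opprK addrNK mulKf //.
  by rewrite expf_neq0.
have Q := hp_lin (lead_coef q ^+ p) Zp Zd Pp Pd.
apply: hp_ext Q; first exact: cocycle_lin.
by move=> s _; ring.
Qed.

End HomogeneousPrimes.

(** * Specialising an arbitrary point to a linear one *)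

Section ClosedPoints.
Variables (p : nat) (k : closedFieldType) (charkp : p \in [pchar k]).
Local Notation cocycleA := (cocycle (@AC p k) (@Aeps p k)).
Local Notation ev1 b := (ev idfun (linpt p 1 b)).
Let p_gt1 : (1 < p)%N. Proof. exact: prime_gt1 (pcharf_prime charkp). Qed.
Variable P : hset p k.
Hypothesis PP : proj_point P.
Let hp : homog_prime P. Proof. by case: PP. Qed.

Lemma hp_const c : c != 0 -> P 0%N (fun=> c) -> False.
Proof.
move=> c0 Pc; have Zc : cocycleA 0 (fun=> c).
  by apply: cocycle_ext (cocycleZ c (@cocycle_one _ _ _ _)) => s _; rewrite mulr1.
apply: (hp_proper hp); apply: (hp_ext hp _ _ (hp_scale hp c^-1 Zc Pc)).
  exact: cocycleZ.
by move=> s _; rewrite mulVf.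
Qed.

(** Modulo [P], which contains [zetax] and hence [lamx], the class is c times a power of [zetay]. *)
Lemma hp_even_class_zetay c L : c != 0 -> P 2 (@zetax p k) ->
  P (size L).*2 (@even_class p k c L) -> P 2 (@zetay p k).
Proof.
move=> c0 Px; elim: L => [|e L IH]; first by move/(hp_const c0).
have ZeL := even_class_cocycle p_gt1 c (e :: L).
have ZL := even_class_cocycle p_gt1 c L; have Zz := zetay_cocycle p_gt1 k.
have Zx := zetax_cocycle p_gt1 k; have Zl := lamy_cocycle p_gt1 k.
have Zg0 := genx_cocycle p_gt1 k (size L).*2.
have Zg := genx_cocycle p_gt1 k (size L).*2.+1.
have Pg : P (size L).*2.+1 (@genx p k (size L).*2.+1).
  case: (size L) Zg => [|n] _; first exact: (hp_lamx charkp hp Px).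
  have Zg := genx_cocycle p_gt1 k n.*2.+1.
  apply: (hp_ext hp _ _ (hp_mulr hp Zx Zg Px)); first exact: (cocycle_cup Zx Zg).
  by move=> s _; rewrite genxSS.
have P2 := hp_mull hp Zl Zg Pg; have P3 := hp_mulr hp Zx Zg0 Px.
have Z1 := cocycle_cup Zz ZL; have Z2 := cocycle_cup Zl Zg; have Z3 := cocycle_cup Zx Zg0.
move=> PeL; have P4 := hp_lin hp (- e.1) Z3 ZeL P3 PeL.
have Z4 := cocycle_lin (- e.1) Z3 ZeL.
have P5 := hp_lin hp (- e.2) Z2 Z4 P2 P4; have Z5 := cocycle_lin (- e.2) Z2 Z4.
have {P5} : P (2 + (size L).*2)%N (cup 2 (@zetay p k) (even_class c L)).
  by apply: (hp_ext hp Z5 _ P5) => s _; rewrite /= genxSS; ring.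
by move/(hp_prime hp Zz ZL) => [//|/IH].
Qed.

Lemma even_value01 c L : even_value p idfun (0 : k) 1 c L = c.
Proof.
elim: L => //= e L ->.
have -> : (0 : k) ^+ p = 0 by rewrite expr0n gtn_eqF // ltnW.
by rewrite exprS !(mul0r, mulr0) expr1n mul1r !addr0.
Qed.

Lemma hp_cup_pow_mem n f N : (0 < N)%N -> cocycleA n f -> P n f ->
  P (N * n)%N (cup_pow n f N).
Proof.
case: N => // N _ Zf Pf; rewrite mulSn.
exact: (hp_mulr hp Zf (cup_pow_cocycle N Zf) Pf).
Qed.

Lemma ev1_cup_pow b n f N : cocycleA n f ->
  ev1 b (N * n) (cup_pow n f N) = ev1 b n f ^+ N.
Proof.
move=> Zf; have [alpha [alC <-]] := A_eps_lift charkp (linpt_eps charkp 1 b).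
elim: N => [|N IH]; first exact: rmorph1.
by rewrite mulSn /= ev_cup ?IH ?exprS //; exact: cup_pow_cocycle.
Qed.

Lemma ev1_square b n f : cocycleA n f -> ev1 b (n + n) (cup n f f) = ev1 b n f ^+ 2.
Proof.
move=> Zf; have [alpha [alC <-]] := A_eps_lift charkp (linpt_eps charkp 1 b).
by rewrite ev_cup.
Qed.

Lemma proj_point_sub : exists a b : k, (a != 0 \/ b != 0) /\
  forall n f, cocycleA n f -> P n f -> ev idfun (linpt p a b) n f = 0.
Proof.
have rel : relevant P by case: PP.
have Zx := zetax_cocycle p_gt1 k; have Zy := zetay_cocycle p_gt1 k.
(* If [P] contains [zetax], it specialises to the point of y: there the square of the value is c,
   and a nonzero c would put [zetay] into [P] too, against relevance. *)
have [Px|nPx] := classic (P 2 (@zetax p k)).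
  exists 0, 1; split=> [|n f Zf Pf]; first by right; exact: oner_neq0.
  have [c [L [sL E]]] := even_square charkp Zf.
  have Zff : cocycleA n.*2 (cup n f f) by rewrite -addnn; exact: cocycle_cup.
  have ZL := even_class_cocycle p_gt1 c L; rewrite sL in ZL.
  have := ev_square charkp idfun charkp (linpt_eps charkp 0 1) Zf sL E.
  rewrite linptx // linpty // even_value01 => Ec.
  have [/eqP c0|c0] := eqVneq c 0.
    by move: c0; rewrite -Ec expf_eq0 => /eqP.
  case: (hp_irrelevant charkp hp rel Px); apply: (hp_even_class_zetay c0 Px (L := L)).
  rewrite sL; apply/(hp_cohom hp Zff ZL E); rewrite -addnn; exact: (hp_mulr hp Zf Zf Pf).
(* [g] is the p-th power of the square of f: its value is a p-th power of a polynomial, as is that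
   of each [zeta_prod]. *)
have pow n f : cocycleA n f -> P n f -> exists c L,
   let q := even_poly_value p c L in
   [/\ (size q <= (p * n).+1)%N, forall b, ev1 b n f ^+ 2 = q.[b] &
     exists g, [/\ cocycleA (p * n).*2 g, P (p * n).*2 g &
                   forall b, ev1 b (p * n).*2 g = q.[b] ^+ p]].
  move=> Zf Pf; have [c [L [sL E]]] := even_square charkp Zf; exists c, L => q.
  have qb b : ev1 b n f ^+ 2 = q.[b].
    have := ev_square charkp idfun charkp (linpt_eps charkp 1 b) Zf sL E.
    by rewrite linptx // linpty // horner_even_poly_value.
  split=> //; first by rewrite -sL; exact: size_even_poly_value.
  have Zff : cocycleA (n + n) (cup n f f) by exact: cocycle_cup.
  exists (cup_pow (n + n) (cup n f f) p); rewrite -addnn -mulnDr; split.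
  - exact: cup_pow_cocycle.
  - by apply: hp_cup_pow_mem => //; [exact: ltnW | exact: (hp_mulr hp Zf Zf Pf)].
  - by move=> b; rewrite ev1_cup_pow // ev1_square // qb.
have [[r Pr]|nPr] := classic (exists r, P 2 (zeta_at r)).
  exists 1, r; split=> [|n f Zf Pf]; first by left; exact: oner_neq0.
  have [c [L [sq qb [g [Zg Pg gq]]]]] := pow n f Zf Pf.
  set q := even_poly_value p c L in sq qb gq.
  apply/eqP; rewrite -[_ == 0]andTb -[true]/(0 < 2)%N -expf_eq0 qb; apply/negPn/negP => qr.
  have Zpx := cup_pow_cocycle (p * n) Zx; rewrite muln2 in Zpx.
  (* The polynomial of [h] is q minus its value at r, which has the root r, so [h] is in [P] with
     [zeta_at r]. Subtracting it from [g] leaves a multiple of a power of [zetax], which is not in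
     [P] unless q vanishes at r. *)
  pose h s := - q.[r] ^+ p * cup_pow 2 (@zetax p k) (p * n) s + g s.
  have Zh : cocycleA (p * n).*2 h by exact: cocycle_lin.
  have evx b : ev1 b (p * n).*2 (cup_pow 2 (@zetax p k) (p * n)) = 1.
    by rewrite -muln2 ev1_cup_pow // ev_zetax // expr1n.
  have hq b : ev1 b (p * n).*2 h = (q - q.[r]%:P).[b] ^+ p.
    rewrite ev_lin evx gq mulr1 addrC hornerD hornerN hornerC.
    by rewrite -!(pFrobenius_autE charkp) -rmorphB.
  have Ph : P (p * n).*2 h.
    have [q0|q0] := eqVneq (q - q.[r]%:P) 0.
      apply: (hp_ev_zero charkp hp Zh) => b.
      by rewrite hq q0 horner0 expr0n gtn_eqF // ltnW.
    have sq' : (size (q - q.[r]%:P)%R <= (p * n).+1)%N.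
      rewrite (leq_trans (size_polyD _ _)) // geq_max sq size_polyN size_polyC.
      by rewrite (leq_trans (leq_b1 _)).
    have [rs [e [<- rsr ->]]] := hp_roots charkp hp q0 sq' Zh hq.
    apply: (hp_zeta_prod charkp hp _ _ Pr); apply: rsr.
    by rewrite rootE hornerD hornerN hornerC subrr.
  have Pgx := hp_lin hp (-1) Zh Zg Ph Pg; have Zgx := cocycle_lin (-1) Zh Zg.
  have /hp_cup_pow Px : P (p * n * 2)%N (cup_pow 2 (@zetax p k) (p * n)).
    rewrite muln2; apply: (hp_ext hp _ _ (hp_scale hp (q.[r] ^+ p)^-1 Zgx Pgx)).
      exact: cocycleZ.
    by move=> s _; rewrite mulN1r opprD addrNK mulNr opprK mulKf // expf_neq0.
  exact: (nPx (Px hp Zx)).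
(* The generic case: a nonzero q would put [zetax] or some [zeta_at r] into [P], so every class in
   [P] vanishes on the whole chart and any b serves. *)
exists 1, 0; split=> [|n f Zf Pf]; first by left; exact: oner_neq0.
have [c [L [sq qb [g [Zg Pg gq]]]]] := pow n f Zf Pf.
set q := even_poly_value p c L in sq qb gq.
have [q0|q0] := eqVneq q 0.
  by have /eqP := qb 0; rewrite q0 horner0 expf_eq0 => /eqP.
have [rs [e [eM _ Ph]]] := hp_roots charkp hp q0 sq Zg gq.
move/Ph: Pg; rewrite -eM => /(hp_zeta_prod_inv charkp hp)[//|[r Pr]].
by case: nPr; exists r.
Qed.

End ClosedPoints.

Lemma closed_point_linear (p : nat) (k : closedFieldType) (charkp : p \in [pchar k])
    (P : hset p k) : closed_point P ->
  exists a b : k, (a != 0 \/ b != 0) /\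
  forall n f, cocycle (@AC p k) (@Aeps p k) n f ->
    P n f <-> ev idfun (linpt p a b) n f = 0.
Proof.
move=> [PP [Z ZP]]; have [a [b [ab Psub]]] := proj_point_sub charkp PP.
have p_gt1 : (1 < p)%N := prime_gt1 (pcharf_prime charkp).
exists a, b; split=> //; have [alpha [alC alT]] := A_eps_lift charkp (linpt_eps charkp a b).
pose Q : hset p k := point_of idfun alpha.
have QP : proj_point Q.
  by apply: (point_of_proj charkp idfun alC); rewrite alT linptx // linpty.
have QE n f : cocycle (@AC p k) (@Aeps p k) n f -> Q n f <-> ev idfun (linpt p a b) n f = 0.
  by move=> Zf; rewrite -alT; exact: (point_ofP p_gt1 idfun alC Zf).
(* [Z] is contained in [P], and [P] in [Q]; so [Q] lies in the closed set of [Z], which has the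
   single point [P]. *)
have ZsubP : hsub Z P by apply/ZP => //; split.
have /(ZP _ QP)[QsubP PsubQ] : hsub Z Q.
  by move=> n f Zf /(ZsubP n f Zf) /(Psub n f Zf) /(QE n f Zf).
move=> n f Zf; rewrite -QE //; split; [exact: PsubQ | exact: QsubP].
Qed.

(** * Flatness and linear parts *)

Section Order.
Variables (p : nat) (p_gt1 : (1 < p)%N) (R : comNzRingType).
Implicit Types a b : A p R.

(* a lies in the d-th power of the augmentation ideal. *)
Definition ord_ge d a := forall i j, (i + j < d)%N -> Acoef a i j = 0.

Lemma AcoefM a b i j : (i < p)%N -> (j < p)%N -> Acoef (a * b) i j =
  \sum_(j' < j.+1) \sum_(i' < i.+1) Acoef a i' j' * Acoef b (i - i') (j - j').
Proof.
move=> ip jp; rewrite /Acoef trcoefM // trcoef_sum.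
by apply: eq_bigr => j' _; rewrite trcoefM.
Qed.

Lemma ord_geM d e a b : ord_ge d a -> ord_ge e b -> ord_ge (d + e) (a * b).
Proof.
move=> ad be i j ij.
have [/Acoef_ge -> //|] := boolP ((p <= i)%N || (p <= j)%N).
rewrite negb_or -!ltnNge => /andP[ip jp]; rewrite AcoefM // big1 // => j' _.
rewrite big1 // => i' _; have [ad'|ad'] := ltnP (i' + j') d; first by rewrite ad ?mul0r.
by rewrite be ?mulr0 //; have := ltn_ord i'; have := ltn_ord j'; lia.
Qed.

Lemma ord_geX d a m : ord_ge d a -> ord_ge (m * d) (a ^+ m).
Proof.
move=> ad; elim: m => [|m IH]; first by move=> i j; rewrite mul0n.
by rewrite exprS mulSn; exact: ord_geM.
Qed.

Lemma ord_ge_eq0 a : ord_ge p.*2.-1 a -> a = 0.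
Proof. by move=> a0; apply: AP => // i j ip jp; rewrite Acoef0 a0 //; lia. Qed.

Lemma Aeps_nilpotent a : Aeps a = 0 -> a ^+ p.*2.-1 = 0.
Proof.
move=> a0; have a1 : ord_ge 1 a by move=> [|i] [|j].
by apply: ord_ge_eq0; have := @ord_geX 1 a p.*2.-1 a1; rewrite muln1.
Qed.

End Order.

Section ResidueModule.
Variables (p : nat) (p_gt1 : (1 < p)%N) (K : fieldType).

(* The hypothesis is part of the type because the action of K[t]/t^p on K is
   associative only for 1 < p. *)
Definition residue : Type := let _ := p_gt1 in K.
HB.instance Definition _ := GRing.Zmodule.copy residue K.

Definition residue_scale (a : trunc p K) (v : residue) : residue := treps a * (v : K).

Fact residue_scaleA a b v : residue_scale a (residue_scale b v) = residue_scale (a * b) v.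
Proof. by rewrite /residue_scale trepsM // mulrA. Qed.
Fact residue_scale1 : left_id 1 residue_scale.
Proof. by move=> v; rewrite /residue_scale /treps trcoef1 // mul1r. Qed.
Fact residue_scaleDr : right_distributive residue_scale +%R.
Proof. by move=> a u v; exact: mulrDr. Qed.
Fact residue_scaleDl v : {morph residue_scale^~ v : a b / a + b}.
Proof. by move=> a b; rewrite /residue_scale /treps trcoefD mulrDl. Qed.

HB.instance Definition _ := GRing.Zmodule_isLmodule.Build (trunc p K) residue
  residue_scaleA residue_scale1 residue_scaleDr residue_scaleDl.

Definition socle (v : residue) : (trunc p K)^o := trC p (v : K) * trT p K ^+ p.-1.

Fact socle_linear : linear socle.
Proof.
move=> a u v; rewrite /socle -[a *: u]/(treps a * (u : K)) rmorphD mulrDl rmorphM /=.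
congr (_ + _); rewrite -[RHS]/(a * (trC p (u : K) * trT p K ^+ p.-1)).
rewrite [trC p (treps a) * _]mulrC -mulrA -trcoefTM1 //.
by rewrite [RHS]mulrC -mulrA.
Qed.

HB.instance Definition _ := GRing.isLinear.Build (trunc p K) residue (trunc p K)^o *:%R
  socle socle_linear.

Lemma socle_inj : injective socle.
Proof.
move=> u v /(congr1 (fun a : trunc p K => trcoef a p.-1)).
have p1 : (p.-1 < p)%N by lia.
by rewrite /socle !trcoefCM // trcoefTn // eqxx p1 !mulr1.
Qed.

End ResidueModule.

(* Otherwise T^(p-1) is in the socle of A, and tensoring the inclusion of the
   socle of K[t]/t^p kills the class of x. *)
Lemma flat_linear_part p (p_gt1 : (1 < p)%N) (K : fieldType)
    (alpha : {rmorphism trunc p K -> A p K}) :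
  (forall c, alpha (trC p c) = AC p c) -> flat alpha ->
  Acoef (alpha (trT p K)) 1 0 != 0 \/ Acoef (alpha (trT p K)) 0 1 != 0.
Proof.
move=> alC al_flat; have T0 := pi_eps p_gt1 alpha.
set T := alpha (trT p K) in T0 *.
have [Tx|Tx] := eqVneq (Acoef T 1 0) 0; last by left.
have [Ty|Ty] := eqVneq (Acoef T 0 1) 0; last by right.
have T2 : ord_ge 2 T.
  by move=> [|[|i]] [|[|j]] // ij; exfalso; lia.
have x1 : ord_ge 1 (Ax p K).
  by move=> [|i] [|j] // _; rewrite AxE Acoef_mon // !andbF.
have xT : T ^+ p.-1 * Ax p K = 0.
  (* The product has order at least 2(p - 1) + 1, one more than the top degree 2p - 2 of [A]. *)
  apply: ord_ge_eq0 => //; have -> : (p.*2.-1 = p.-1 * 2 + 1)%N by lia.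
  by apply: ord_geM => //; exact: ord_geX.
have x10 : Acoef (Ax p K) 1 0 = 1.
  by rewrite AxE Acoef_mon // p_gt1 (ltnW p_gt1).
pose one : residue p_gt1 K := (1 : K).
have pre : null_tensor alpha [:: (Ax p K, socle one)].
  move=> Z b bD1 bD2 bM; rewrite big_seq1 /= /socle rmorph1 mul1r.
  have -> : trT p K ^+ p.-1 = (trT p K ^+ p.-1) *: (1 : (trunc p K)^o).
    by rewrite [RHS]mulr1.
  rewrite -bM rmorphXn xT; apply: (addrI (b 0 1)).
  by rewrite addr0 -bD1 addr0.
(* Since [T] has order at least 2, reading the coefficient of x is balanced over [K[t]/t^p]; it
   shows that the tensor of x with [one] is nonzero. *)
have Bal (r : trunc p K) (s : A p K) : Acoef (alpha r * s) 1 0 = treps r * Acoef s 1 0.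
  rewrite {1}(trdivK p_gt1 r) rmorphD rmorphM alC mulrDl AcoefD AcoefCM // -mulrA.
  by rewrite [X in _ + X](@ord_geM p p_gt1 _ 2 0 T _ T2) // addr0.
have post := al_flat _ _ (@socle p p_gt1 K : {linear residue p_gt1 K -> (trunc p K)^o})
  (@socle_inj p p_gt1 K) [:: (Ax p K, one)] pre.
have H1 (s1 s2 : A p K) (m : K) : Acoef (s1 + s2) 1 0 * m = Acoef s1 1 0 * m + Acoef s2 1 0 * m.
  by rewrite AcoefD mulrDl.
have H2 (s : A p K) (m1 m2 : K) : Acoef s 1 0 * (m1 + m2) = Acoef s 1 0 * m1 + Acoef s 1 0 * m2.
  by rewrite mulrDr.
have H3 (r : trunc p K) (s : A p K) (m : K) :
    Acoef (alpha r * s) 1 0 * m = Acoef s 1 0 * (treps r * m).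
  by rewrite Bal; ring.
have /eqP := post K (fun s m => Acoef s 1 0 * (m : K)) H1 H2 H3.
by rewrite big_seq1 /= x10 mul1r oner_eq0.
Qed.

(** * Projectivity over the truncated polynomials *)

Section Projectivity.
Variables (p : nat) (p_gt1 : (1 < p)%N) (K : fieldType).

Definition jordan : 'M[K]_p := \matrix_(i, j) (i == j.+1 :> nat)%:R.

Lemma jordan_exp e i j : (jordan ^+ e) i j = (i == (j + e)%N :> nat)%:R.
Proof.
elim: e i j => [|e IH] i j; first by rewrite expr0 mxE addn0.
rewrite exprS -mulmxE mxE; case: (posnP i) => [i0|i0].
  rewrite i0 addnS big1 // => s _; rewrite mxE i0 mul0r //.
have ip : (i.-1 < p)%N by have := ltn_ord i; lia.
rewrite (bigD1 (Ordinal ip)) //= big1 => [|s ns].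
  by rewrite mxE IH /= prednK // eqxx mul1r addr0 addnS -eqSS prednK.
rewrite mxE (_ : (_ == _) = false) ?mul0r //; apply/negbTE; apply: contraNneq ns => es.
by apply/eqP/val_inj; rewrite /= es.
Qed.

Lemma jordan_nil : jordan ^+ p = 0.
Proof. by apply/matrixP => i j; rewrite jordan_exp mxE; have := ltn_ord i; case: eqP => //; lia. Qed.

Variables (M : 'M[K]_p) (m1 : K).
Hypothesis m1_neq0 : m1 != 0.
Hypothesis Mlow : forall i j : 'I_p, (i <= j)%N -> M i j = 0.
Hypothesis Msub : forall i j : 'I_p, i = j.+1 :> nat -> M i j = m1.

Lemma strict_low_exp e (i j : 'I_p) : (i <= j + e)%N ->
  (M ^+ e) i j = (i == (j + e)%N :> nat)%:R * m1 ^+ e.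
Proof.
elim: e i j => [|e IH] i j ije; first by rewrite !expr0 mxE addn0 mulr1.
rewrite exprS -mulmxE mxE; have [E|nE] := eqVneq (i : nat) (j + e.+1)%N; last first.
  rewrite mul0r big1 // => s _; have [si|is_] := ltnP s i; last by rewrite Mlow ?mul0r.
  rewrite IH; last by lia.
  by rewrite (_ : (_ == _) = false) ?mul0r ?mulr0 //; apply/negbTE; lia.
have sp : (j + e < p)%N by have := ltn_ord i; lia.
rewrite (bigD1 (Ordinal sp)) //= IH //= eqxx Msub ?E ?addnS // big1 => [|s ns].
  by rewrite !mul1r addr0 exprS.
have {}ns : (s != j + e :> nat)%N by [].
have [si|is_] := ltnP s i; last by rewrite Mlow ?mul0r.
rewrite IH; last by lia.
by rewrite (negbTE ns) mul0r mulr0.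
Qed.

Lemma strict_low_nil : M ^+ p = 0.
Proof.
apply/matrixP => i j; rewrite strict_low_exp ?mxE; have := ltn_ord i; last by lia.
by move=> ip; rewrite (_ : (_ == _) = false) ?mul0r //; apply/negbTE; lia.
Qed.

Let p_gt0 : (0 < p)%N. Proof. exact: ltnW. Qed.
Let o := Ordinal p_gt0.

(** [N] shifts the columns [u], [N *m u], ... and kills the last one. *)
Lemma krylov_jordan m (N : 'M[K]_m) (u : 'cV[K]_m) : N ^+ p = 0 ->
  let Q := \matrix_(i < m, j < p) (N ^+ j *m u) i 0 in N *m Q = Q *m jordan.
Proof.
move=> Np Q; apply/matrixP => i j; transitivity ((N ^+ j.+1 *m u) i 0).
  rewrite exprS -mulmxE -mulmxA !mxE; apply: eq_bigr => s _; by rewrite !mxE.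
have [jp|jp] := ltnP j.+1 p.
  rewrite [RHS]mxE (bigD1 (Ordinal jp)) //= [jordan _ _]mxE eqxx mulr1 big1 => [|s ns].
    by rewrite addr0 [RHS]mxE.
  rewrite [jordan _ _]mxE (_ : (_ == _) = false) ?mulr0 //; apply/negbTE.
  by apply: contraNneq ns => es; apply/eqP/val_inj.
have -> : j.+1 = p by have := ltn_ord j; lia.
rewrite Np mul0mx mxE [RHS]mxE big1 // => s _.
rewrite [jordan _ _]mxE (_ : (_ == _) = false) ?mulr0 //.
by apply/negbTE; have := ltn_ord s; lia.
Qed.

Lemma intertwine_exp m n (g : 'M[K]_(m, n)) N1 N2 e :
  g *m N1 = N2 *m g -> g *m (N1 ^+ e) = (N2 ^+ e) *m g.
Proof.
move=> gN; elim: e => [|e IH]; first by rewrite !expr0 mulmx1 mul1mx.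
by rewrite !exprS -!mulmxE mulmxA gN -mulmxA IH mulmxA.
Qed.

(** The nonzero constant subdiagonal makes the first basis vector generate a free module of rank
    one, so a lift is given by any preimage of the image of that vector. The Krylov matrix [Q] is
    triangular with powers of [m1] on its diagonal, hence invertible. *)
Lemma projective_strict_low : projective p M.
Proof.
move=> a1 a2 N1 N2 g h N1p N2p gN rg hM.
have /row_freeP[B gB] : row_free g by rewrite /row_free rg.
pose e0 : 'cV[K]_p := delta_mx o 0.
pose u := B *m (h *m e0).
pose Q := \matrix_(i < p, j < p) (M ^+ j *m e0) i 0.
pose L := \matrix_(i < a1, j < p) (N1 ^+ j *m u) i 0.
have MQ : M *m Q = Q *m jordan := krylov_jordan e0 strict_low_nil.
have NL : N1 *m L = L *m jordan := krylov_jordan u N1p.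
have Qe (i j : 'I_p) : Q i j = (M ^+ j) i o.
  rewrite mxE mxE (bigD1 o) //= big1 => [|s ns]; first by rewrite mxE !eqxx mulr1 addr0.
  by rewrite mxE (negbTE ns) mulr0.
have Qu : Q \in unitmx.
  rewrite unitmxE det_trig; last first.
    apply/is_trig_mxP => i j ij; rewrite Qe strict_low_exp //=; last by lia.
    by rewrite (_ : (_ == _) = false) ?mul0r //; apply/negbTE; lia.
  rewrite unitfE; apply/prodf_neq0 => i _; rewrite Qe strict_low_exp //=.
  by rewrite add0n eqxx mul1r expf_neq0.
have gL : g *m L = h *m Q.
  apply/matrixP => i j; transitivity ((g *m (N1 ^+ j *m u)) i 0).
    by rewrite !mxE; apply: eq_bigr => s _; rewrite [L _ _]mxE.
  rewrite mulmxA (intertwine_exp _ gN) /u -mulmxA [g *m _]mulmxA gB mul1mx mulmxA.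
  rewrite -(intertwine_exp _ hM) -mulmxA [LHS]mxE [RHS]mxE; apply: eq_bigr => s _.
  by rewrite [Q _ _]mxE.
exists (L *m invmx Q); last by rewrite mulmxA gL mulmxK.
have QM : invmx Q *m M = jordan *m invmx Q.
  by rewrite -[M](mulmxK Qu) MQ !mulmxA mulVmx // mul1mx.
by rewrite -mulmxA QM mulmxA -NL mulmxA.
Qed.

End Projectivity.

(** * The test module *)

Section TestModule.
Variables (p : nat) (k : fieldType) (charkp : p \in [pchar k]) (a0 b0 : k).
Let p_gt1 : (1 < p)%N. Proof. exact: prime_gt1 (pcharf_prime charkp). Qed.

Lemma scalemx_exp (F : fieldType) n (c : F) (M : 'M[F]_n) e :
  (c *: M) ^+ e = c ^+ e *: M ^+ e.
Proof.
elim: e => [|e IH]; first by rewrite !expr0 scale1r.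
by rewrite !exprS IH -!mulmxE -scalemxAl -scalemxAr scalerA.
Qed.

Fact testxyC : (b0 *: jordan p k) * (- a0 *: jordan p k) =
  (- a0 *: jordan p k) * (b0 *: jordan p k).
Proof. by rewrite -!mulmxE -!scalemxAl -!scalemxAr !scalerA mulrC. Qed.
Fact testxp : (b0 *: jordan p k) ^+ p = 0.
Proof. by rewrite scalemx_exp jordan_nil ?scaler0. Qed.
Fact testyp : (- a0 *: jordan p k) ^+ p = 0.
Proof. by rewrite scalemx_exp jordan_nil ?scaler0. Qed.

(* k[x,y]/(x^p, y^p) acting on k[t]/t^p through x |-> b0 t, y |-> - a0 t: it
   is annihilated by a0 x + b0 y. *)
Definition test_module : fdmod p k := FdMod testxyC testxp testyp.

Lemma restr_test (K : fieldType) (iota : {rmorphism k -> K}) (alpha : trunc p K -> A p K)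
    (r c : 'I_p) :
  restr iota alpha test_module r c = \sum_(i < p) \sum_(j < p)
    Acoef (alpha (trT p K)) i j * iota b0 ^+ i * (- iota a0) ^+ j
    * (r == (c + (i + j))%N :> nat)%:R.
Proof.
have jK : map_mx iota (jordan p k) = jordan p K.
  by apply/matrixP => i j; rewrite !mxE rmorph_nat.
rewrite /restr /Aev /= !map_mxZ !rmorphN jK summxE; apply: eq_bigr => i _.
rewrite summxE; apply: eq_bigr => j _.
rewrite !scalemx_exp -!mulmxE mul_scalar_mx -!scalemxAl -scalemxAr !scalerA mulmxE -exprD.
by rewrite mxE jordan_exp.
Qed.

(** [T] acts as a polynomial in the Jordan block without constant term; its linear coefficient is
    the difference of the two sides of the inequality. *)
Lemma restr_test_projective (K : fieldType) (iota : {rmorphism k -> K})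
    (alpha : trunc p K -> A p K) :
  Aeps (alpha (trT p K)) = 0 ->
  Acoef (alpha (trT p K)) 1 0 * iota b0 != Acoef (alpha (trT p K)) 0 1 * iota a0 ->
  projective p (restr iota alpha test_module).
Proof.
move=> T0 ab; set T := alpha _ in T0 ab.
apply: (projective_strict_low p_gt1 (m1 := Acoef T 1 0 * iota b0 - Acoef T 0 1 * iota a0)).
- by rewrite subr_eq0.
- move=> r c rc; rewrite restr_test -/T big1 // => i _; rewrite big1 // => j _.
  have [/andP[/eqP -> /eqP ->]|ij] := boolP ((i == 0%N :> nat) && (j == 0%N :> nat)).
    by rewrite -[Acoef T 0 0]/(Aeps T) T0 !mul0r.
  by rewrite (_ : (_ == _) = false) ?mulr0 //; apply/negbTE; lia.
- move=> r c rc; rewrite restr_test -/T.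
  have p0 := ltnW p_gt1.
  have Z (i j : 'I_p) : (i + j != 1)%N ->
     Acoef T i j * iota b0 ^+ i * (- iota a0) ^+ j * (r == (c + (i + j))%N :> nat)%:R = 0.
    by move=> ij; rewrite (_ : (_ == _) = false) ?mulr0 //; apply/negbTE; lia.
  rewrite (bigD1 (Ordinal p0)) //= (bigD1 (Ordinal p_gt1)) //= big1 => [|j nj]; last first.
    by rewrite (Z (Ordinal p0) j) //=; move: nj; rewrite -val_eqE.
  rewrite (bigD1 (Ordinal p_gt1)) //= (bigD1 (Ordinal p0)) //= big1 => [|j nj]; last first.
    by rewrite (Z (Ordinal p_gt1) j) //=; move: nj; rewrite -val_eqE /=; lia.
  rewrite big1 => [|i /andP[n0 n1]]; last first.
    by rewrite big1 // => j _; rewrite Z //; move: n0 n1; rewrite -!val_eqE /=; lia.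
  rewrite rc ?addn0 ?add0n ?addn1 !eqxx !mulr1; ring.
Qed.

Lemma test_module_supported (i : hopf) (P : hset p k) :
  a0 != 0 \/ b0 != 0 ->
  (forall n f, cocycle (@AC p k) (@Aeps p k) n f ->
     P n f <-> ev idfun (linpt p a0 b0) n f = 0) ->
  supported_at i P test_module.
Proof.
move=> ab Pev Q [K [iota [alpha [[alC al_flat _] nproj QE]]]].
have T0 := pi_eps p_gt1 alpha; have nz := flat_linear_part p_gt1 alC al_flat.
set T := alpha (trT p K) in T0 nz.
have E : Acoef T 1 0 * iota b0 = Acoef T 0 1 * iota a0.
  by apply/eqP; apply: contra_notT nproj; exact: restr_test_projective.
(* The linear part of [T], nonzero by flatness, is parallel to [(a0, b0)]; l is read off a nonzero
   coordinate of the latter. *)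
have [l [l0 lx ly]] : exists l, [/\ l != 0, Acoef T 1 0 = l * iota a0 & Acoef T 0 1 = l * iota b0].
  have [a00|a00] := eqVneq a0 0.
    have b00 : iota b0 != 0 by rewrite fmorph_eq0; case: ab => //; rewrite a00 eqxx.
    have Tx : Acoef T 1 0 = 0.
      by move/eqP: E; rewrite a00 rmorph0 mulr0 mulf_eq0 (negbTE b00) orbF => /eqP.
    exists (Acoef T 0 1 / iota b0); rewrite divfK // a00 rmorph0 mulr0; split=> //.
    by rewrite mulf_neq0 ?invr_eq0 //; case: nz => //; rewrite Tx eqxx.
  have ia0 : iota a0 != 0 by rewrite fmorph_eq0.
  exists (Acoef T 1 0 / iota a0); rewrite divfK //; split=> //; last first.
    by rewrite mulrAC E mulfK.
  rewrite mulf_neq0 ?invr_eq0 //; case: nz => //; apply: contraNneq => Tx.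
  by move/eqP: E; rewrite Tx mul0r eq_sym mulf_eq0 (negbTE ia0) orbF.
have PQ n f : cocycle (@AC p k) (@Aeps p k) n f -> P n f <-> point_of iota alpha n f.
  move=> Zf; rewrite (Pev _ _ Zf) (point_ofP p_gt1 iota alC Zf).
  by rewrite (ev_proportional charkp T0 l0 lx ly Zf).
case: QE => Q1 Q2; split=> n f Zf.
- by move=> /(Q1 n f Zf) /(PQ n f Zf).
- by move=> /(PQ n f Zf) /(Q2 n f Zf).
Qed.

Local Notation N := (jordan p k).
Local Notation V := test_module.
Local Notation tm i := (tens charkp i V V).

Lemma tensmx_scalel (c : k) m n q r (M : 'M[k]_(m, n)) (M' : 'M[k]_(q, r)) :
  (c *: M) *t M' = c *: (M *t M').
Proof. by apply/matrixP => i j; rewrite !mxE mulrA. Qed.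
Lemma tensmx_scaler (c : k) m n q r (M : 'M[k]_(m, n)) (M' : 'M[k]_(q, r)) :
  M *t (c *: M') = c *: (M *t M').
Proof. by apply/matrixP => i j; rewrite !mxE mulrCA. Qed.

(** On the standard tensor product this primitive element acts as the sum of its two zero actions,
    and an isomorphism carries the vanishing over. *)
Lemma tens_iso_kill (i : hopf) : fdmod_iso (tm i) (tm Ga1Ga1) ->
  a0 *: modx (tm i) + b0 *: mody (tm i) = 0.
Proof.
case=> f [g [_ gf fx fy]].
have Z : a0 *: modx (tm Ga1Ga1) + b0 *: mody (tm Ga1Ga1) = 0.
  rewrite /= /tensx /tensy /= !tensmx_scalel !tensmx_scaler.
  by rewrite !scalerDr !scalerA mulrN [b0 * a0]mulrC !scaleNr addrACA !subrr addr0.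
have F : f *m (a0 *: modx (tm i) + b0 *: mody (tm i)) = 0.
  by rewrite mulmxDr -!scalemxAr fx fy !scalemxAl -mulmxDl Z mul0mx.
by rewrite -[LHS]mul1mx -gf -mulmxA F mulmx0.
Qed.

Lemma tens_jordan_entry e e' (i1 i2 j1 j2 : 'I_p) :
  ((N ^+ e) *t (N ^+ e')) (mxtens_index (i1, i2)) (mxtens_index (j1, j2)) =
  ((i1 == (j1 + e)%N :> nat) && (i2 == (j2 + e')%N :> nat))%:R.
Proof. by rewrite tensmxE !(jordan_exp p_gt1) /= -natrM mulnb. Qed.

Lemma tens_iso_exceptional (i : hopf) : fdmod_iso (tm i) (tm Ga1Ga1) ->
  match i with
  | Ga1Ga1 => True
  | Ga2 => b0 = 0
  | Ga1Zp => a0 * b0 = 0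
  | ZpZp => a0 * b0 * (a0 + b0) = 0
  end.
Proof.
move=> /tens_iso_kill; pose N1 := N *t (1%:M : 'M[k]_p); pose N2 := (1%:M : 'M[k]_p) *t N.
have p0 := ltnW p_gt1; pose o := Ordinal p0.
(* The entry in this row and column is the coefficient of t1 t2, for t1 and t2 the two copies of
   [t]. *)
have o11 : (N1 *m N2) (mxtens_index (Ordinal p_gt1, Ordinal p_gt1)) (mxtens_index (o, o)) = 1.
  by rewrite tensmx_mul mul1mx mulmx1 -[N]expr1 tens_jordan_entry.
have can : a0 *: (b0 *: N1 + b0 *: N2) + b0 *: (- a0 *: N1 + - a0 *: N2) = 0.
  by rewrite !scalerDr !scalerA mulrN [b0 * a0]mulrC !scaleNr addrACA !subrr addr0.
case: i => //; rewrite /= /tensx /tensy /= !tensmx_scalel !tensmx_scaler -/N1 -/N2.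
- rewrite [b0 *: (_ + _ + _)]scalerDr addrA can add0r => om.
  have Nx e : (b0 *: N1) ^+ e = b0 ^+ e *: ((N ^+ e) *t 1%:M).
    by rewrite scalemx_exp; congr (_ *: _); exact: (@tens1_exp p k V V N e).
  have Ny e : (b0 *: N2) ^+ e = b0 ^+ e *: (1%:M *t (N ^+ e)).
    by rewrite scalemx_exp; congr (_ *: _); exact: (@tens2_exp p k V V N e).
  have p1 : (p.-1 < p)%N by lia.
  (* This entry is the coefficient of t1 t2^(p-1), which in omega(t1, t2) is 'C(p, 1) / p = 1 and so
     nonzero in k. *)
  have /eqP := congr1 (fun M : 'M[k]_(p * p) =>
    M (mxtens_index (Ordinal p_gt1, Ordinal p1)) (mxtens_index (o, o))) om.
  rewrite mxE [X in _ == X]mxE /omega summxE.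
  rewrite (eq_big_nat _ _ (F2 := fun j => if j == 1%N then b0 ^+ p else 0)); last first.
    move=> j /andP[j1 jp]; rewrite -mulrA mulr_natl Nx Ny -mulmxE -scalemxAl -scalemxAr.
    rewrite tensmx_mul mul1mx mulmx1 scalerA -exprD subnKC 1?ltnW // mulmxnE mxE.
    rewrite tens_jordan_entry /=; have [->|nj] := eqVneq j 1%N.
      by rewrite (_ : (_ && _) = true) ?mulr1 ?bin1 ?divnn ?p0 //; lia.
    by rewrite (_ : (_ && _) = false) ?mulr0 ?mul0rn //; lia.
  rewrite -big_mkcond big_nat1_eq p_gt1 -exprS expf_eq0 => /andP[_ /eqP]; exact.
- rewrite [b0 *: (_ + _ + _)]scalerDr addrA can add0r -mulmxE -scalemxAl -scalemxAr !scalerA.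
  move=> /(congr1 (fun M : 'M[k]_(p * p) =>
    M (mxtens_index (Ordinal p_gt1, Ordinal p_gt1)) (mxtens_index (o, o)))).
  rewrite mxE o11 [X in _ = X]mxE mulr1 => /eqP.
  by rewrite !mulf_eq0 oppr_eq0 -orbA orbb orbC => /orP[] /eqP ->; rewrite ?mulr0 ?mul0r.
- rewrite [b0 *: (_ + _ + _)]scalerDr [a0 *: (_ + _ + _)]scalerDr addrACA can add0r.
  rewrite -!mulmxE -!scalemxAl -!scalemxAr !scalerA.
  move=> /(congr1 (fun M : 'M[k]_(p * p) =>
    M (mxtens_index (Ordinal p_gt1, Ordinal p_gt1)) (mxtens_index (o, o)))).
  rewrite mxE [X in X + _]mxE [X in _ + X]mxE o11 [X in _ = X]mxE => E.
  by rewrite -[RHS]E; ring.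
Qed.

End TestModule.

(** * Noble points *)

Section FlatByAutomorphism.
Variables (p : nat) (p_gt1 : (1 < p)%N) (R : comNzRingType).
Variables (alpha : {rmorphism trunc p R -> A p R}).
Variables (sigma tau : {rmorphism A p R -> A p R}).
Hypothesis sigmaK : forall a, sigma (tau a) = a.
Hypothesis tauK : forall a, tau (sigma a) = a.
Hypothesis alphaE : forall u, alpha u = sigma (trC p u).

(* A is free over K[t]/t^p, with basis the images of the powers of y. *)
Lemma flat_automorphism : flat alpha.
Proof.
pose rho j (s : A p R) : trunc p R := trcoef (tau s) j.
have rhoD j s1 s2 : rho j (s1 + s2) = rho j s1 + rho j s2.
  by rewrite /rho rmorphD trcoefD.
have rhoM j r s : rho j (alpha r * s) = r * rho j s.
  by rewrite /rho alphaE rmorphM tauK trcoefCM.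
have rhoE s : s = \sum_(j < p) alpha (rho j s) * sigma (Ay p R ^+ j).
  rewrite -{1}[s]sigmaK (tr_sum p_gt1 (tau s)) rmorph_sum; apply: eq_bigr => j _.
  by rewrite rmorphM alphaE.
move=> M1 M2 f f_inj l nl Z b bD1 bD2 bM.
have b0l m : b 0 m = 0 by apply: (addrI (b 0 m)); rewrite -bD1 !addr0.
have b0r s : b s 0 = 0 by apply: (addrI (b s 0)); rewrite -bD2 !addr0.
have E s m : b s m = \sum_(j < p) b (sigma (Ay p R ^+ j)) (rho j s *: m).
  rewrite {1}[s]rhoE (big_morph (fun s => b s m) (fun x y => bD1 x y m) (b0l m)).
  by apply: eq_bigr => j _; rewrite bM.
under eq_bigr do rewrite E.
rewrite exchange_big big1 //= => j _.
rewrite -(big_morph (b _) (bD2 _) (b0r _)).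
suff -> : \sum_(u <- l) rho j u.1 *: u.2 = 0 by [].
apply: f_inj; rewrite linear0 linear_sum.
under eq_bigr do rewrite linearZ.
have := nl M2 (fun s m => rho j s *: m); rewrite big_map; apply.
- by move=> s1 s2 m; rewrite rhoD scalerDl.
- by move=> s m1 m2; rewrite scalerDr.
- by move=> r s m; rewrite rhoM mulrC scalerA.
Qed.

End FlatByAutomorphism.

Section Nobility.
Variables (p : nat) (F : fieldType) (charFp : p \in [pchar F]).
Let p_gt1 : (1 < p)%N. Proof. exact: prime_gt1 (pcharf_prime charFp). Qed.
Local Notation AF := (A p F).
Local Notation x := (Ax p F).
Local Notation y := (Ay p F).

Lemma A_eps_x : Aeps x = 0.
Proof. by rewrite /Aeps AxE Acoef_mon //= !andbF. Qed.
Lemma A_eps_y : Aeps y = 0.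
Proof. by rewrite /Aeps AyE Acoef_mon //= !andbF. Qed.

(** [X], [Y] are new coordinates, and [X'], [Y'] express the inverse substitution. The two maps are
    then inverse automorphisms, and [t |-> X] is the standard inclusion followed by one of them. *)
Lemma flat_coordinates (X Y X' Y' : AF) :
  Aeps X = 0 -> Aeps Y = 0 -> Aeps X' = 0 -> Aeps Y' = 0 ->
  (forall s : {rmorphism AF -> AF}, (forall c, s (AC p c) = AC p c) ->
     s x = X -> s y = Y -> s X' = x /\ s Y' = y) ->
  (forall s : {rmorphism AF -> AF}, (forall c, s (AC p c) = AC p c) ->
     s x = X' -> s y = Y' -> s X = x /\ s Y = y) ->
  exists alpha : {rmorphism trunc p F -> AF},
    [/\ forall c, alpha (trC p c) = AC p c, alpha (trT p F) = X & flat alpha].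
Proof.
move=> X0 Y0 X0' Y0' H1 H2.
have [s [sC sx sy]] := @A_lift p F charFp AF (@AC p F) X Y (A_nil charFp X0) (A_nil charFp Y0).
have [t [tC tx ty]] := @A_lift p F charFp AF (@AC p F) X' Y' (A_nil charFp X0') (A_nil charFp Y0').
have [alpha [alC alT]] := A_eps_lift charFp X0.
have [sX sY] := H1 s sC sx sy; have [tX tY] := H2 t tC tx ty.
exists alpha; split=> //; apply: (flat_automorphism p_gt1 (sigma := s) (tau := t)).
- apply: (@A_rmorph_eq p F charFp AF (s \o t) idfun) => [c||] /=.
  + by rewrite tC sC.
  + by rewrite tx.
  + by rewrite ty.
- apply: (@A_rmorph_eq p F charFp AF (t \o s) idfun) => [c||] /=.
  + by rewrite sC tC.
  + by rewrite sx.
  + by rewrite sy.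
- apply: (tr_rmorph_eq p_gt1 (f := alpha) (g := s \o @trC p (trunc p F))) => [c|] /=.
  + by rewrite alC sC.
  + by rewrite alT sx.
Qed.

Lemma flat_linpt a b : a != 0 \/ b != 0 ->
  exists alpha : {rmorphism trunc p F -> AF},
    [/\ forall c, alpha (trC p c) = AC p c, alpha (trT p F) = linpt p a b & flat alpha].
Proof.
have CV c : c != 0 -> AC p c * AC p c^-1 = 1 :> AF.
  by have [AC1 ACM] := @AC_monoid_morphism p F; move=> c0; rewrite -ACM mulfV.
have eps c (u v : AF) d : Aeps u = 0 -> Aeps v = 0 -> Aeps (AC p c * (u - AC p d * v)) = 0.
  by rewrite /Aeps => u0 v0; rewrite AcoefCM // AcoefD AcoefN AcoefCM // u0 v0; ring.
case=> [a0|b0].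
  apply: (@flat_coordinates _ y (AC p a^-1 * (x - AC p b * y)) y).
  - exact: linpt_eps.
  - exact: A_eps_y.
  - by apply: eps; [exact: A_eps_x | exact: A_eps_y].
  - exact: A_eps_y.
  - move=> s sC sx sy; split=> //; rewrite rmorphM rmorphB rmorphM !sC sx sy /linpt.
    by rewrite addrK mulrA [AC p _ * AC p a]mulrC CV // mul1r.
  - move=> s sC sx sy; split=> //; rewrite /linpt rmorphD !rmorphM !sC sx sy.
    by rewrite mulrA CV // mul1r subrK.
apply: (@flat_coordinates _ x y (AC p b^-1 * (x - AC p a * y))).
- exact: linpt_eps.
- exact: A_eps_x.
- exact: A_eps_y.
- by apply: eps; [exact: A_eps_x | exact: A_eps_y].
- move=> s sC sx sy; split=> //; rewrite rmorphM rmorphB rmorphM !sC sx sy /linpt.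
  by rewrite addrC addKr mulrA [AC p _ * AC p b]mulrC CV // mul1r.
- move=> s sC sx sy; split=> //; rewrite /linpt rmorphD !rmorphM !sC sx sy.
  by rewrite mulrA CV // mul1r addrC subrK.
Qed.

(** [1 + y] has order p, so this is g h^(-1) - 1 for the group-like elements g = 1 + x and h = 1 + y
    of (Z/p)^2. *)
Definition mixpt : AF := (1 + x) * (1 + y) ^+ p.-1 - 1.

Lemma pow1y : (1 + y) ^+ p.-1 * (1 + y) = 1.
Proof.
have cA := pchar_A charFp charFp.
rewrite -exprSr prednK ?(ltnW p_gt1) // -(pFrobenius_autE cA) rmorphD rmorph1 /=.
by rewrite pFrobenius_autE (A_nil charFp A_eps_y) addr0.
Qed.

Lemma Acoef10M (u v : AF) : Acoef (u * v) 1 0 = Acoef u 0 0 * Acoef v 1 0 + Acoef u 1 0 * Acoef v 0 0.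
Proof.
by rewrite AcoefM // ?(ltnW p_gt1) // big_ord1 big_ord_recl big_ord1.
Qed.
Lemma Acoef01M (u v : AF) : Acoef (u * v) 0 1 = Acoef u 0 0 * Acoef v 0 1 + Acoef u 0 1 * Acoef v 0 0.
Proof.
by rewrite AcoefM // ?(ltnW p_gt1) // big_ord_recl big_ord1 !big_ord1.
Qed.

Lemma Acoef1 i j : Acoef (1 : AF) i j = ((i == 0%N) && (j == 0%N))%:R.
Proof. by rewrite -(rmorph1 (@AC p F)) AcoefC //; case: (_ && _). Qed.

Let AxE' i j : Acoef x i j = ((i == 1%N) && (j == 0%N))%:R.
Proof.
rewrite AxE Acoef_mon //=; case: eqP => [->|_]; last by rewrite !andbF.
by case: eqP => [->|_]; rewrite ?andbF // p_gt1 ltnW.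
Qed.
Let AyE' i j : Acoef y i j = ((i == 0%N) && (j == 1%N))%:R.
Proof.
rewrite AyE Acoef_mon //=; case: eqP => [->|_]; last by rewrite !andbF.
by case: eqP => [->|_]; rewrite ?andbF // p_gt1 ltnW.
Qed.

Lemma Acoef_pow1y m : [/\ Acoef ((1 + y) ^+ m) 0 0 = 1, Acoef ((1 + y) ^+ m) 1 0 = 0
  & Acoef ((1 + y) ^+ m) 0 1 = m%:R].
Proof.
elim: m => [|m [IH0 IH1 IH2]]; first by rewrite !expr0 !Acoef1.
rewrite exprS; split.
- by rewrite -[LHS]/(Aeps _) AepsM // /Aeps IH0 mulr1 AcoefD Acoef1 AyE' /= addr0.
- by rewrite Acoef10M IH0 IH1 !AcoefD !Acoef1 !AyE' /=; ring.
- by rewrite Acoef01M IH0 IH2 !AcoefD !Acoef1 !AyE' /= -natr1; ring.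
Qed.

Lemma mixpt_coef : [/\ Aeps mixpt = 0, Acoef mixpt 1 0 = 1 & Acoef mixpt 0 1 = -1].
Proof.
have [E0 E1 E2] := Acoef_pow1y p.-1.
have pm1 : (p.-1)%:R = -1 :> F.
  apply/eqP; rewrite -addr_eq0 natr1 prednK ?(ltnW p_gt1) //.
  by rewrite (pcharf0 charFp).
rewrite /mixpt; split.
- rewrite /Aeps AcoefD AcoefN -[X in X - _]/(Aeps _) AepsM // /Aeps E0 AcoefD !Acoef1 AxE' /=.
  by ring.
- by rewrite AcoefD AcoefN Acoef10M E0 E1 !AcoefD !Acoef1 !AxE' /=; ring.
- by rewrite AcoefD AcoefN Acoef01M E0 E2 !AcoefD !Acoef1 !AxE' /= pm1; ring.
Qed.

Lemma flat_mixpt : exists alpha : {rmorphism trunc p F -> AF},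
  [/\ forall c, alpha (trC p c) = AC p c, alpha (trT p F) = mixpt & flat alpha].
Proof.
have [E0 _ _] := mixpt_coef.
apply: (@flat_coordinates _ y ((1 + x) * (1 + y) - 1) y) => //; do ?exact: A_eps_y.
- rewrite /Aeps AcoefD AcoefN -[X in X - _]/(Aeps _) AepsM // /Aeps !AcoefD !Acoef1.
  by rewrite AxE' AyE' /=; ring.
- move=> s sC sx sy; split=> //; rewrite rmorphB rmorphM !rmorphD !rmorph1 sx sy /mixpt.
  by rewrite [1 + (_ - 1)]addrC subrK -mulrA pow1y mulr1 addrC addKr.
- move=> s sC sx sy; split=> //; rewrite /mixpt rmorphB rmorphM rmorphXn !rmorphD !rmorph1 sx sy.
  by rewrite [1 + (_ - 1)]addrC subrK -mulrA [(1 + y) * _]mulrC pow1y mulr1 addrC addKr.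
Qed.

End Nobility.

(** * Hopf subalgebras generated by one element *)

Section CoproductNilpotence.
Variables (p : nat) (S : comNzRingType) (cS : p \in [pchar S]).

Lemma pchar_expD (u v : S) : (u + v) ^+ p = u ^+ p + v ^+ p.
Proof. by rewrite -!(pFrobenius_autE cS) rmorphD. Qed.

Lemma coprodx_nil i (x1 x2 : S) : x1 ^+ p = 0 -> x2 ^+ p = 0 -> coprodx i x1 x2 ^+ p = 0.
Proof.
by move=> z1 z2; case: i; rewrite /= !pchar_expD ?exprMn z1 z2 ?mul0r ?addr0.
Qed.

Lemma omega_nil (x1 x2 : S) : x1 ^+ p = 0 -> omega p x1 x2 ^+ p = 0.
Proof.
move=> z1; rewrite /omega big_nat; rewrite big_seq_cond.
rewrite -(pFrobenius_autE cS) rmorph_sum big1 // => j /andP[_ /andP[j1 _]].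
rewrite /= pFrobenius_autE !exprMn -(prednK j1) exprS exprMn z1.
by rewrite mul0r mulr0 mul0r.
Qed.

Lemma coprody_nil i (x1 y1 x2 y2 : S) : x1 ^+ p = 0 -> y1 ^+ p = 0 -> y2 ^+ p = 0 ->
  coprody p i x1 y1 x2 y2 ^+ p = 0.
Proof.
move=> z1 w1 w2; case: i; rewrite /= !pchar_expD ?exprMn w1 w2 ?omega_nil //;
  by rewrite ?mul0r ?addr0.
Qed.

End CoproductNilpotence.

Section HopfImages.
Variables (p : nat) (F : fieldType) (charFp : p \in [pchar F]).
Let p_gt1 : (1 < p)%N. Proof. exact: prime_gt1 (pcharf_prime charFp). Qed.
Local Notation AF := (A p F).
Local Notation AA := (A p (A p F)).
Local Notation x := (Ax p F).
Local Notation y := (Ay p F).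
Let cA : p \in [pchar AF] := pchar_A charFp charFp.
Let cAA : p \in [pchar AA] := pchar_A charFp cA.

(** Identifies the explicit sums defining [inr_AA], [coprod] and [antip] with algebra maps given by
    the universal property. *)
Lemma Aev_rmorph (S : comNzRingType) (f : F -> S) (phi : {rmorphism AF -> S}) a :
  (forall c, phi (AC p c) = f c) -> Aev f a (phi x) (phi y) = phi a.
Proof.
move=> phiC; rewrite [in RHS](A_sum p_gt1 a) rmorph_sum; apply: eq_bigr => i _.
rewrite rmorph_sum; apply: eq_bigr => j _.
by rewrite /mon !rmorphM !rmorphXn phiC mulrA.
Qed.

Let inlF : {rmorphism F -> AA} := @AC p AF \o @AC p F.

Lemma inl_exp_p (a : AF) : a ^+ p = 0 -> (AC p a : AA) ^+ p = 0.
Proof. by move=> a0; rewrite -(rmorphXn (@AC p AF)) a0 (rmorph0 (@AC p AF)). Qed.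

Lemma Axp (R : comNzRingType) : Ax p R ^+ p = 0.
Proof. by rewrite -(rmorphXn (@trC p (trunc p R))) trTp // rmorph0. Qed.
Lemma Ayp (R : comNzRingType) : Ay p R ^+ p = 0.
Proof. exact: trTp. Qed.

Lemma inr_rmorph : exists phi : {rmorphism AF -> AA},
  [/\ forall a, inr_AA a = phi a, forall c, phi (AC p c) = AC p (AC p c),
      phi x = Ax p AF & phi y = Ay p AF].
Proof.
have [phi [phiC phix phiy]] := @A_lift p F charFp AA inlF _ _ (Axp AF) (Ayp AF).
exists phi; split; [move=> a | exact: phiC | exact: phix | exact: phiy].
rewrite -(Aev_rmorph a phiC) phix phiy; reflexivity.
Qed.

Lemma coprod_rmorph i : exists phi : {rmorphism AF -> AA},
  [/\ forall a, coprod i a = phi a, forall c, phi (AC p c) = AC p (AC p c),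
      phi x = coprodx i (inl_AA x) (inr_AA x)
    & phi y = coprody p i (inl_AA x) (inl_AA y) (inr_AA x) (inr_AA y)].
Proof.
have [r [rE _ rx ry]] := inr_rmorph.
have x1 : inl_AA x ^+ p = 0 := inl_exp_p (Axp F).
have y1 : inl_AA y ^+ p = 0 := inl_exp_p (Ayp F).
have x2 : inr_AA x ^+ p = 0 by rewrite rE rx Axp.
have y2 : inr_AA y ^+ p = 0 by rewrite rE ry Ayp.
have [phi [phiC phix phiy]] := @A_lift p F charFp AA inlF _ _
  (coprodx_nil cAA i x1 x2) (coprody_nil cAA i (inr_AA x) x1 y1 y2).
exists phi; split; [move=> a | exact: phiC | exact: phix | exact: phiy].
rewrite -(Aev_rmorph a phiC) phix phiy; reflexivity.
Qed.

Lemma antip_rmorph i : exists phi : {rmorphism AF -> AF},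
  [/\ forall a, antip i a = phi a, forall c, phi (AC p c) = AC p c,
      phi x = antipx p F i & phi y = antipy p F i].
Proof.
have nil_mul (z : AF) : z ^+ p = 0 -> antip_mul z ^+ p = 0.
  move=> z0; apply: (A_nil charFp); rewrite /antip_mul.
  have e1 : Aeps (1 : AF) = 1 by rewrite /Aeps Acoef1.
  have eX (u : AF) m : Aeps (u ^+ m) = Aeps u ^+ m.
    elim: m => [|m IH]; first by rewrite !expr0.
    by rewrite !exprS AepsM // IH.
  have ez : Aeps z = 0.
    have /eqP := eX z p; rewrite z0 /Aeps Acoef0 eq_sym expf_eq0 => /andP[_ /eqP]; exact.
  rewrite [Aeps _]AcoefD AcoefN -[X in X - _]/(Aeps _) eX.
  by rewrite [Aeps _]AcoefD -![Acoef _ 0 0]/(Aeps _) e1 ez addr0 expr1n subrr.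
have nil_opp (z : AF) : z ^+ p = 0 -> (- z) ^+ p = 0.
  by move=> z0; rewrite exprNn z0 mulr0.
have X0 : antipx p F i ^+ p = 0.
  by case: (i); [exact: nil_opp (Axp F) | exact: nil_opp (Axp F) | exact: nil_opp (Axp F)
    | exact: nil_mul (Axp F)].
have Y0 : antipy p F i ^+ p = 0.
  by case: (i); [exact: nil_opp (Ayp F) | exact: nil_opp (Ayp F) | exact: nil_mul (Ayp F)
    | exact: nil_mul (Ayp F)].
have [phi [phiC phix phiy]] := @A_lift p F charFp AF (@AC p F) _ _ X0 Y0.
exists phi; split; [move=> a | exact: phiC | exact: phix | exact: phiy].
rewrite -(Aev_rmorph a phiC) phix phiy; reflexivity.
Qed.

Variable alpha : {rmorphism trunc p F -> AF}.
Hypothesis alphaC : forall c, alpha (trC p c) = AC p c.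
Local Notation T := (alpha (trT p F)).
Local Notation H := (fun a => exists u, a = alpha u).

Definition split_in (K : AF -> Prop) (z : AA) : Prop :=
  exists2 s : seq (AF * AF), (forall u, u \in s -> K u.1 /\ K u.2) &
    z = \sum_(u <- s) inl_AA u.1 * inr_AA u.2.

Lemma split_pure (K : AF -> Prop) a b : K a -> K b -> split_in K (inl_AA a * inr_AA b).
Proof.
move=> Ka Kb; exists [:: (a, b)]; last by rewrite big_seq1.
by move=> u; rewrite inE => /eqP ->.
Qed.

Lemma splitD (K : AF -> Prop) z w : split_in K z -> split_in K w -> split_in K (z + w).
Proof.
move=> [s Ks ->] [s' Ks' ->]; exists (s ++ s'); last by rewrite big_cat.
by move=> u; rewrite mem_cat => /orP[/Ks|/Ks'].
Qed.

Lemma split0 (K : AF -> Prop) : split_in K 0.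
Proof. by exists [::] => //; rewrite big_nil. Qed.

Lemma splitM (K : AF -> Prop) z w : (forall a b, K a -> K b -> K (a * b)) ->
  split_in K z -> split_in K w -> split_in K (z * w).
Proof.
have [r [rE _ _ _]] := inr_rmorph.
move=> KM [s Ks ->] [s' Ks' ->].
exists [seq (u.1 * v.1, u.2 * v.2) | u <- s, v <- s'].
  move=> _ /allpairsP[[u v] /= [/Ks[K1 K2] /Ks'[K3 K4] ->]] /=.
  by split; exact: KM.
rewrite big_allpairs_dep mulr_suml; apply: eq_bigr => u _.
rewrite mulr_sumr; apply: eq_bigr => v _ /=.
rewrite !rE (rmorphM r) /inl_AA (rmorphM (@AC p AF)) -!mulrA; congr (_ * _).
by rewrite mulrCA.
Qed.

(** The image is generated by [T] over the constants, and the coproduct and antipode are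
    multiplicative, so they need checking on [T] alone. *)
Lemma image_hopf_subalgebra i : split_in H (coprod i T) -> H (antip i T) ->
  hopf_subalgebra i H.
Proof.
have [r [rE _ _ _]] := inr_rmorph.
move=> HT [v vT].
have H1 : H 1 by exists 1; rewrite rmorph1.
have HM a b : H a -> H b -> H (a * b).
  by move=> [u ->] [w ->]; exists (u * w); rewrite rmorphM.
have HL c a b : H a -> H b -> H (AC p c * a + b).
  by move=> [u ->] [w ->]; exists (trC p c * u + w); rewrite rmorphD rmorphM alphaC.
split; [exact: H1 | exact: HL | exact: HM | |]; move=> a [u ->].
  rewrite -/(split_in H (coprod i (alpha u))).
  have [phi [phiE phiC _ _]] := coprod_rmorph i; rewrite phiE.
  rewrite (tr_sum p_gt1 u) !rmorph_sum; elim/big_ind: _ => [|z w Hz Hw|j _].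
  - exact: split0.
  - exact: splitD.
  rewrite !rmorphM !rmorphXn alphaC phiC; apply: splitM; first exact: HM.
    have -> : AC p (AC p (trcoef u j)) = inl_AA (AC p (trcoef u j)) * inr_AA 1.
      by rewrite rE rmorph1 mulr1.
    by apply: split_pure; [exists (trC p (trcoef u j)); rewrite alphaC | exact: H1].
  rewrite -phiE; elim: (j : nat) => [|m IH]; last first.
    by rewrite exprS; apply: splitM; [exact: HM | exact: HT | exact: IH].
  have -> : (coprod i T) ^+ 0 = inl_AA 1 * inr_AA 1.
    by rewrite expr0 rE rmorph1 mulr1 /inl_AA (rmorph1 (@AC p AF)).
  by apply: split_pure; exact: H1.
have [phi [phiE phiC _ _]] := antip_rmorph i; rewrite phiE.
exists (\sum_(j < p) trC p (trcoef u j) * v ^+ j).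
rewrite {1}(tr_sum p_gt1 u) !rmorph_sum; apply: eq_bigr => j _.
by rewrite !rmorphM !rmorphXn !alphaC phiC -phiE vT.
Qed.

Lemma split_additive i : coprod i T = inl_AA T + inr_AA T -> split_in H (coprod i T).
Proof.
have [r [rE _ _ _]] := inr_rmorph.
move=> ->; have H1 : H 1 by exists 1; rewrite rmorph1.
have HT : H T by exists (trT p F).
apply: splitD.
  have -> : inl_AA T = inl_AA T * inr_AA 1 by rewrite rE rmorph1 mulr1.
  exact: split_pure.
have -> : inr_AA T = inl_AA 1 * inr_AA T by rewrite /inl_AA (rmorph1 (@AC p AF)) mul1r.
exact: split_pure.
Qed.

Lemma split_multiplicative i :
  coprod i T = inl_AA T + inr_AA T + inl_AA T * inr_AA T -> split_in H (coprod i T).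
Proof.
have [r [rE _ _ _]] := inr_rmorph.
move=> ->; have H1 : H 1 by exists 1; rewrite rmorph1.
have HT : H T by exists (trT p F).
apply: splitD; last exact: split_pure.
apply: splitD.
  have -> : inl_AA T = inl_AA T * inr_AA 1 by rewrite rE rmorph1 mulr1.
  exact: split_pure.
have -> : inr_AA T = inl_AA 1 * inr_AA T by rewrite /inl_AA (rmorph1 (@AC p AF)) mul1r.
exact: split_pure.
Qed.

End HopfImages.

(** * Subgroups realising the noble points *)

Section NoblePoints.
Variables (p : nat) (k : fieldType) (charkp : p \in [pchar k]).
Let p_gt1 : (1 < p)%N. Proof. exact: prime_gt1 (pcharf_prime charkp). Qed.
Local Notation Ak := (A p k).
Local Notation x := (Ax p k).
Local Notation y := (Ay p k).
Local Notation image alpha := (fun a : Ak => exists u, a = alpha u).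

Lemma linpt10 : linpt p 1 0 = x :> Ak.
Proof.
by rewrite /linpt (rmorph1 (@AC p k)) (rmorph0 (@AC p k)) mul1r mul0r addr0.
Qed.
Lemma linpt01 : linpt p 0 1 = y :> Ak.
Proof.
by rewrite /linpt (rmorph1 (@AC p k)) (rmorph0 (@AC p k)) mul1r mul0r add0r.
Qed.

(** The image of [alpha] itself serves as the unipotent subgroup, the augmentation ideal of [A]
    being nil. Only the direction of the linear part matters, whence the factor [l]. *)
Lemma noble_intro (P : hset p k) (a0 b0 l : k) (i : hopf)
    (alpha : {rmorphism trunc p k -> Ak}) :
  (forall n f, cocycle (@AC p k) (@Aeps p k) n f ->
     P n f <-> ev idfun (linpt p a0 b0) n f = 0) ->
  (forall c, alpha (trC p c) = AC p c) -> flat alpha ->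
  hopf_subalgebra i (image alpha) -> l != 0 ->
  Acoef (alpha (trT p k)) 1 0 = l * a0 -> Acoef (alpha (trT p k)) 0 1 = l * b0 ->
  noble i P.
Proof.
move=> Pev alC al_flat al_hopf l0 lx ly.
exists k, idfun, alpha; split=> //.
  split=> //; exists (image alpha); split=> // [a _ a0'|u]; last by exists u.
  by exists p.*2.-1; exact: Aeps_nilpotent.
have T0 := pi_eps p_gt1 alpha.
have PQ n f : cocycle (@AC p k) (@Aeps p k) n f -> P n f <-> point_of idfun alpha n f.
  move=> Zf; rewrite (Pev _ _ Zf) (point_ofP p_gt1 idfun alC Zf).
  by rewrite (ev_proportional charkp (iota := idfun) T0 l0 lx ly Zf).
by split=> n f Zf /(PQ n f Zf).
Qed.

Lemma hopf_linpt (alpha : {rmorphism trunc p k -> Ak}) a b :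
  (forall c, alpha (trC p c) = AC p c) -> alpha (trT p k) = linpt p a b ->
  hopf_subalgebra Ga1Ga1 (image alpha).
Proof.
move=> alC alT; apply: (image_hopf_subalgebra charkp alC).
  apply: (split_additive charkp); rewrite alT.
  have [phi [phiE phiC phix phiy]] := coprod_rmorph charkp Ga1Ga1.
  have [r [rE rC rx ry]] := inr_rmorph charkp.
  rewrite phiE rE /linpt (rmorphD phi) !(rmorphM phi) !phiC phix phiy /=.
  rewrite (rmorphD r) !(rmorphM r) !rC /inl_AA (rmorphD (@AC p Ak)) !(rmorphM (@AC p Ak)).
  by rewrite !rE !mulrDr addrACA.
have [phi [phiE phiC phix phiy]] := antip_rmorph charkp Ga1Ga1.
exists (- trT p k); rewrite rmorphN alT phiE /linpt rmorphD !rmorphM !phiC phix phiy /=.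
by rewrite !mulrN -opprD.
Qed.

Lemma hopf_x_additive (alpha : {rmorphism trunc p k -> Ak}) i :
  (forall c, alpha (trC p c) = AC p c) -> alpha (trT p k) = x ->
  coprodx i (inl_AA x) (inr_AA x) = inl_AA x + inr_AA x -> antipx p k i = - x ->
  hopf_subalgebra i (image alpha).
Proof.
move=> alC alT ci ai; apply: (image_hopf_subalgebra charkp alC).
  apply: (split_additive charkp); rewrite alT.
  by have [phi [phiE phiC phix phiy]] := coprod_rmorph charkp i; rewrite phiE phix ci.
have [phi [phiE phiC phix phiy]] := antip_rmorph charkp i.
by exists (- trT p k); rewrite rmorphN alT phiE phix ai.
Qed.

Lemma antip_mul_image (alpha : {rmorphism trunc p k -> Ak}) :
  image alpha (antip_mul (alpha (trT p k))).
Proof.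
exists ((1 + trT p k) ^+ p.-1 - 1).
by rewrite rmorphB rmorphXn rmorphD !rmorph1.
Qed.

Lemma hopf_x_ZpZp (alpha : {rmorphism trunc p k -> Ak}) :
  (forall c, alpha (trC p c) = AC p c) -> alpha (trT p k) = x ->
  hopf_subalgebra ZpZp (image alpha).
Proof.
move=> alC alT; apply: (image_hopf_subalgebra charkp alC).
  apply: (split_multiplicative charkp); rewrite alT.
  have [phi [phiE phiC phix phiy]] := coprod_rmorph charkp ZpZp; rewrite phiE phix.
  reflexivity.
have [phi [phiE phiC phix phiy]] := antip_rmorph charkp ZpZp.
rewrite phiE alT phix; have := antip_mul_image alpha; rewrite alT; exact.
Qed.

Lemma hopf_y (alpha : {rmorphism trunc p k -> Ak}) i : i = Ga1Zp \/ i = ZpZp ->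
  (forall c, alpha (trC p c) = AC p c) -> alpha (trT p k) = y ->
  hopf_subalgebra i (image alpha).
Proof.
move=> ii alC alT; apply: (image_hopf_subalgebra charkp alC).
  apply: (split_multiplicative charkp); rewrite alT.
  have [phi [phiE phiC phix phiy]] := coprod_rmorph charkp i; rewrite phiE phiy.
  case: ii => ->; reflexivity.
have [phi [phiE phiC phix phiy]] := antip_rmorph charkp i.
rewrite phiE alT phiy; have := antip_mul_image alpha; rewrite alT; case: ii => ->; exact.
Qed.

(** A product of group-like elements is group-like, and its inverse is its power [p.-1]. *)
Lemma hopf_mixpt (alpha : {rmorphism trunc p k -> Ak}) :
  (forall c, alpha (trC p c) = AC p c) -> alpha (trT p k) = mixpt p k ->
  hopf_subalgebra ZpZp (image alpha).
Proof.
move=> alC alT; apply: (image_hopf_subalgebra charkp alC).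
  apply: (split_multiplicative charkp); rewrite alT.
  have [phi [phiE phiC phix phiy]] := coprod_rmorph charkp ZpZp.
  have [r [rE rC rx ry]] := inr_rmorph charkp.
  rewrite phiE; have gl (u : A p Ak) v w : u + 1 = (v + 1) * (w + 1) -> u = v + w + v * w.
    by move=> E; apply: (addIr 1); rewrite E; ring.
  have mixE (f : {rmorphism Ak -> A p Ak}) :
      f (mixpt p k) + 1 = (1 + f x) * (1 + f y) ^+ p.-1.
    by rewrite /mixpt (rmorphB f) (rmorphM f) (rmorphXn f) !(rmorphD f) (rmorph1 f) subrK.
  apply: gl; rewrite rE (mixE phi) (mixE r) -[inl_AA _]/(AC p (mixpt p k)) (mixE (@AC p Ak)).
  rewrite phix phiy /= !rE -![inl_AA _]/(AC p _).
  have E (v w : A p Ak) : 1 + (v + w + v * w) = (1 + v) * (1 + w) by ring.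
  by rewrite !E exprMn mulrACA.
have [phi [phiE phiC phix phiy]] := antip_rmorph charkp ZpZp.
have := antip_mul_image alpha; rewrite alT phiE /mixpt /antip_mul.
rewrite (rmorphB phi) (rmorphM phi) (rmorphXn phi) !(rmorphD phi) (rmorph1 phi) phix phiy /=.
by rewrite /antip_mul [1 + (_ - 1)]addrC subrK [1 + (_ - 1)]addrC subrK
  [1 + (_ - 1)]addrC subrK exprMn.
Qed.

End NoblePoints.

Theorem lemma3p2p3 (p : nat) (k : closedFieldType) (charkp : p \in [pchar k])
    (i : hopf) (P : hset p k) :
  closed_point P -> ignoble i P ->
  exists V W : fdmod p k,
    [/\ supported_at i P V, supported_at i P W
      & ~ fdmod_iso (tens charkp i V W) (tens charkp Ga1Ga1 V W)].
Proof.
move=> /(closed_point_linear charkp)[a [b [ab Pev]]] ign.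
exists (test_module charkp a b), (test_module charkp a b).
split; [exact: test_module_supported | exact: test_module_supported |].
have noble_x (E : b = 0) : (forall alpha : {rmorphism trunc p k -> A p k},
     (forall c, alpha (trC p c) = AC p c) -> alpha (trT p k) = Ax p k ->
     hopf_subalgebra i (fun a => exists u, a = alpha u)) -> False.
  move=> Hx; have a0 : a != 0 by case: ab => //; rewrite E eqxx.
  have [alpha [alC alT fl]] := flat_linpt charkp (or_introl (oner_neq0 k) : 1 != 0 \/ 0 != 0).
  apply: ign; apply: (noble_intro charkp Pev alC fl (l := a^-1)).
  - by apply: Hx => //; rewrite alT linpt10.
  - by rewrite invr_eq0.
  - by rewrite alT linptx // mulVf.
  - by rewrite alT linpty // E mulr0.
have noble_y (E : a = 0) : (forall alpha : {rmorphism trunc p k -> A p k},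
     (forall c, alpha (trC p c) = AC p c) -> alpha (trT p k) = Ay p k ->
     hopf_subalgebra i (fun a => exists u, a = alpha u)) -> False.
  move=> Hy; have b0 : b != 0 by case: ab => //; rewrite E eqxx.
  have [alpha [alC alT fl]] := flat_linpt charkp (or_intror (oner_neq0 k) : 0 != 0 \/ 1 != 0).
  apply: ign; apply: (noble_intro charkp Pev alC fl (l := b^-1)).
  - by apply: Hy => //; rewrite alT linpt01.
  - by rewrite invr_eq0.
  - by rewrite alT linptx // E mulr0.
  - by rewrite alT linpty // mulVf.
move=> /tens_iso_exceptional; case: i ign noble_x noble_y => ign noble_x noble_y.
(* For the standard structure every a x + b y is primitive, so no closed point is ignoble. *)
- move=> _; have [alpha [alC alT fl]] := flat_linpt charkp ab.
  apply: ign; apply: (noble_intro charkp Pev alC fl (l := 1)).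
  + exact: (hopf_linpt charkp alC alT).
  + exact: oner_neq0.
  + by rewrite alT linptx // mul1r.
  + by rewrite alT linpty // mul1r.
- move=> /noble_x; apply=> alpha alC alT; exact: (hopf_x_additive charkp alC alT).
- move=> /eqP; rewrite mulf_eq0 => /orP[] /eqP; [move/noble_y | move/noble_x]; apply=> alpha alC alT.
  + by apply: (hopf_y charkp _ alC alT); left.
  + exact: (hopf_x_additive charkp alC alT).
move=> /eqP; rewrite !mulf_eq0 -orbA => /or3P[] /eqP.
- by move/noble_y; apply=> alpha alC alT; apply: (hopf_y charkp _ alC alT); right.
- by move/noble_x; apply=> alpha alC alT; exact: (hopf_x_ZpZp charkp alC alT).
move=> /eqP; rewrite addr_eq0 => /eqP aE.
have b0 : b != 0 by apply/negP => /eqP bE; case: ab; rewrite ?aE ?bE ?oppr0 eqxx.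
have [alpha [alC alT fl]] := flat_mixpt charkp; have [_ m1 m2] := mixpt_coef charkp.
(* [mixpt] has linear part (1, -1), which is - b^-1 times (a, b) because a = - b. *)
apply: ign; apply: (noble_intro charkp Pev alC fl (l := - b^-1)).
- exact: (hopf_mixpt charkp alC alT).
- by rewrite oppr_eq0 invr_eq0.
- by rewrite alT m1 aE mulrNN mulVf.
- by rewrite alT m2 mulNr mulVf.
Qed.
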